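(* Let $k\ge 3$ and let $\widehat{F}$ be a pattern of $K_k$ with exactly two classes, one of which (viewed as a graph formed by its edges) is a graph $J$ with Ramsey number $R(J,J)\le k$. Then for $n$ sufficiently large, the number of $3$-edge-colorings avoiding $\widehat{F}$ is maximized, among all graphs on $n$ vertices, by the Turán graph $T_{k-1}(n)$; that is, $c_{3,\widehat{F}}(T_{k-1}(n))=c_{3,\widehat{F}}(n)$.
   Context: All graphs are finite and simple. A pattern of $K_k$ is a partition of $E(K_k)$ into classes; it can be realized as a coloring of $K_k$ with one color per class. A $3$-edge-coloring of a graph $G$ assigns one of $3$ colors to each edge (not necessarily properly). A copy of $\widehat{F}$ in such a coloring is a set of $k$ pairwise adjacent vertices admitting a bijection to $V(K_k)$ under which two edges have the same color in $G$ iff their images lie in the same class of $\widehat{F}$. A coloring avoids $\widehat{F}$ if it contains no copy. $c_{3,\widehat{F}}(G)$ is the number of $3$-edge-colorings of $G$ avoiding $\widehat{F}$, and $c_{3,\widehat{F}}(n)$ its maximum over all $n$-vertex graphs. $R(J,J)$ is the least $\ell$ such that every $2$-edge-coloring of $K_\ell$ contains a monochromatic copy of $J$. $T_{k-1}(n)$ is the complete $(k-1)$-partite graph on $n$ vertices with parts of sizes as equal as possible. *)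

(* Defs.v *)
From mathcomp Require Import all_boot.
Set Implicit Arguments. Unset Strict Implicit. Unset Printing Implicit Defensive.

Definition is_graph n (E : {set {set 'I_n}}) : bool := [forall e in E, #|e| == 2].

Definition edgesK k : {set {set 'I_k}} := [set e : {set 'I_k} | #|e| == 2].

(* A pattern of K_k is given by a labeling pat of the edges of K_k; the
   classes of the partition are the fibres of pat on edgesK k. *)
Definition pclasses k (pat : {set 'I_k} -> nat) : seq nat :=
  undup [seq pat e | e <- enum (edgesK k)].
Definition num_classes k (pat : {set 'I_k} -> nat) : nat := size (pclasses pat).
Definition pclass k (pat : {set 'I_k} -> nat) (a : nat) : {set {set 'I_k}} :=
  [set e in edgesK k | pat e == a].

(* A 3-edge-coloring of E: c : {ffun {set 'I_n} -> 'I_3}, normalized to be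
   ord0 off the edge set (so colorings of E correspond bijectively). *)
Definition coloring_of n (E : {set {set 'I_n}}) (c : {ffun {set 'I_n} -> 'I_3}) : bool :=
  [forall e, (e \notin E) ==> (c e == ord0)].

Definition clique_map n k (E : {set {set 'I_n}}) (f : {ffun 'I_k -> 'I_n}) : bool :=
  injectiveb f && [forall i, forall j, (i != j) ==> ([set f i; f j] \in E)].

Definition is_copy n k (pat : {set 'I_k} -> nat) (E : {set {set 'I_n}})
    (c : {ffun {set 'I_n} -> 'I_3}) (f : {ffun 'I_k -> 'I_n}) : bool :=
  clique_map E f &&
  [forall e1 in edgesK k, forall e2 in edgesK k,
     (c (f @: e1) == c (f @: e2)) == (pat e1 == pat e2)].

Definition avoids n k (pat : {set 'I_k} -> nat) (E : {set {set 'I_n}})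
    (c : {ffun {set 'I_n} -> 'I_3}) : bool :=
  ~~ [exists f, is_copy pat E c f].

Definition c3 n k (pat : {set 'I_k} -> nat) (E : {set {set 'I_n}}) : nat :=
  #|[set c : {ffun {set 'I_n} -> 'I_3} | coloring_of E c && avoids pat E c]|.

Definition c3max k (pat : {set 'I_k} -> nat) (n : nat) : nat :=
  \max_(E : {set {set 'I_n}} | is_graph E) c3 pat E.

Definition turan (r n : nat) : {set {set 'I_n}} :=
  [set e : {set 'I_n} | [exists u : 'I_n, exists v : 'I_n,
     (e == [set u; v]) && (u %% r != v %% r)]].

(* Ramsey numbers. J is a graph given by its edge set (its vertices are
   those covered by edges). *)
Definition gverts k (J : {set {set 'I_k}}) : {set 'I_k} := \bigcup_(e in J) e.

Definition mono_copy k l (J : {set {set 'I_k}}) (d : {set 'I_l} -> bool) (b : bool) : Prop :=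
  exists f : 'I_k -> 'I_l,
    {in gverts J &, injective f} /\ (forall e, e \in J -> d (f @: e) = b).

Definition ramsey_prop k (J : {set {set 'I_k}}) (l : nat) : Prop :=
  forall d : {set 'I_l} -> bool, exists b, mono_copy J d b.

Definition ramsey_le k (J : {set {set 'I_k}}) (m : nat) : Prop :=
  exists l, l <= m /\ ramsey_prop J l.

(* Main.v *)
Require Import Defs.
From Stdlib Require Import FunctionalExtensionality.
From mathcomp Require Import all_boot all_order all_algebra all_fingroup.
From mathcomp Require Import zify ring lra.
From mathcomp Require Import reals exp.
From mathcomp Require Import Rstruct.
Set Implicit Arguments. Unset Strict Implicit. Unset Printing Implicit Defensive.
Import Order.TTheory GRing.Theory Num.Theory.

(** Let [r = k - 1].  By symmetrization some extremal graph is complete multipartite; suppose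
    it has more than [r] parts.  A colouring is described, up to few edges, by a template that
    gives each pair of vertices the list of colours frequent between their regularity classes.
    By the Ramsey hypothesis the pairs whose list has size at least 2 and contains a fixed
    colour span few copies of [K_k], so [3 e3 + 2 e2] is at most [3 e(T_r(n)) + o(n^2)], where
    [ei] counts the pairs with a list of size [i]; as [2^3 < 3^2], having [3^e(T_r(n))]
    colourings forces [e3] to be close to [e(T_r(n))].  One pair with a nonempty list in a
    [K_k] with all other lists full already yields the pattern, hence the common
    neighbourhood of an [(r-1)]-clique of full pairs is almost contained in one part, and
    there are [r] parts of size close to [n/r].  In almost all colourings a vertex outside
    these parts lacks a colour on at least three of them, so by [8 < 9] deleting it loses a
    smaller factor than deleting a vertex of [T_r(n)]; such a gain can be iterated only
    boundedly often. *)

(** Two facts about a two-class pattern fix the numbers. Two edges at a vertex can receive any two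
    prescribed colours, while three edges cannot receive three different ones; so, in a typical
    colouring, a vertex that lacks colours on at most two of the [r] large parts still completes a
    copy, and three is the threshold. Lacking a colour on three parts of size [n/r] leaves about
    [3^(n-3n/r) 2^(3n/r)] rows at the vertex, against [3^(n-n/r)] in the Turán graph. After
    symmetrization only part sizes matter, and it suffices to find one vertex whose deletion loses a
    factor 3 less than in [T_r(n)]. A part with more than [n/r + 1] vertices supplies one at once.
    Otherwise this upper bound turns a lower bound that holds on average over [r]-cliques into one
    for every vertex of a single clique. Regularity is needed only against the colour neighbourhoods
    of [k] vertices, so the [exp(O(n))] templates are negligible against savings of order [n^2] in
    the exponent. *)

Lemma perm_extension (T : finType) (A : {set T}) (f : T -> T) :
  {in A &, injective f} -> exists s : {perm T}, {in A, s =1 f}.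
Proof.
move=> finj; have [x0 A0|A0] := pickP (mem A); last first.
  by exists 1%g => x xA; have := A0 x; rewrite /= xA.
pose B := f @: A.
have cAB : #|~: A| = #|~: B|.
  by apply: (@addnI #|A|); rewrite cardsC -(card_in_imset finj) cardsC.
(* The complements of [A] and of its image have equal size and are matched in enumeration order. *)
pose g x := if x \in A then f x else nth x0 (enum (~: B)) (index x (enum (~: A))).
have gout x : x \notin A -> g x \in ~: B.
  move=> xA; rewrite /g (negbTE xA) -mem_enum mem_nth // -cardE -cAB cardE index_mem.
  by rewrite mem_enum inE.
have gin x : x \in A -> g x \in B by move=> xA; rewrite /g xA imset_f.
have ginj : injective g.
  move=> x y; case: (boolP (x \in A)) => xA; case: (boolP (y \in A)) => yA gxy.
  - by apply: finj => //; move: gxy; rewrite /g xA yA.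
  - by have := gout _ yA; rewrite -gxy inE gin.
  - by have := gout _ xA; rewrite gxy inE gin.
  move: gxy; rewrite /g (negbTE xA) (negbTE yA) => /eqP.
  have ix z : z \notin A -> index z (enum (~: A)) < size (enum (~: B)).
    by move=> zA; rewrite -cardE -cAB cardE index_mem mem_enum inE.
  rewrite nth_uniq ?enum_uniq ?ix // => /eqP /(congr1 (nth x0 (enum (~: A)))).
  by rewrite !nth_index // mem_enum inE.
by exists (perm ginj) => x xA; rewrite permE /g xA.
Qed.

Lemma imset_set2 (T U : finType) (f : T -> U) x y : f @: [set x; y] = [set f x; f y].
Proof. by rewrite imsetU1 imset_set1. Qed.

Lemma edgesKP k (e : {set 'I_k}) :
  reflect (exists x y, x != y /\ e = [set x; y]) (e \in edgesK k).
Proof.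
rewrite inE; apply: (iffP (@cards2P _ e)).
  by case=> x [y ?]; exists x, y.
by case=> x [y ?]; exists x, y.
Qed.

Lemma edgesK2 k (x y : 'I_k) : ([set x; y] \in edgesK k) = (x != y).
Proof. by rewrite inE cards2; case: (x == y). Qed.

Lemma edgesK_perm k (s : {perm 'I_k}) (e : {set 'I_k}) : (s @: e \in edgesK k) = (e \in edgesK k).
Proof. by rewrite !inE card_imset //; apply: perm_inj. Qed.

(** * Colourings of [K_k] that realize the pattern *)

Section PatternColorings.

Variables (k : nat) (J : {set {set 'I_k}}).

(* [chi] realizes, up to relabelling the vertices, the pattern with classes [J] and its complement. *)
Definition pcol (chi : {ffun {set 'I_k} -> 'I_3}) : bool :=
  [exists s : {perm 'I_k}, exists a, exists b, (a != b) &&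
    [forall e in edgesK k, chi (s @: e) == if e \in J then a else b]].

Lemma pcol_of (s : {perm 'I_k}) (a b : 'I_3) : a != b ->
  pcol [ffun e : {set 'I_k} => if s^-1%g @: e \in J then a else b].
Proof.
move=> ab; apply/existsP; exists s; apply/existsP; exists a; apply/existsP; exists b.
rewrite ab; apply/forall_inP => e _; rewrite ffunE -imset_comp.
by rewrite (eq_imset (g := id)) ?imset_id // => x /=; rewrite permK.
Qed.

(** With three colours, a list of size at least 2 that misses [j] must contain [l]. So asking
    whether [j] is in the list is a 2-colouring of the edges, either value of which names a usable
    colour other than [i]. *)
Lemma other_color (i : 'I_3) : exists j l : 'I_3,
  [/\ j != i, l != i & forall L : {set 'I_3}, 1 < #|L| -> j \notin L -> l \in L].
Proof.
have [l li] : exists l : 'I_3, l != i.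
  by exists (inord ((i + 1) %% 3)); rewrite -val_eqE /= inordK ?ltn_pmod //; case: i => -[|[|[|]]].
have [j /andP[ji jl]] : exists j : 'I_3, (j != i) && (j != l).
  have : 0 < #|~: [set i; l]|.
    by rewrite cardsCs setCK card_ord cards2 eq_sym li.
  by case/card_gt0P => j; rewrite !inE negb_or => H; exists j.
exists j, l; split=> // L L2 jL; apply: contraLR L2 => lL.
rewrite -leqNgt; suff /subset_leq_card : L \subset [set i] by rewrite cards1.
apply/subsetP => x xL; rewrite inE.
have full : [set i; j; l] = [set: 'I_3].
  apply/eqP; rewrite eqEcard subsetT cardsT card_ord.
  by rewrite -setUA setUC -setUA [[set l] :|: _]setUC cardsU1 cards2 !inE negb_or jl ji eq_sym li.
have := in_setT x; rewrite -full !inE => /orP[/orP[//|/eqP xj]|/eqP xl].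
  by rewrite xj (negbTE jL) in xL.
by rewrite xl (negbTE lL) in xL.
Qed.

(** The monochromatic copy lives on [l <= k] vertices and its map is injective only on the vertices
    covered by [J]; extending it to a permutation of all [k] vertices places the whole pattern. *)
Lemma ramsey_perm (d : {set 'I_k} -> bool) : ramsey_le J k ->
  exists b (s : {perm 'I_k}), forall e, e \in J -> d (s @: e) = b.
Proof.
case=> l [lk /(_ (fun e => d (widen_ord lk @: e))) [b [f [finj fJ]]]].
have [|s sf] := @perm_extension _ (gverts J) (fun x => widen_ord lk (f x)).
  by move=> x y xJ yJ /(congr1 val) /= /val_inj; apply: finj.
exists b, s => e eJ; rewrite -(fJ e eJ) -imset_comp; congr d.
apply: eq_in_imset => x xe; apply: sf; rewrite /gverts; apply/bigcupP; by exists e.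
Qed.

(** This is where the Ramsey hypothesis enters: [J] is placed so that one colour other than [i] is
    available on all its edges, and every remaining edge receives [i]. *)
Lemma ramsey_lists (L : {set 'I_k} -> {set 'I_3}) i : ramsey_le J k ->
  (forall e, e \in edgesK k -> i \in L e /\ 1 < #|L e|) ->
  exists2 chi, pcol chi & forall e, e \in edgesK k -> chi e \in L e.
Proof.
move=> HR HL; have [j [l [ji li jl]]] := other_color i.
have [b [s sJ]] := ramsey_perm (fun e => j \in L e) HR.
pose a := if b then j else l.
have ai : a != i by rewrite /a; case: (b).
exists [ffun e : {set 'I_k} => if s^-1%g @: e \in J then a else i]; first exact: pcol_of.
move=> e eK; have [iL L2] := HL e eK; rewrite ffunE; case: ifP => // eJ.
have := sJ _ eJ; rewrite -imset_comp (eq_imset (g := id)) ?imset_id; last first.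
  by move=> x /=; rewrite permKV.
by rewrite /a => <-; case: ifP => // /negbT; apply: jl.
Qed.

(** The class of [e0] gets [c0], the other class any other colour. Serves cliques in which one list
    is merely nonempty and all others are full. *)
Lemma pcol_edge e0 c0 : e0 \in edgesK k -> exists2 chi, pcol chi & chi e0 = c0.
Proof.
move=> _; have [j [l [ji _ _]]] := other_color c0.
pose a := if e0 \in J then c0 else j; pose b := if e0 \in J then j else c0.
exists [ffun e : {set 'I_k} => if (1 : {perm 'I_k})^-1%g @: e \in J then a else b].
  by apply: pcol_of; rewrite /a /b; case: ifP; rewrite // eq_sym.
rewrite ffunE (eq_imset (g := id)) ?imset_id; last by move=> x; rewrite invg1 perm1.
by rewrite /a /b; case: (e0 \in J).
Qed.

Hypotheses (k3 : 2 < k) (JK : J \subset edgesK k) (J0 : J != set0) (JnK : J != edgesK k).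

Let jr (x y : 'I_k) := [set x; y] \in J.
Let jrC x y : jr x y = jr y x. Proof. by rewrite /jr setUC. Qed.

(** Same class: two of the three edges of a triangle agree, and they share a vertex. Different
    classes: an edge [xy] in [J] and an edge [zw] outside are joined by [xz], whose class differs
    from that of one of them. *)
Lemma star_two (b : bool) : exists v x y,
  [/\ v != x, v != y, x != y & (jr v x == jr v y) = b].
Proof.
case: b.
  have lt0 : 0 < k by lia. have lt1 : 1 < k by lia.
  pose x := Ordinal lt0; pose y := Ordinal lt1; pose z := Ordinal k3.
  have [xy|xy] := boolP (jr x y == jr x z); first by exists x, y, z; rewrite xy.
  have [yz|yz] := boolP (jr y x == jr y z); first by exists y, x, z; rewrite yz.
  exists z, x, y; split=> //; move: xy yz; rewrite (jrC z x) (jrC z y) (jrC y x).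
  by case: (jr x y); case: (jr x z); case: (jr y z).
have [e eJ] : exists e, e \in J by apply/set0Pn.
have [f fK fJ] : exists2 f, f \in edgesK k & f \notin J.
  by apply/subsetPn; apply: contra JnK => ?; rewrite eqEsubset JK.
have /edgesKP [x [y [xy ?]]] := subsetP JK _ eJ; subst e.
have /edgesKP [z [w [zw ?]]] := fK; subst f.
rewrite -/(jr _ _) in eJ; rewrite -/(jr _ _) in fJ.
have main x' y' : x' != y' -> x' != z -> jr x' y' ->
    exists v x y, [/\ v != x, v != y, x != y & (jr v x == jr v y) = false].
  move=> xy' xz xyJ; have [xzJ|xzJ] := boolP (jr x' z); last first.
    exists x', y', z; rewrite xyJ (negbTE xzJ); split=> //.
    by apply: contraNN xzJ => /eqP<-.
  exists z, x', w; rewrite eq_sym xz zw jrC xzJ (negbTE fJ); split=> //.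
  by apply: contraNN fJ => /eqP<-; rewrite jrC.
have [xz|xz] := eqVneq x z; last exact: (main x y).
by apply: (main y x); rewrite ?(eq_sym y x) // -?xz 1?eq_sym // jrC.
Qed.

(** A vertex with two edges in the same class (if [c1 = c2]) or in different classes (if not) is
    moved to [u]. *)
Lemma pcol_star (u w1 w2 : 'I_k) (c1 c2 : 'I_3) : u != w1 -> u != w2 -> w1 != w2 ->
  exists chi, [/\ pcol chi, chi [set u; w1] = c1 & chi [set u; w2] = c2].
Proof.
move=> uw1 uw2 w12.
have [v [x [y [vx vy xy jvxy]]]] := star_two (c1 == c2).
pose f z := if z == v then u else if z == x then w1 else w2.
have fv : f v = u by rewrite /f eqxx.
have fx : f x = w1 by rewrite /f eqxx eq_sym (negbTE vx).
have fy : f y = w2 by rewrite /f eq_sym (negbTE vy) eq_sym (negbTE xy).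
have [|s sf] := @perm_extension _ [set v; x; y] f.
  move=> p q; rewrite !inE => /orP[/orP[]|] /eqP-> /orP[/orP[]|] /eqP->;
    rewrite ?fv ?fx ?fy // => /eqP; rewrite ?(negbTE uw1) ?(negbTE uw2) ?(negbTE w12) //;
    by rewrite eq_sym ?(negbTE uw1) ?(negbTE uw2) ?(negbTE w12).
have sv : s v = u by rewrite sf ?fv // !inE eqxx.
have sx : s x = w1 by rewrite sf ?fx // !inE eqxx !orbT.
have sy : s y = w2 by rewrite sf ?fy // !inE eqxx !orbT.
have inv (a b : 'I_k) : s^-1%g @: [set s a; s b] = [set a; b] by rewrite imset_set2 !permK.
have [j [l [jc _ _]]] := other_color c1.
(* [o] colours the second class. When [c1 = c2] neither prescribed edge shows it, so any colour
   other than [c1] will do. *)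
pose o := if c1 == c2 then j else c2.
have oc : o != c1 by rewrite /o; have [//|] := eqVneq c1 c2; rewrite eq_sym.
pose a := if jr v x then c1 else o; pose b := if jr v x then o else c1.
exists [ffun e : {set 'I_k} => if s^-1%g @: e \in J then a else b]; split.
- by apply: pcol_of; rewrite /a /b; case: ifP; rewrite // eq_sym.
- by rewrite ffunE -sv -sx inv -/(jr v x) /a /b; case: (jr v x).
rewrite ffunE -sv -sy inv -/(jr v y) /a /b /o.
by move: jvxy; case: (jr v x); case: (jr v y); case: (eqVneq c1 c2).
Qed.

End PatternColorings.

(** Lets the single graph [pclass pat a] stand for the pattern; it is neither empty nor complete
    because both classes are inhabited. *)
Lemma pclass_two k (pat : {set 'I_k} -> nat) a : num_classes pat = 2 -> a \in pclasses pat ->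
  [/\ pclass pat a \subset edgesK k, pclass pat a != set0, pclass pat a != edgesK k &
    {in edgesK k &, forall e1 e2, (pat e1 == pat e2) = ((e1 \in pclass pat a) == (e2 \in pclass pat a))}].
Proof.
move=> n2 aP.
have mP e : e \in edgesK k -> pat e \in pclasses pat.
  by move=> eK; rewrite mem_undup map_f // mem_enum.
have [b [ab bP inP]] : exists b, [/\ a != b, b \in pclasses pat & forall x, x \in pclasses pat -> x = a \/ x = b].
  have U := undup_uniq [seq pat e | e <- enum (edgesK k)].
  rewrite -/(pclasses pat) in U; move: aP n2 U; rewrite /num_classes.
  case: (pclasses pat) => [|x [|y []]] //= + _; rewrite !inE => + /andP[xy _].
  move: xy; rewrite ?mem_seq1 => xy; case/orP=> /eqP->.
    by exists y; split; rewrite ?inE ?eqxx ?orbT // => z; rewrite !inE => /orP[]/eqP; auto.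
  by exists x; split; rewrite ?inE ?eqxx ?orbT 1?eq_sym // => z; rewrite !inE => /orP[]/eqP; auto.
have ex c : c \in pclasses pat -> exists2 e, e \in edgesK k & pat e = c.
  by rewrite mem_undup => /mapP[e]; rewrite mem_enum => ? ->; exists e.
split.
- by apply/subsetP => e; rewrite inE => /andP[].
- by have [e eK ea] := ex _ aP; apply/set0Pn; exists e; rewrite inE eK ea eqxx.
- have [e eK eb] := ex _ bP; apply/eqP => /setP /(_ e); rewrite inE eK eb eq_sym.
  by rewrite (negbTE ab).
have pE e : e \in edgesK k -> (e \in pclass pat a) = (pat e == a) by move=> eK; rewrite in_set eK.
move=> e1 e2 k1 k2; rewrite !pE //.
have [->|->] := inP _ (mP _ k1); have [->|->] := inP _ (mP _ k2); rewrite ?eqxx //;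
  by rewrite ?(negbTE ab) // (eq_sym b a) (negbTE ab).
Qed.

(** The relabelling inside [pcol] absorbs the bijection of a copy: if [f] displayed [chi], then [f]
    composed with that permutation would be a copy. *)
Lemma avoids_pcol n k (pat : {set 'I_k} -> nat) a (E : {set {set 'I_n}}) c
    (f : {ffun 'I_k -> 'I_n}) (chi : {ffun {set 'I_k} -> 'I_3}) :
  num_classes pat = 2 -> a \in pclasses pat -> avoids pat E c -> clique_map E f ->
  pcol (pclass pat a) chi -> exists2 e, e \in edgesK k & c (f @: e) != chi e.
Proof.
move=> n2 aP; have [_ _ _ HJ] := pclass_two n2 aP.
move=> av /andP[/injectiveP finj /forallP fE] pc.
have [/exists_inP[e eK ne]|] := boolP [exists e in edgesK k, c (f @: e) != chi e].
  by exists e.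
rewrite negb_exists_in => /forall_inP H; case/negP: av.
case/existsP: pc => s /existsP[x /existsP[y /andP[xy /forall_inP Hs]]].
apply/existsP; exists [ffun i => f (s i)]; apply/andP; split.
  apply/andP; split.
    by apply/injectiveP => i j; rewrite !ffunE => /finj /perm_inj.
  apply/forallP => i; apply/forallP => j; apply/implyP => ij; rewrite !ffunE.
  by have /forallP/(_ (s j))/implyP := fE (s i); apply; rewrite (inj_eq perm_inj).
have cE e : e \in edgesK k -> c ([ffun i => f (s i)] @: e) = if e \in pclass pat a then x else y.
  move=> eK; rewrite -(eqP (Hs e eK)).
  have := H (s @: e); rewrite edgesK_perm eK => /(_ isT); rewrite negbK => /eqP <-.
  by rewrite -imset_comp; congr (c _); apply: eq_imset => i; rewrite ffunE.
apply/forall_inP => e1 k1; apply/forall_inP => e2 k2; rewrite !cE // HJ //.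
by case: (e1 \in _); case: (e2 \in _); rewrite ?eqxx // ?(eq_sym y x) (negbTE xy).
Qed.

(** * Symmetrization *)

Lemma is_graph2 n (E : {set {set 'I_n}}) e : is_graph E -> e \in E -> #|e| = 2.
Proof. by move=> /forall_inP H /H /eqP. Qed.

Lemma graph_loop n (E : {set {set 'I_n}}) x : is_graph E -> ([set x; x] \in E) = false.
Proof. by move=> gE; apply/negbTE/negP => /(is_graph2 gE); rewrite cards2 eqxx. Qed.

Lemma card_fibred_pairs (T1 T2 S : finType) (A : {set T1}) (B : {set T2}) (f : T1 -> S) (g : T2 -> S) :
  #|[set p : T1 * T2 | [&& p.1 \in A, p.2 \in B & f p.1 == g p.2]]|
  = \sum_d #|[set x in A | f x == d]| * #|[set y in B | g y == d]|.
Proof.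
rewrite -sum1_card (partition_big (fun p => f p.1) predT) //=.
apply: eq_bigr => d _; rewrite -cardsX -sum1_card; apply: eq_bigl => -[x y].
rewrite !inE /=; case: (x \in A); case: (y \in B); rewrite //= ?andbF //.
by have [->|] := eqVneq (f x) d; rewrite ?andbT ?andbF // eq_sym.
Qed.

(** Fibrewise [2 a b <= a^2 + b^2]. In the cloning step [a] and [b] count the extensions of a
    colouring of the remaining graph to one or the other of two nonadjacent vertices. *)
Lemma card_fibred_pairs_amgm (T1 T2 S : finType) (A : {set T1}) (B : {set T2}) (f : T1 -> S) (g : T2 -> S) :
  2 * #|[set p : T1 * T2 | [&& p.1 \in A, p.2 \in B & f p.1 == g p.2]]|
  <= #|[set p : T1 * T1 | [&& p.1 \in A, p.2 \in A & f p.1 == f p.2]]|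
   + #|[set p : T2 * T2 | [&& p.1 \in B, p.2 \in B & g p.1 == g p.2]]|.
Proof.
rewrite !card_fibred_pairs big_distrr -big_split /=; apply: leq_sum => d _.
by rewrite mulnn mulnn; apply: (nat_Cauchy _ _).1.
Qed.

Lemma is_copy_transfer n n' k (pat : {set 'I_k} -> nat) (E : {set {set 'I_n}}) (E' : {set {set 'I_n'}})
    (c : {ffun {set 'I_n} -> 'I_3}) (c' : {ffun {set 'I_n'} -> 'I_3})
    (f : {ffun 'I_k -> 'I_n}) (g : {ffun 'I_k -> 'I_n'}) :
  clique_map E' g -> (forall e : {set 'I_k}, e \in edgesK k -> c' (g @: e) = c (f @: e)) ->
  is_copy pat E c f -> is_copy pat E' c' g.
Proof.
move=> gE' cc /andP[_ /forall_inP H]; rewrite /is_copy gE' /=.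
apply/forall_inP => e1 k1; apply/forall_inP => e2 k2; rewrite !cc //.
by have /forall_inP/(_ e2 k2) := H e1 k1.
Qed.

Section Zykov.

Variables (n k : nat) (pat : {set 'I_k} -> nat).
Implicit Types (E : {set {set 'I_n}}) (c : {ffun {set 'I_n} -> 'I_3}) (e : {set 'I_n}).

Definition cols E := [set c | coloring_of E c && avoids pat E c].

(** [pull (redirect u v) E] is the graph in which [u] has become a clone of [v], not adjacent to it.
    The size condition excludes larger sets that collapse onto an edge. *)
Definition pull (s : 'I_n -> 'I_n) E := [set e : {set 'I_n} | (#|e| == 2) && (s @: e \in E)].

Definition redirect (u v x : 'I_n) := if x == u then v else x.

Definition edges_off (v : 'I_n) E := [set e in E | v \notin e].

Definition col_off (v : 'I_n) c := [ffun e : {set 'I_n} => if v \in e then ord0 else c e].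

Lemma pull_graph s E : is_graph (pull s E).
Proof. by apply/forall_inP => e; rewrite inE => /andP[]. Qed.

Lemma pullE s E x y : is_graph E -> ([set x; y] \in pull s E) = ([set s x; s y] \in E).
Proof.
move=> gE; rewrite inE imset_set2 cards2; case: (eqVneq x y) => [->|//].
by rewrite (graph_loop _ gE).
Qed.

Lemma cols_off v E c : c \in cols E -> col_off v c \in cols (edges_off v E).
Proof.
rewrite !inE => /andP[/forallP cE av]; apply/andP; split.
  apply/forallP => e; apply/implyP; rewrite inE negb_and negbK ffunE.
  by case: (v \in e) => //; rewrite orbF => eE; have := cE e; rewrite eE.
apply: contra av => /existsP[f fc]; apply/existsP; exists f.
have /andP[/andP[finj /forallP fE] _] := fc.
apply: is_copy_transfer fc.
  apply/andP; split=> //; apply/forallP => i; apply/forallP => j; apply/implyP => ij.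
  by have /forallP/(_ j)/implyP/(_ ij) := fE i; rewrite inE => /andP[].
move=> e /edgesKP[i [j [ij ->]]]; rewrite ffunE imset_set2.
by have /forallP/(_ j)/implyP/(_ ij) := fE i; rewrite inE => /andP[_ /negbTE->].
Qed.

Variables (E : {set {set 'I_n}}) (gE : is_graph E).

(** No edge contains both [u] and [v], so the restrictions off [v] and off [u] determine a
    colouring. *)
Lemma cols_le_pairs u v : u != v -> [set u; v] \notin E ->
  #|cols E| <= #|[set p | [&& p.1 \in cols (edges_off v E), p.2 \in cols (edges_off u E)
                          & col_off u p.1 == col_off v p.2]]|.
Proof.
move=> uv uvE; rewrite -(card_in_imset (f := fun c => (col_off v c, col_off u c))).
  apply: subset_leq_card; apply/subsetP => p /imsetP[c cE ->].
  rewrite inE /= !cols_off //=; apply/eqP/ffunP => e; rewrite !ffunE.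
  by case: (u \in e); case: (v \in e).
move=> c c'; rewrite !inE => /andP[/forallP cE _] /andP[/forallP cE' _] [/ffunP H1 /ffunP H2].
apply/ffunP => e; have := H1 e; have := H2 e; rewrite !ffunE.
case: ifP => // ue _; case: ifP => // ve _.
suff eE : e \notin E by rewrite (eqP (implyP (cE e) eE)) (eqP (implyP (cE' e) eE)).
apply: contra uvE => eE; suff <- : e = [set u; v] by [].
by apply/esym/eqP; rewrite eqEcard (is_graph2 gE eE) cards2 uv subUset !sub1set ue ve.
Qed.

Lemma redirect_id u v e : u \notin e -> redirect u v @: e = e.
Proof.
move=> ue; rewrite -[RHS]imset_id; apply: eq_in_imset => x xe; rewrite /redirect.
by case: eqVneq xe ue => // -> ->.
Qed.

(** Two colourings of [E] without [v] that agree off [u] are glued: the second, transported from [u]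
    to its clone [v], colours the edges at [v]. A clique contains at most one of the clones, so a
    copy in the glued colouring gives one in the first or the second colouring. *)
Lemma pairs_le_cols u v : u != v -> [set u; v] \notin E ->
  #|[set p | [&& p.1 \in cols (edges_off v E), p.2 \in cols (edges_off v E)
                          & col_off u p.1 == col_off u p.2]]| <= #|cols (pull (redirect v u) E)|.
Proof.
move=> uv uvE; set E' := pull _ E; set P := [set p | _]; pose s := redirect v u.
have s_v x : s x != v by rewrite /s /redirect; case: (eqVneq x v).
pose F (p : {ffun {set 'I_n} -> 'I_3} * {ffun {set 'I_n} -> 'I_3}) :=
  [ffun e : {set 'I_n} => if e \in E' then if v \in e then p.2 (s @: e) else p.1 e else ord0].
rewrite -(card_in_imset (f := F)); last first.
  move=> [c1 c2] [c1' c2']; rewrite !inE /=.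
  move=> /and3P[/andP[/forallP z1 _] /andP[/forallP z2 _] /eqP/ffunP o].
  move=> /and3P[/andP[/forallP z1' _] /andP[/forallP z2' _] /eqP/ffunP o'] /ffunP FF.
  have H1 e : c1 e = c1' e.
    have [eE|eE] := boolP (e \in edges_off v E); last first.
      by rewrite (eqP (implyP (z1 e) eE)) (eqP (implyP (z1' e) eE)).
    have := FF e; rewrite !ffunE; move: eE; rewrite inE => /andP[eE ve].
    by rewrite inE (is_graph2 gE eE) eqxx redirect_id // eE (negbTE ve).
  have H2 e : c2 e = c2' e.
    have [eE|eE] := boolP (e \in edges_off v E); last first.
      by rewrite (eqP (implyP (z2 e) eE)) (eqP (implyP (z2' e) eE)).
    have := o e; have := o' e; rewrite !ffunE; case: ifP => [ue _ _|_ <- <- //].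
    move: eE; rewrite inE => /andP[eE ve].
    have /eqP/cards2P[x [y [xy exy]]] := is_graph2 gE eE.
    have [w [wu ew]] : exists w, w != u /\ e = [set u; w].
      move: ue; rewrite exy !inE => /orP[]/eqP->; first by exists y; rewrite eq_sym.
      by exists x; rewrite setUC.
    have wv : w != v by apply: contraNneq ve => <-; rewrite ew !inE eqxx orbT.
    have sw : s @: [set v; w] = e by rewrite imset_set2 /s /redirect eqxx (negbTE wv).
    have := FF [set v; w]; rewrite !ffunE pullE // /redirect eqxx (negbTE wv) -ew eE.
    by rewrite !inE eqxx /= sw.
  by congr (_, _); apply/ffunP.
apply: subset_leq_card; apply/subsetP => _ /imsetP[[c1 c2] + ->].
rewrite !inE /= => /and3P[/andP[_ av1] /andP[_ av2] /eqP/ffunP o].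
apply/andP; split.
  by apply/forallP => e; apply/implyP => eE; rewrite ffunE (negbTE eE).
apply/existsP => -[f fc]; have /andP[/andP[_ /forallP fE] _] := fc.
have fE2 i j : i != j -> [set f i; f j] \in E' by move=> ij; have /forallP/(_ j)/implyP/(_ ij) := fE i.
pose g := [ffun i => s (f i)].
have gE' : clique_map (edges_off v E) g.
  have H i j : i != j -> [set g i; g j] \in edges_off v E.
    move=> /fE2; rewrite !ffunE pullE // => H.
    by rewrite inE H !inE negb_or eq_sym s_v eq_sym s_v.
  apply/andP; split; last by apply/forallP => i; apply/forallP => j; apply/implyP/H.
  apply/injectiveP => i j gij; apply/eqP/negPn/negP => /H.
  by rewrite inE gij (graph_loop _ gE).
have gf (e : {set 'I_k}) : g @: e = s @: (f @: e) by rewrite -imset_comp; apply: eq_imset => i; rewrite ffunE.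
have [/existsP[i0 /eqP iv]|] := boolP [exists i, f i == v]; last first.
  rewrite negb_exists => /forallP nv; case/negP: av1; apply/existsP; exists g.
  apply: is_copy_transfer fc => // e /edgesKP[i [j [ij ->]]].
  rewrite gf imset_set2 ffunE (fE2 _ _ ij) !inE eq_sym (negbTE (nv i)) eq_sym (negbTE (nv j)) /=.
  by rewrite redirect_id // !inE eq_sym (negbTE (nv i)) eq_sym (negbTE (nv j)).
have nu l : f l != u.
  apply/eqP => lu; have [li|/fE2] := eqVneq l i0.
    by case/negP: uv; rewrite -lu li iv.
  by rewrite lu iv pullE // /redirect eqxx (negbTE uv) (graph_loop _ gE).
case/negP: av2; apply/existsP; exists g.
apply: is_copy_transfer fc => // e /edgesKP[i [j [ij ->]]].
rewrite gf imset_set2 ffunE (fE2 _ _ ij); case: ifP => // ve.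
have uf : u \notin [set f i; f j] by rewrite !inE negb_or eq_sym nu eq_sym nu.
by have := o [set f i; f j]; rewrite redirect_id ?ve // !ffunE (negbTE uf).
Qed.

(** Consequently, at an extremal graph both clonings are extremal as well, and the direction of
    cloning can be chosen freely. *)
Lemma zykov u v : u != v -> [set u; v] \notin E ->
  2 * #|cols E| <= #|cols (pull (redirect v u) E)| + #|cols (pull (redirect u v) E)|.
Proof.
move=> uv uvE; have H1 := cols_le_pairs uv uvE; have H2 := pairs_le_cols uv uvE.
have H3 := @pairs_le_cols v u; rewrite eq_sym setUC in H3; have {}H3 := H3 uv uvE.
have H4 := card_fibred_pairs_amgm (cols (edges_off v E)) (cols (edges_off u E)) (col_off u) (col_off v).
by apply: leq_trans (leq_trans H4 (leq_add H2 H3)); rewrite leq_mul2l H1.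
Qed.

End Zykov.

Lemma sum_redirect n (F : 'I_n -> nat) u v :
  \sum_x F (redirect u v x) + F u = \sum_x F x + F v.
Proof.
rewrite (bigD1 u) //= [in RHS](bigD1 u) //= /redirect eqxx.
rewrite (eq_bigr F) => [|x /negbTE->//]; lia.
Qed.

(** Complete multipartite graph. Labels of parts are arbitrary numbers, so that deleting the vertex
    [u] is just composition with [lift u]. *)
Definition mgr n (pt : 'I_n -> nat) : {set {set 'I_n}} :=
  [set e : {set 'I_n} | [exists u : 'I_n, exists v : 'I_n, (e == [set u; v]) && (pt u != pt v)]].

Lemma mgrE n (pt : 'I_n -> nat) u v : ([set u; v] \in mgr pt) = (pt u != pt v).
Proof.
rewrite inE; apply/existsP/idP => [[x /existsP[y /andP[/eqP uv xy]]]|uv]; last first.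
  by exists u; apply/existsP; exists v; rewrite eqxx.
have xy' : x != y by apply: contraNneq xy => ->.
have uv' : u != v by move: (congr1 (fun A : {set _} => #|A|) uv); rewrite /= !cards2 xy'; case: eqP.
have ux : u \in [set x; y] by rewrite -uv !inE eqxx.
have vx : v \in [set x; y] by rewrite -uv !inE eqxx orbT.
move: ux vx uv'; rewrite !inE => /orP[]/eqP-> /orP[]/eqP->; rewrite ?eqxx // => _.
by rewrite eq_sym.
Qed.

Lemma mgr_graph n (pt : 'I_n -> nat) : is_graph (mgr pt).
Proof.
apply/forall_inP => e; rewrite inE => /existsP[x /existsP[y /andP[/eqP-> xy]]].
by rewrite cards2; case: (eqVneq x y) xy => // ->; rewrite eqxx.
Qed.

Lemma turan_mgr r n : turan r n = mgr (fun i : 'I_n => i %% r).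
Proof. by []. Qed.

Section Extremal.

Variables (n k : nat) (pat : {set 'I_k} -> nat).
Implicit Types E : {set {set 'I_n}}.

Definition nbr E x := [set y | [set x; y] \in E].

(** A graph without such pairs is complete multipartite: nonadjacency is then equality of
    neighbourhoods, an equivalence relation. *)
Definition bad E x y := ([set x; y] \notin E) && (nbr E x != nbr E y).

Lemma in_nbr E x y : (y \in nbr E x) = ([set x; y] \in E). Proof. by rewrite inE. Qed.

Lemma badC E x y : bad E x y = bad E y x.
Proof. by rewrite /bad setUC eq_sym. Qed.

Lemma bad_pull E u v x y : is_graph E ->
  bad (pull (redirect u v) E) x y <= bad E (redirect u v x) (redirect u v y).
Proof.
move=> gE; rewrite /bad pullE //; case: (_ \notin E) => //=.
case: eqVneq => // ne; case: eqVneq => // eq; case/eqP: ne.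
by apply/setP => z; rewrite !in_nbr !pullE //; have /setP/(_ (redirect u v z)) := eq; rewrite !in_nbr.
Qed.

(** Cloning replaces the bad pairs at [u] by those at [v], and moreover destroys [(u, v)] and
    [(v, u)]; so the number of ordered bad pairs drops by at least 2. *)
Lemma bad_decreases E u v : is_graph E -> bad E u v ->
  \sum_y bad E v y <= \sum_y bad E u y ->
  \sum_x \sum_y bad (pull (redirect u v) E) x y < \sum_x \sum_y bad E x y.
Proof.
move=> gE uv le; pose s := redirect u v.
have H1 : \sum_x \sum_y bad (pull s E) x y <= \sum_x \sum_y bad E (s x) (s y).
  by apply: leq_sum => x _; apply: leq_sum => y _; apply: bad_pull.
have H2 : \sum_x \sum_y bad E (s x) (s y) + \sum_x bad E (s x) u
   = \sum_x \sum_y bad E (s x) y + \sum_x bad E (s x) v.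
  by rewrite -!big_split /=; apply: eq_bigr => x _; exact: (sum_redirect (fun y => bad E (s x) y : nat)).
have H3 := sum_redirect (fun x => \sum_y bad E x y : nat) u v.
have H4 := sum_redirect (fun x => bad E x u : nat) u v.
have H5 := sum_redirect (fun x => bad E x v : nat) u v.
have H0 w : bad E w w = false by rewrite /bad eqxx andbF.
have H6 : \sum_x bad E x u = \sum_y bad E u y by apply: eq_bigr => x _; rewrite badC.
have H7 : \sum_x bad E x v = \sum_y bad E v y by apply: eq_bigr => x _; rewrite badC.
have H8 : bad E v u by rewrite badC.
rewrite /= H0 H6 H8 in H4; rewrite /= H0 H7 uv in H5; rewrite -/s in H3 H4 H5.
move: H1 H2 H3 H4 H5 le; set a := \sum_x _; set b := \sum_x _; set c := \sum_x _; set d := \sum_x _.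
set e := \sum_x _; set f := \sum_x _; set g := \sum_x _; set h := \sum_x _; lia.
Qed.

Lemma c3max_mgr : exists pt : 'I_n -> nat, c3max pat n = c3 pat (mgr pt).
Proof.
have g0 : is_graph (set0 : {set {set 'I_n}}) by apply/forall_inP => e; rewrite inE.
have [E gE cE] := @eq_bigmax_cond _ (fun E : {set {set 'I_n}} => is_graph E) (c3 pat) (ltac:(by apply/card_gt0P; exists set0)).
have max (F : {set {set 'I_n}}) : is_graph F -> c3 pat F <= c3max pat n by move=> gF; rewrite /c3max (bigD1 F) //= leq_maxl.
rewrite -/(c3max pat n) in cE; move: (ltnSn (\sum_x \sum_y bad E x y)).
move: {2}(_.+1) => m; elim: m => // m IH in E gE cE *.
have [/existsP[u /existsP[v uv]] lem|] := boolP [exists u, exists v, bad E u v].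
  have nuv : u != v by apply: contraTneq uv => ->; rewrite /bad eqxx andbF.
  have Z := zykov pat gE nuv (proj1 (andP uv)); rewrite -!/(c3 pat _) -cE in Z.
  have M1 := max _ (pull_graph (redirect u v) E); have M2 := max _ (pull_graph (redirect v u) E).
  have [le|/ltnW le] := leqP (\sum_y bad E v y) (\sum_y bad E u y).
    apply: (IH (pull (redirect u v) E)); first exact: pull_graph.
      by apply/eqP; rewrite eqn_leq M1 andbT; lia.
    by apply: leq_trans (ltnSE lem); apply: bad_decreases.
  apply: (IH (pull (redirect v u) E)); first exact: pull_graph.
    by apply/eqP; rewrite eqn_leq M2 andbT; lia.
  by apply: leq_trans (ltnSE lem); apply: bad_decreases; rewrite // badC.
rewrite negb_exists => /forallP nb _; exists (fun x => val (enum_rank (nbr E x))).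
rewrite cE; congr (c3 pat _); apply/setP => e.
have adj x y : ([set x; y] \in E) = (nbr E x != nbr E y).
  apply/idP/idP => [xy|].
    apply: contraTneq xy => /setP/(_ y); rewrite !inE => ->.
    by rewrite (graph_loop _ gE).
  by apply: contraR => xy; have := nb x; rewrite negb_exists => /forallP/(_ y); rewrite /bad xy /= negbK.
have [/cards2P[x [y [xy ->]]]|ne] := boolP (#|e| == 2).
  by rewrite adj mgrE (inj_eq val_inj) (inj_eq enum_rank_inj).
by apply/idP/idP => H; case/negP: ne; apply/eqP; [apply: is_graph2 gE H|apply: is_graph2 (mgr_graph _) H].
Qed.

End Extremal.

(** * Deletion of a vertex and the Turan bound *)

(** Number of edges of [T_r(n)], adding vertices in turn: vertex [m] is joined to all earlier ones
    except the [m %/ r] with the same residue. *)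
Fixpoint tur (r n : nat) : nat := if n is m.+1 then tur r m + (m - m %/ r) else 0.

Definition parts n (pt : 'I_n -> nat) : seq nat := undup (codom pt).

Lemma mem_parts n (pt : 'I_n -> nat) x : pt x \in parts pt.
Proof. by rewrite mem_undup codom_f. Qed.

Lemma set2_eq (T : finType) (x y : T) (e : {set T}) : #|e| = 2 -> x != y -> x \in e -> y \in e -> e = [set x; y].
Proof.
move=> e2 xy xe ye; apply/esym/eqP.
by rewrite eqEcard e2 cards2 xy subUset !sub1set xe ye.
Qed.

Lemma lift_preimage n (u : 'I_n.+1) (e : {set 'I_n.+1}) : u \notin e -> exists e' : {set 'I_n}, e = lift u @: e'.
Proof.
move=> ue; exists [set y | lift u y \in e]; apply/setP => x.
apply/idP/imsetP => [xe|[y]]; last by rewrite inE => ? ->.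
have [y|xu] := unliftP u x; last by case/negP: ue; rewrite -xu.
by move=> xy; exists y; rewrite // inE -xy.
Qed.

Lemma mgr_lift n (pt : 'I_n.+1 -> nat) (u : 'I_n.+1) (e : {set 'I_n}) :
  (lift u @: e \in mgr pt) = (e \in mgr (pt \o lift u)).
Proof.
have [/cards2P[x [y [xy ->]]]|ne] := boolP (#|e| == 2).
  by rewrite imset_set2 !mgrE.
apply/idP/idP => H; case/negP: ne; rewrite -1?(is_graph2 (mgr_graph _) H) //.
by rewrite card_imset //; apply: lift_inj.
Qed.

Lemma card_mgr_delete n (pt : 'I_n.+1 -> nat) (u : 'I_n.+1) :
  #|mgr pt| = #|mgr (pt \o lift u)| + #|[set x | pt x != pt u]|.
Proof.
rewrite -(cardsID [set e : {set 'I_n.+1} | u \in e]) addnC; congr (_ + _).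
  rewrite -(card_imset _ (imset_inj (@lift_inj _ u))); apply: eq_card => e.
  rewrite in_setD in_set; apply/andP/imsetP => [[ue eE]|[e' e'E ->]].
    by have [e' ee'] := lift_preimage ue; exists e'; rewrite // -mgr_lift -ee'.
  rewrite mgr_lift; split=> //; apply/imsetP => -[x _ /eqP].
  by rewrite (negbTE (neq_lift u x)).
rewrite -(card_in_imset (f := fun x => [set u; x])); last first.
  move=> x y; rewrite !inE => xu yu /setP/(_ x); rewrite !inE eqxx orbT.
  by move=> /esym/orP[/eqP xu'|/eqP//]; rewrite xu' eqxx in xu.
apply: eq_card => e; rewrite in_setI in_set; apply/andP/imsetP => [[eE ue]|[x + ->]].
  have e2 := is_graph2 (mgr_graph pt) eE.
  have : 0 < #|e :\ u| by move: e2; rewrite (cardsD1 u) ue add1n => -[->].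
  case/card_gt0P => x; rewrite in_setD1 => /andP[xu xe]; rewrite eq_sym in xu.
  have ex := set2_eq e2 xu ue xe; exists x => //.
  by move: eE; rewrite ex mgrE in_set eq_sym.
by rewrite in_set mgrE eq_sym => ->; rewrite !inE eqxx.
Qed.

Lemma card_colorings n (E : {set {set 'I_n}}) : #|[set c | coloring_of E c]| = 3 ^ #|E|.
Proof.
have <- : #|pffun_on (ord0 : 'I_3) E predT| = 3 ^ #|E| by rewrite card_pffun_on card_ord.
apply: eq_card => c; rewrite in_set.
apply/forallP/pffun_onP => [H|[H _] e]; last first.
  by apply/implyP => eE; apply/negPn/negP => ce; case/negP: eE; apply: (subsetP H); rewrite inE.
split=> //; apply/subsetP => e; rewrite inE; apply: contraR => eE; exact: (implyP (H e)).
Qed.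

Lemma c3_le n k (pat : {set 'I_k} -> nat) (E : {set {set 'I_n}}) : c3 pat E <= 3 ^ #|E|.
Proof.
rewrite -card_colorings; apply: subset_leq_card; apply/subsetP => c.
by rewrite !inE => /andP[].
Qed.

Lemma big_part n (pt : 'I_n.+1 -> nat) :
  exists u, n.+1 <= size (parts pt) * #|[set x | pt x == pt u]|.
Proof.
pose m := \max_u #|[set x | pt x == pt u]|.
have [u mu] := @bigop.eq_bigmax _ (fun u => #|[set x | pt x == pt u]|) (ltac:(by rewrite card_ord)).
exists u; rewrite -mu -{1}[n.+1]card_ord -sum1_card.
apply: (@leq_trans (\sum_(s <- parts pt) #|[set x | pt x == s]|)).
  have H s : #|[set x | pt x == s]| = \sum_x (pt x == s).
    by rewrite -sum1_card big_mkcond; apply: eq_bigr => x _; rewrite inE; case: (_ == _).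
  rewrite (eq_bigr _ (fun s _ => H s)) exchange_big /=; apply: leq_sum => x _.
  by rewrite (big_rem (pt x)) ?mem_parts //= eqxx.
rewrite -sum1_size big_distrl /=.
rewrite big_seq [X in _ <= X]big_seq; apply: leq_sum => s; rewrite mem_undup => /codomP[x ->].
by rewrite mul1n (@leq_bigmax _ (fun u => #|[set x | pt x == pt u]|) x).
Qed.

Lemma parts_lift n (pt : 'I_n.+1 -> nat) (u : 'I_n.+1) : size (parts (pt \o lift u)) <= size (parts pt).
Proof.
apply: uniq_leq_size; first exact: undup_uniq.
by move=> s; rewrite mem_undup => /codomP[x ->]; apply: mem_parts.
Qed.

Lemma card_neq_part n (pt : 'I_n -> nat) u :
  #|[set x | pt x != pt u]| = n - #|[set x | pt x == pt u]|.
Proof.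
have := cardsC [set x | pt x == pt u]; rewrite card_ord.
by have -> : ~: [set x | pt x == pt u] = [set x | pt x != pt u] by [apply/setP => x; rewrite !inE]; lia.
Qed.

(** Turán's bound by induction: among [n.+1] vertices, one in a largest part has at most
    [n - n %/ r] neighbours. *)
Lemma card_mgr_le r n (pt : 'I_n -> nat) : 0 < r -> size (parts pt) <= r -> #|mgr pt| <= tur r n.
Proof.
move=> r0; elim: n pt => [|n IH] pt sr.
  by rewrite leqn0 cards_eq0; apply/eqP/setP => e; rewrite !inE; apply/existsP => -[[]].
have [u hu] := big_part pt.
rewrite (card_mgr_delete _ u) leq_add ?IH ?(leq_trans (parts_lift _ _)) //.
rewrite card_neq_part; set a := #|_| in hu *.
have : n < r * a by apply: leq_trans hu _; rewrite leq_mul2r sr orbT.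
rewrite mulnC -ltn_divLR //; lia.
Qed.

Lemma card_mod_eq r n : 0 < r -> #|[set i : 'I_n | i %% r == n %% r]| = n %/ r.
Proof.
move=> r0; have lt (j : 'I_(n %/ r)) : j * r + n %% r < n.
  apply: (@leq_trans (n %/ r * r + n %% r)); last by rewrite -divn_eq.
  by rewrite ltn_add2r ltn_mul2r r0 ltn_ord.
rewrite -[RHS]card_ord -(card_imset (f := fun j => Ordinal (lt j))); last first.
  move=> i j /(congr1 val) /= /eqP; rewrite eqn_add2r eqn_mul2r => /orP[/eqP|/eqP /val_inj //]; lia.
apply: eq_card => i; rewrite inE; apply/eqP/imsetP => [ir|[j _ ->]]; last by rewrite /= modnMDl modn_mod.
have iq : i %/ r < n %/ r.
  have : i %/ r * r + i %% r < n %/ r * r + n %% r by rewrite -!divn_eq ltn_ord.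
  by rewrite ir ltn_add2r ltn_mul2r r0.
by exists (Ordinal iq) => //; apply: val_inj; rewrite /= -ir -divn_eq.
Qed.

Lemma eq_mgr n (f g : 'I_n -> nat) : f =1 g -> mgr f = mgr g.
Proof.
move=> fg; apply/setP => e; rewrite !in_set.
by apply: eq_existsb => x; apply: eq_existsb => y; rewrite !fg.
Qed.

Lemma card_turan r n : 0 < r -> #|turan r n| = tur r n.
Proof.
move=> r0; elim: n => [|n IH].
  by apply/eqP; rewrite cards_eq0; apply/eqP/setP => e; rewrite !inE; apply/existsP => -[[]].
rewrite turan_mgr (card_mgr_delete _ ord_max) /= (eq_mgr (g := fun i : 'I_n => i %% r)); last first.
  by move=> i /=; rewrite /bump leqNgt ltn_ord.
rewrite -turan_mgr IH; congr (_ + _); have /= -> := card_neq_part (fun i : 'I_n.+1 => i %% r) ord_max.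
suff -> : #|[set x : 'I_n.+1 | x %% r == @ord_max n %% r]| = (n %/ r).+1 by rewrite subSS.
rewrite (cardsD1 ord_max) inE eqxx -(card_mod_eq n r0) add1n; congr _.+1.
rewrite -[RHS](card_imset _ (@lift_inj _ ord_max)); apply: eq_card => x.
apply/idP/imsetP => [|[y]]; last first.
  by rewrite !inE => yn ->; rewrite eq_sym neq_lift /= /bump leqNgt ltn_ord.
rewrite !inE => /andP[xn xr]; have [y xy|xy] := unliftP ord_max x; last by rewrite xy eqxx in xn.
by exists y => //; rewrite inE; move: xr; rewrite xy /= /bump leqNgt ltn_ord.
Qed.

Lemma c3_turan k (pat : {set 'I_k} -> nat) r n : 0 < r < k -> c3 pat (turan r n) = 3 ^ tur r n.
Proof.
move=> /andP[r0 rk]; rewrite -(card_turan n r0) -card_colorings; apply: eq_card => c; rewrite !in_set.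
case: (coloring_of _ c) => //=; apply/existsP => -[f /andP[/andP[_ /forallP fE] _]].
pose g i : 'I_r := Ordinal (ltn_pmod (f i) r0).
suff : #|'I_k| <= #|'I_r| by rewrite !card_ord leqNgt rk.
rewrite -(card_imset _ (_ : injective g)) ?max_card // => i j /(congr1 val) /= ij.
apply/eqP/negPn/negP => nij; have /forallP/(_ j)/implyP/(_ nij) := fE i.
by rewrite turan_mgr mgrE ij eqxx.
Qed.

Section Delete.

Variables (n k : nat) (pat : {set 'I_k} -> nat) (pt : 'I_n.+1 -> nat) (u : 'I_n.+1).

Definition col_lift (c : {ffun {set 'I_n.+1} -> 'I_3}) : {ffun {set 'I_n} -> 'I_3} :=
  [ffun e : {set 'I_n} => c (lift u @: e)].

Definition row (c : {ffun {set 'I_n.+1} -> 'I_3}) : {ffun 'I_n.+1 -> 'I_3} :=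
  [ffun x => c [set u; x]].

Lemma col_lift_cols c : c \in cols pat (mgr pt) -> col_lift c \in cols pat (mgr (pt \o lift u)).
Proof.
rewrite !inE => /andP[/forallP cE av]; apply/andP; split.
  by apply/forallP => e; apply/implyP => eE; rewrite ffunE; apply: (implyP (cE _)); rewrite mgr_lift.
apply: contra av => /existsP[f fc]; apply/existsP; exists [ffun i => lift u (f i)].
have fE (e : {set 'I_k}) : [ffun i => lift u (f i)] @: e = lift u @: (f @: e).
  by rewrite -imset_comp; apply: eq_imset => i; rewrite ffunE.
have /andP[/andP[/injectiveP finj /forallP fP] _] := fc.
apply: is_copy_transfer fc => [|e _]; last by rewrite ffunE fE.
apply/andP; split; first by apply/injectiveP => i j; rewrite !ffunE => /lift_inj /finj.
apply/forallP => i; apply/forallP => j; apply/implyP => ij; rewrite !ffunE -imset_set2 mgr_lift.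
by have /forallP/(_ j)/implyP := fP i; apply.
Qed.

(** A colouring is determined by its restriction off [u] and its row at [u], so bounding the
    possible rows bounds the loss under deletion. *)
Lemma delete_count (A : {set {ffun {set 'I_n.+1} -> 'I_3}}) (Rs : {set {ffun 'I_n.+1 -> 'I_3}}) :
  A \subset cols pat (mgr pt) -> {in A, forall c, row c \in Rs} ->
  #|A| <= c3 pat (mgr (pt \o lift u)) * #|Rs|.
Proof.
move=> /subsetP AE AR; rewrite -cardsX.
rewrite -(card_in_imset (f := fun c => (col_lift c, row c)) (D := A)).
  apply: subset_leq_card; apply/subsetP => _ /imsetP[c cA ->].
  by rewrite in_setX AR // andbT; apply: col_lift_cols; apply: AE.
move=> c c' /AE + /AE; rewrite !inE => /andP[/forallP z _] /andP[/forallP z' _] [/ffunP H /ffunP Hr].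
apply/ffunP => e; have [ue|ue] := boolP (u \in e); last first.
  by have [e' ->] := lift_preimage ue; have := H e'; rewrite !ffunE.
have [eE|eE] := boolP (e \in mgr pt); last by rewrite (eqP (implyP (z e) eE)) (eqP (implyP (z' e) eE)).
have e2 := is_graph2 (mgr_graph pt) eE.
have : 0 < #|e :\ u| by move: e2; rewrite (cardsD1 u) ue add1n => -[->].
case/card_gt0P => x; rewrite in_setD1 => /andP[xu xe]; rewrite eq_sym in xu.
by rewrite (set2_eq e2 xu ue xe); have := Hr x; rewrite !ffunE.
Qed.

Lemma c3_delete :
  c3 pat (mgr pt) <= c3 pat (mgr (pt \o lift u)) * 3 ^ #|[set x | pt x != pt u]|.
Proof.
pose Rs := [set r in pffun_on (ord0 : 'I_3) [pred x | pt x != pt u] predT].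
apply: leq_trans (@delete_count _ Rs (subxx _) _) _.
  move=> c; rewrite !inE => /andP[/forallP z _]; apply/pffun_onP; split=> //.
  apply/subsetP => x; rewrite !inE ffunE; apply: contraR; rewrite negbK => /eqP xu.
  by apply: (implyP (z _)); rewrite mgrE xu eqxx.
by rewrite leq_mul2l cardsE card_pffun_on card_ord cardsE leqnn orbT.
Qed.

End Delete.

(* Deleting a vertex that costs one factor 3 less than in the Turan graph can be iterated only boundedly often. *)
Lemma turan_extremal k (pat : {set 'I_k} -> nat) r n0 : 1 < r < k ->
  (forall n (pt : 'I_n.+1 -> nat), n0 <= n -> r < size (parts pt) -> 3 ^ tur r n.+1 <= c3 pat (mgr pt) ->
    exists u, c3 pat (mgr pt) <= c3 pat (mgr (pt \o lift u)) * 3 ^ (n - n %/ r).-1) ->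
  exists N, forall n, N <= n -> c3 pat (turan r n) = c3max pat n.
Proof.
move=> /andP[r1 rk] H; have r0 : 0 < r by lia.
(* Crude bound for the number of edges on [n0.+1] vertices, hence for any surplus that survives down
   to that size. *)
pose B := #|{set 'I_n0.+1}|.
have few n (pt : 'I_n -> nat) : size (parts pt) <= r -> c3 pat (mgr pt) <= 3 ^ tur r n.
  by move=> ?; apply: leq_trans (c3_le _ _) _; rewrite leq_exp2l // card_mgr_le.
(* [m] is the surplus over the Turán graph in the exponent of 3; each deletion raises it by 1. A
   deletion may leave only [r] parts, but then [0 < m] contradicts [few], whence the disjunction. *)
have gain d : forall (pt : 'I_(d + n0.+1) -> nat) m, r < size (parts pt) \/ 0 < m ->
    3 ^ (tur r (d + n0.+1) + m) <= c3 pat (mgr pt) -> d + m <= B.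
  elim: d => [|d IH] pt m Hm le.
    have := leq_trans le (c3_le _ _); rewrite leq_exp2l // => le'.
    have mB : #|mgr pt| <= B by apply: max_card.
    by apply: leq_trans mB; apply: leq_trans le'; rewrite !add0n leq_addl.
  have {}le : 3 ^ (tur r (d + n0.+1) + ((d + n0.+1) - (d + n0.+1) %/ r) + m) <= c3 pat (mgr pt) := le.
  have lt : r < size (parts pt).
    case: Hm => // m0; rewrite ltnNge; apply/negP => /few; rewrite leqNgt => /negP; apply.
    by apply: leq_trans le; rewrite ltn_exp2l // -[X in X < _]addn0 ltn_add2l.
  have [||u Hu] := H (d + n0.+1) pt _ lt; first by lia.
    by apply: leq_trans le; rewrite leq_exp2l // leq_addr.
  rewrite addSnnS; apply: (IH (pt \o lift u)); first by right.
  have d1 : (d + n0.+1) %/ r < d + n0.+1 by rewrite ltn_Pdiv //; lia.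
  rewrite -(leq_pmul2r (m := 3 ^ ((d + n0.+1) - (d + n0.+1) %/ r).-1)) ?expn_gt0 //.
  apply: leq_trans Hu; rewrite -expnD; apply: leq_trans le; rewrite leq_exp2l //=; lia.
exists (n0.+1 + B).+1 => n nN; have [pt cpt] := c3max_mgr n pat.
apply/eqP; rewrite eqn_leq (c3_turan pat n (r := r)); last by rewrite r0.
apply/andP; split.
  rewrite -(c3_turan pat n (r := r)) ?r0 // /c3max turan_mgr.
  by rewrite (bigD1 (mgr (fun i : 'I_n => i %% r))) ?mgr_graph //= leq_maxl.
rewrite cpt; have [|lt] := leqP (size (parts pt)) r; first exact: few.
rewrite leqNgt; apply/negP => /ltnW le; have nE : n = (n - n0.+1) + n0.+1 by lia.
move: pt cpt lt le; rewrite nE => pt cpt lt le.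
have := gain _ pt 0 (or_introl lt); rewrite addn0 => /(_ le); lia.
Qed.

(** * Counting colorings *)

Section Counting.

Variable T : finType.
Implicit Types (E : {set T}) (c : {ffun T -> 'I_3}).

Definition fam E : {set {ffun T -> 'I_3}} := [set c in pffun_on (ord0 : 'I_3) E predT].

Lemma famP E c : reflect (forall e, e \notin E -> c e = ord0) (c \in fam E).
Proof.
rewrite inE; apply: (iffP pffun_onP) => [[H _] e eE|H].
  by apply/eqP; apply: contraNT eE => ce; apply: (subsetP H); rewrite inE.
by split=> //; apply/subsetP => e; rewrite inE; apply: contraR => /H->.
Qed.

Lemma card_fam E : #|fam E| = 3 ^ #|E|.
Proof. by rewrite cardsE card_pffun_on card_ord. Qed.

(** Generating-function form of a Chernoff bound: a colouring has weight [x] to the number of its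
    rare edges, at least [x ^+ d] on [A], and the weights of all colourings of [E] sum to the
    product over edges. *)
Lemma weighted_count (R : realFieldType) E (A : {set {ffun T -> 'I_3}})
    (rare : T -> {set 'I_3}) (x : R) d :
  (0 < x <= 1)%R -> A \subset fam E ->
  {in A, forall c, #|[set e in E | c e \in rare e]| <= d} ->
  (#|A|%:R * x ^+ d <= \prod_(e in E) ((3 - #|rare e|)%:R + x * #|rare e|%:R))%R.
Proof.
move=> /andP[x0 x1] /subsetP AE Ad.
have Hs e : ((3 - #|rare e|)%:R + x * #|rare e|%:R = \sum_(k : 'I_3) x ^+ (k \in rare e))%R.
  rewrite (bigID (mem (rare e))) /= [RHS]addrC; congr (_ + _)%R; last first.
    rewrite (eq_bigr (fun _ => x)) => [|i ir]; last by rewrite ir.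
    by rewrite sumr_const mulr_natr.
  rewrite (eq_bigr (fun _ => 1%R)) => [|i ni]; last by rewrite (negbTE ni).
  rewrite sumr_const; congr (_ *+ _)%R.
  apply/eqP; rewrite -(eqn_add2l #|rare e|) subnKC; last by rewrite -[X in _ <= X](card_ord 3) max_card.
  by rewrite -[X in X == _](card_ord 3) -(cardC (mem (rare e))).
rewrite (eq_bigr _ (fun e _ => Hs e)) (big_distr_big ord0) /=.
rewrite (bigID (mem A)) /= -[X in (X <= _)%R]addr0; apply: lerD; last first.
  by apply: sumr_ge0 => c _; apply: prodr_ge0 => e _; rewrite exprn_ge0 // ltW.
rewrite (eq_bigl (mem A)) => [|c]; last first.
  by rewrite /= andbC; case: (boolP (c \in A)) => //= /AE; rewrite inE => ->.
rewrite mulr_natl -sumr_const; apply: ler_sum => c cA.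
rewrite prodrXr; apply: ler_wiXn2l; rewrite ?(ltW x0) //.
apply: leq_trans (Ad c cA); rewrite -sum1_card big_mkcond [X in (_ <= X)%N]big_mkcond /=.
by apply: leq_sum => e _; rewrite inE; case: (e \in E); case: (c e \in _).
Qed.

Section Blocks.

Variables (I : eqType) (E : {set T}) (b : I -> {set T}) (tg : I -> T -> 'I_3) (C : nat).

Definition missing (s : seq I) : {set {ffun T -> 'I_3}} :=
  [set c in fam E | all (fun i => [exists e in b i, c e != tg i e]) s].

(** Recolouring block [i] to its target is at most [3 ^ C] to one and, by disjointness, leaves the
    other blocks alone. So at least a fraction [1 / 3 ^ C] of [missing s] meets the target on [i],
    and each further block multiplies the count by at most [1 - 1 / 3 ^ C]. *)
Lemma block_count s : uniq s -> {in s, forall i, b i \subset E /\ #|b i| <= C} ->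
  {in s &, forall i j, i != j -> [disjoint b i & b j]} ->
  #|missing s| * (3 ^ C) ^ size s <= 3 ^ #|E| * (3 ^ C - 1) ^ size s.
Proof.
elim: s => [|i s IH] /=.
  by move=> _ _ _; rewrite !expn0 !muln1 -card_fam; apply: subset_leq_card; apply/subsetP => c; rewrite inE => /andP[].
move=> /andP[iS uS] HE Hd.
have sub j : j \in s -> j \in i :: s by rewrite inE orbC => ->.
have {}IH := IH uS (fun j js => HE j (sub _ js)) (fun j l js ls => Hd j l (sub _ js) (sub _ ls)).
have [bE bC] := HE i (mem_head _ _).
pose M := [set c in missing s | [forall e in b i, c e == tg i e]].
have split_ : #|missing s| = #|missing (i :: s)| + #|M|.
  rewrite -(cardsID M) addnC; congr (_ + _); last by apply: eq_card => c; rewrite in_setI [c \in M]inE andbA andbb.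
  apply: eq_card => c; rewrite in_setD [c \in M]inE [c \in missing (i :: s)]inE [c \in missing s]inE /=.
  by rewrite -negb_forall_in; case: (c \in _); case: (all _ _); case: [forall _ in _, _].
have MC : #|missing s| <= #|M| * 3 ^ C.
  apply: (@leq_trans (#|M| * #|fam (b i)|)); last by rewrite leq_mul2l card_fam leq_exp2l // bC orbT.
  rewrite -cardsX.
  pose F c := ([ffun e => if e \in b i then tg i e else c e] : {ffun T -> 'I_3},
               [ffun e => if e \in b i then c e else ord0] : {ffun T -> 'I_3}).
  rewrite -(card_in_imset (f := F)); last first.
    move=> c c' _ _ [/ffunP H1 /ffunP H2]; apply/ffunP => e.
    by have := H1 e; have := H2 e; rewrite !ffunE; case: ifP.
  apply: subset_leq_card; apply/subsetP => _ /imsetP[c + ->].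
  rewrite inE => /andP[/famP cE /allP cs]; rewrite in_setX; apply/andP; split; last first.
    by apply/famP => e /negbTE eb; rewrite ffunE eb.
  rewrite inE; apply/andP; split; last by apply/forall_inP => e eb; rewrite ffunE eb.
  rewrite inE; apply/andP; split.
    by apply/famP => e eE; rewrite ffunE ifN ?cE //; apply: contra eE; apply: (subsetP bE).
  apply/allP => j js; have /exists_inP[e ej ce] := cs j js; apply/exists_inP; exists e => //.
  rewrite ffunE ifN //; apply: contraL ej => ei.
  have ij : i != j by apply: contraNneq iS => ->.
  by rewrite (disjointFr (Hd i j (mem_head _ _) (sub _ js) ij) ei).
set p := (3 ^ C) in IH MC *; have p0 : 0 < p by rewrite expn_gt0.
rewrite !expnS; apply: (@leq_trans (#|missing s| * (p - 1) * p ^ size s)).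
  rewrite mulnA leq_mul2r; apply/orP; right; rewrite mulnBr muln1 leq_subRL; last by rewrite leq_pmulr.
  by rewrite addnC {2}split_ mulnDl -/p addnC [in X in _ <= X]addnC leq_add2r.
by rewrite mulnAC mulnC [X in _ <= X]mulnCA leq_mul2l IH orbT.
Qed.

End Blocks.

End Counting.

(** * Graphs close to the Turan graph *)

Lemma edgesK_imset r (T : finType) (b : 'I_r -> T) (e : {set 'I_r}) :
  injective b -> [set j | b j \in b @: e] = e.
Proof. by move=> bi; apply/setP => j; rewrite inE mem_imset. Qed.

Section Near.

Variables (r : nat) (pat : {set 'I_r.+1} -> nat).
Hypothesis r1 : 1 < r.
Variables (n : nat) (pt : 'I_n.+1 -> nat) (W : 'I_r -> nat).
Hypothesis Winj : injective W.

Let part j := [set y | pt y == W j].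

Definition realizes (c : {ffun {set 'I_n.+1} -> 'I_3}) (B : {ffun 'I_r -> {set 'I_n.+1}})
    (chi : {ffun {set 'I_r} -> 'I_3}) : bool :=
  [exists b : {ffun 'I_r -> 'I_n.+1}, [forall j, b j \in B j] &&
     [forall e in edgesK r, c (b @: e) == chi e]].

Definition large m (B : {ffun 'I_r -> {set 'I_n.+1}}) : bool :=
  [forall j, (B j \subset part j) && (m <= #|B j|)].

(** Substitute for regularity between the [r] large parts, obtained by direct counting and
    independent of templates. *)
Definition universal m c : bool :=
  [forall B, large m B ==> [forall chi, realizes c B chi]].

Definition rare_at m (rho : {ffun 'I_n.+1 -> 'I_3}) (j : 'I_r) (i : 'I_3) : bool :=
  #|[set y in part j | rho y == i]| < m.

Lemma frequent_color m rho j : 3 * m <= #|part j| -> exists i, ~~ rare_at m rho j i.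
Proof.
move=> le; apply/existsP; rewrite -[X in is_true X]negbK negb_exists; apply/negP => /forallP H.
have part_sum : #|part j| = \sum_(i < 3) #|[set y in part j | rho y == i]|.
  rewrite -sum1_card (partition_big rho predT) //=; apply: eq_bigr => i _.
  by rewrite -sum1_card; apply: eq_bigl => y; rewrite inE.
have H' i : #|[set y in part j | rho y == i]| < m by have := H i; rewrite negbK.
have : \sum_(i < 3) #|[set y in part j | rho y == i]|.+1 <= \sum_(i < 3) m by apply: leq_sum => i _; apply: H'.
rewrite sum_nat_const card_ord; apply/negP; rewrite -ltnNge; apply: leq_ltn_trans le _.
by rewrite part_sum !big_ord_recr big_ord0 /=; lia.
Qed.

Lemma cover_two (S : {set 'I_r}) : #|S| <= 2 -> exists j1 j2, j1 != j2 /\ S \subset [set j1; j2].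
Proof.
move=> S2; have r0 : 0 < r by lia.
pose z0 := Ordinal r0; pose z1 := Ordinal r1.
have [S0|[x xS]] := set_0Vmem S; first by exists z0, z1; rewrite S0 sub0set.
have [y [yx Sy]] : exists y, y != x /\ S :\ x \subset [set y].
  have [S0|[y yS]] := set_0Vmem (S :\ x).
    have [xz|xz] := eqVneq x z0; first by exists z1; rewrite S0 sub0set xz.
    by exists z0; rewrite S0 sub0set eq_sym.
  exists y; split; first by move: yS; rewrite !inE => /andP[].
  have : #|(S :\ x) :\ y| == 0 by move: S2; rewrite (cardsD1 x S) xS (cardsD1 y (S :\ x)) yS; lia.
  by rewrite cards_eq0 -subset0 subDset setU0.
exists x, y; rewrite eq_sym; split=> //; apply/subsetP => z zS.
have [->|zx] := eqVneq z x; first by rewrite !inE eqxx.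
by have := subsetP Sy z; rewrite !inE zx zS => /(_ isT)->; rewrite orbT.
Qed.

(** If at most two parts lacked a colour, take a pattern colouring whose edges from [u] to these two
    parts have frequent colours. In every part at least [m] vertices then have the required colour
    towards [u], and universality finds among them a [K_r] with the remaining colours: a copy. *)
Lemma universal_rare a m c (u : 'I_n.+1) : num_classes pat = 2 -> a \in pclasses pat ->
  (forall j, pt u != W j) -> (forall j, 3 * m <= #|part j|) ->
  c \in cols pat (mgr pt) -> universal m c -> 2 < #|[set j | [exists i, rare_at m (row u c) j i]]|.
Proof.
move=> n2 aP uW mW; rewrite inE => /andP[_ av] /forallP univ; rewrite ltnNge; apply/negP => /cover_two[j1 [j2 [j12 sub]]].
have [i1 fi1] := frequent_color (row u c) (mW j1).
have [i2 fi2] := frequent_color (row u c) (mW j2).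
have [JK J0 JnK _] := pclass_two n2 aP.
have [chi [pchi c1 c2]] : exists chi, [/\ pcol (pclass pat a) chi, chi [set ord0; lift ord0 j1] = i1
    & chi [set ord0; lift ord0 j2] = i2].
  by apply: pcol_star; rewrite ?neq_lift ?(inj_eq lift_inj).
(* [u] takes the vertex [ord0] of the pattern, and part [j] supplies the vertex [lift ord0 j]. *)
pose B := [ffun j => [set y in part j | row u c y == chi [set ord0; lift ord0 j]]].
have lB : large m B.
  apply/forallP => j; rewrite ffunE; apply/andP; split; first by apply/subsetP => y; rewrite inE => /andP[].
  have [->|nj1] := eqVneq j j1; first by rewrite c1 leqNgt.
  have [->|nj2] := eqVneq j j2; first by rewrite c2 leqNgt.
  rewrite leqNgt; apply/negP => H.
  have : j \in [set j | [exists i, rare_at m (row u c) j i]] by rewrite inE; apply/existsP; exists (chi [set ord0; lift ord0 j]).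
  by move/(subsetP sub); rewrite !inE (negbTE nj1) (negbTE nj2).
have /existsP[b /andP[/forallP bB /forall_inP bchi]] :=
  forallP (implyP (univ B) lB) [ffun e : {set 'I_r} => chi (lift ord0 @: e)].
pose f : {ffun 'I_r.+1 -> 'I_n.+1} := [ffun i : 'I_r.+1 => if unlift ord0 i is Some j then b j else u].
have f0 : f ord0 = u by rewrite ffunE unlift_none.
have fl j : f (lift ord0 j) = b j by rewrite ffunE liftK.
have ptb j : pt (b j) = W j by have := bB j; rewrite ffunE !inE => /andP[/eqP].
have fE i j : i != j -> pt (f i) != pt (f j).
  have [i'|] := unliftP ord0 i; have [j'|] := unliftP ord0 j => -> ->; rewrite ?f0 ?fl ?ptb ?eqxx //.
  - by rewrite (inj_eq lift_inj) (inj_eq Winj).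
  - by move=> _; rewrite eq_sym uW.
have [|e + /negP] := avoids_pcol (f := f) n2 aP av _ pchi.
  apply/andP; split.
    by apply/injectiveP => i j fij; apply/eqP/negPn/negP => /fE; rewrite fij eqxx.
  by apply/forallP => i; apply/forallP => j; apply/implyP => /fE; rewrite mgrE.
case/edgesKP => [x [y [xy ->]]]; apply; rewrite imset_set2.
have star j : c [set u; b j] == chi [set ord0; lift ord0 j].
  by have := bB j; rewrite ffunE !inE => /andP[_]; rewrite ffunE.
have [x' xE|x0] := unliftP ord0 x; have [y' yE|y0] := unliftP ord0 y.
- rewrite xE yE !fl -!imset_set2; have := bchi [set x'; y']; rewrite ffunE; apply.
  by rewrite edgesK2 -(inj_eq (@lift_inj _ ord0)) -xE -yE.
- by rewrite xE y0 f0 fl setUC [X in chi X]setUC.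
- by rewrite yE x0 f0 fl.
by move: xy; rewrite x0 y0 eqxx.
Qed.

Section Nonuniversal.

Variables (q : nat) (B : {ffun 'I_r -> {set 'I_n.+1}}) (chi : {ffun {set 'I_r} -> 'I_3}).
Hypothesis lB : large (r * q) B.

(* Lines [j |-> x + j * y] meet in at most one position, so these transversals are edge-disjoint. *)
Let tr (p : nat * nat) (j : 'I_r) : 'I_n.+1 := nth ord0 (enum (B j)) (p.1 + j * p.2).
Let blk p := [set tr p @: (e : {set 'I_r}) | e in edgesK r].
Let tg p (e : {set 'I_n.+1}) := chi [set j | tr p j \in e].
Let grid := [seq (x, y) | x <- iota 0 q, y <- iota 0 q].

Let gridP p : p \in grid -> p.1 < q /\ p.2 < q.
Proof. by case/allpairsP => -[x y] /= [+ + ->]; rewrite !mem_iota !add0n. Qed.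

(** The reason for [r * q] in [lB]: [x + j * y] stays below it when [x, y < q] and [j < r]. *)
Let idx p j : p \in grid -> p.1 + (j : 'I_r) * p.2 < size (enum (B j)).
Proof.
case/gridP => p1 p2; rewrite -cardE; have /forallP/(_ j)/andP[_] := lB; apply: leq_trans.
have := ltn_ord j; have q0 : 0 < q by lia.
move=> jr; apply: (@leq_trans (q + j * q)); last by rewrite -mulSn leq_mul2r jr orbT.
by rewrite -addSn; apply: leq_add; rewrite ?leq_mul2l ?(ltnW p2) ?orbT.
Qed.

Let tr_part p j : p \in grid -> pt (tr p j) = W j.
Proof.
move=> pg; have : tr p j \in B j by rewrite -mem_enum mem_nth // idx.
by have /forallP/(_ j)/andP[/subsetP H _] := lB; move/H; rewrite inE => /eqP.
Qed.

Let tr_inj p : p \in grid -> injective (tr p).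
Proof. by move=> pg i j /(congr1 pt); rewrite !tr_part // => /Winj. Qed.

(** A common edge determines the two parts it joins, so the two lines agree at two positions and are
    equal. *)
Let blk_disjoint p p' : p \in grid -> p' \in grid -> p != p' -> [disjoint blk p & blk p'].
Proof.
move=> pg pg'; rewrite -setI_eq0; apply: contraNT => /set0Pn[e0].
rewrite inE => /andP[/imsetP[e eK ->] /imsetP[e' eK' ee']].
have eq_e : e = e'.
  apply/setP => j; have H := fun x : 'I_n.+1 => (congr1 (fun A : {set _} => x \in A) ee').
  apply/idP/idP => je.
    have := H (tr p j); rewrite imset_f // => /esym/imsetP[j' j'e' /(congr1 pt)].
    by rewrite !tr_part // => /Winj->.
  have := H (tr p' j); rewrite [RHS]imset_f // => /imsetP[j' j'e' /(congr1 pt)].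
  by rewrite !tr_part // => /Winj->.
have tr_eq j : j \in e -> p.1 + j * p.2 = p'.1 + j * p'.2.
  move=> je; have : tr p j \in tr p' @: e' by rewrite -ee' imset_f.
  case/imsetP => j' _ tjj; have := congr1 pt tjj; rewrite !tr_part // => /Winj jj'; move: tjj.
  rewrite -jj' => /eqP; rewrite nth_uniq ?enum_uniq ?idx // => /eqP //.
move: eK; move: eq_e tr_eq => _ tr_eq /edgesKP[i [j [ij eij]]].
have := tr_eq i; have := tr_eq j; rewrite eij !inE !eqxx orbT => /(_ isT) H1 /(_ isT) H2.
move: ij; rewrite -val_eqE; move: p p' H1 H2 {pg pg' ee' tr_eq} => [x y] [x' y'] /= H1 H2 ij.
have [lt|lt] : i < j \/ j < i by lia.
  have -> : y = y' by nia.
  by apply/eqP; congr (_, _); nia.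
have -> : y = y' by nia.
by apply/eqP; congr (_, _); nia.
Qed.

(** The [q * q] transversals form edge-disjoint blocks, on each of which the colouring has to
    deviate from [chi]. *)
Lemma count_not_realizes :
  #|[set c in cols pat (mgr pt) | ~~ realizes c B chi]| * (3 ^ #|edgesK r|) ^ (q * q)
  <= 3 ^ #|mgr pt| * (3 ^ #|edgesK r| - 1) ^ (q * q).
Proof.
have sz : size grid = q * q by rewrite size_allpairs size_iota.
have ug : uniq grid by apply: allpairs_uniq; rewrite ?iota_uniq // => -[x y] [x' y'].
have H1 : {in grid, forall p, blk p \subset mgr pt /\ #|blk p| <= #|edgesK r|}.
  move=> p pg; split; last exact: leq_imset_card.
  apply/subsetP => _ /imsetP[_ /edgesKP[i [j [ij ->]]] ->].
  by rewrite imset_set2 mgrE !tr_part // (inj_eq Winj).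
have H2 : {in grid &, forall p p', p != p' -> [disjoint blk p & blk p']} by move=> p p'; apply: blk_disjoint.
have := block_count tg ug H1 H2; rewrite sz; apply: leq_trans; rewrite leq_mul2r; apply/orP; right.
apply: subset_leq_card; apply/subsetP => c; rewrite in_set [c \in cols _ _]in_set => /andP[/andP[/forallP cE _] nr].
rewrite in_set; apply/andP; split.
  by apply/famP => e eE; apply/eqP; apply: (implyP (cE e)).
apply/allP => p pg; apply: contraR nr => /exists_inPn H.
apply/existsP; exists [ffun j => tr p j]; apply/andP; split.
  by apply/forallP => j; rewrite ffunE -mem_enum mem_nth // idx.
apply/forall_inP => e eK.
have -> : [ffun j => tr p j] @: e = tr p @: e by apply: eq_imset => j; rewrite ffunE.
have := H (tr p @: e); rewrite imset_f // negbK /tg edgesK_imset; last exact: tr_inj.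
by apply.
Qed.

End Nonuniversal.

(** Union bound over [B] and [chi]: the number of choices is exponential in [n], the saving is
    exponential in [q * q], and [q] will be linear in [n]. *)
Lemma count_nonuniversal q :
  #|[set c in cols pat (mgr pt) | ~~ universal (r * q) c]| * (3 ^ #|edgesK r|) ^ (q * q)
  <= (2 ^ n.+1) ^ r * 3 ^ (2 ^ r) * (3 ^ #|mgr pt| * (3 ^ #|edgesK r| - 1) ^ (q * q)).
Proof.
set M := 3 ^ _ * _ ^ _; set P := _ ^ (q * q) in M *.
have cardI : #|{: {ffun 'I_r -> {set 'I_n.+1}} * {ffun {set 'I_r} -> 'I_3}}| = (2 ^ n.+1) ^ r * 3 ^ (2 ^ r).
  by rewrite card_prod !card_ffun !card_ord -!cardsT -!powersetT !card_powerset !cardsT !card_ord.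
rewrite -cardI -[X in _ <= X](sum_nat_const _ M).
pose F (p : {ffun 'I_r -> {set 'I_n.+1}} * {ffun {set 'I_r} -> 'I_3}) :=
  [set c in cols pat (mgr pt) | large (r * q) p.1 && ~~ realizes c p.1 p.2].
apply: (@leq_trans (\sum_p #|F p| * (3 ^ #|edgesK r|) ^ (q * q))); last first.
  rewrite [X in _ <= X](eq_bigl predT) //; apply: leq_sum => -[B chi] _; rewrite /F /=.
  have [lB|lB] := boolP (large _ B); last first.
    by rewrite (_ : [set _ in _ | _] = set0) ?cards0 //; apply/setP => c; rewrite !inE andbF.
  exact: count_not_realizes.
rewrite -big_distrl leq_mul2r; apply/orP; right => /=.
rewrite -sum1_card; apply: (@leq_trans (\sum_(c in [set c in cols pat (mgr pt) | ~~ universal (r * q) c]) \sum_p (c \in F p))).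
  apply: leq_sum => c; rewrite inE => /andP[cE].
  rewrite negb_forall => /existsP[B]; rewrite negb_imply => /andP[lB]; rewrite negb_forall => /existsP[chi nr].
  by rewrite (bigD1 (B, chi)) //= in_set cE lB nr.
rewrite exchange_big /=; apply: leq_sum => p _.
rewrite -sum1_card big_mkcond [X in _ <= X]big_mkcond; apply: leq_sum => c _.
by case: (_ \in [set _ in _ | _]); case: (c \in F p).
Qed.

Definition rare_rows m : {set {ffun 'I_n.+1 -> 'I_3}} :=
  [set rho | 2 < #|[set j | [exists i, rare_at m rho j i]]|].

Section RareRows.

Variables (R : realFieldType) (x : R) (m p0 : nat).
Hypotheses (x01 : (0 < x <= 1)%R) (p0P : forall j, p0 <= #|part j|).

Let x0 : (0 < x)%R. Proof. by case/andP: x01. Qed.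
Let x1 : (x <= 1)%R. Proof. by case/andP: x01. Qed.

Let card_three (j1 j2 j3 : 'I_r) : j1 != j2 -> j2 != j3 -> j3 != j1 ->
  3 * p0 <= #|part j1 :|: part j2 :|: part j3|.
Proof.
move=> j12 j23 j31.
have dis i j : i != j -> [disjoint part i & part j].
  move=> ij; rewrite -setI_eq0; apply/set0Pn => -[y]; rewrite !inE => /andP[/eqP-> /eqP/Winj ji].
  by rewrite ji eqxx in ij.
rewrite cardsU (_ : _ :&: part j3 = set0); last first.
  by apply/eqP; rewrite setIUl setU_eq0 !setI_eq0 !dis // eq_sym.
rewrite cards0 subn0 cardsU (_ : part j1 :&: part j2 = set0); last by apply/eqP; rewrite setI_eq0 dis.
by rewrite cards0 subn0; have := p0P j1; have := p0P j2; have := p0P j3; lia.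
Qed.

Lemma three_parts (j1 j2 j3 : 'I_r) : j1 != j2 -> j2 != j3 -> j3 != j1 -> 3 * p0 <= n.+1.
Proof.
move=> a1 a2 a3; apply: leq_trans (card_three a1 a2 a3) _.
by rewrite -[X in _ <= X](card_ord n.+1) max_card.
Qed.

(** As [2 + x <= 3], a lower bound may replace the true size of the three parts. *)
Let pow_shift t p N : t <= p -> p <= N ->
  (3 ^+ (N - p) * (2 + x) ^+ p <= 3 ^+ (N - t) * (2 + x) ^+ t)%R.
Proof.
move=> tp pN; have -> : N - t = (N - p) + (p - t) by lia.
rewrite -{2}(subnK tp) !exprD !mulrA; apply: ler_wpM2r; first by rewrite exprn_ge0 //; have := x0; lra.
apply: ler_wpM2l; first by rewrite exprn_ge0.
by apply: lerXn2r; rewrite ?nnegrE //; have := x0; have := x1; lra.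
Qed.

(** The weighted count applied to vertices: on each of the three parts one colour weighs [x] instead
    of 1, giving the factor [2 + x], and fewer than [m] occurrences per part give the exponent
    [3 * m]. *)
Lemma count_three_rare (j1 j2 j3 : 'I_r) (i1 i2 i3 : 'I_3) : j1 != j2 -> j2 != j3 -> j3 != j1 ->
  (#|[set rho | [&& rare_at m rho j1 i1, rare_at m rho j2 i2 & rare_at m rho j3 i3]]|%:R * x ^+ (3 * m)
   <= 3 ^+ (n.+1 - 3 * p0) * (2 + x) ^+ (3 * p0))%R.
Proof.
move=> j12 j23 j31; set A := [set rho | _].
pose rar y := if pt y == W j1 then [set i1] else if pt y == W j2 then [set i2]
  else if pt y == W j3 then [set i3] else set0.
pose P := part j1 :|: part j2 :|: part j3.
have cP : 3 * p0 <= #|P| by apply: card_three.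
have Ad : {in A, forall c : {ffun 'I_n.+1 -> 'I_3}, #|[set e in [set: 'I_n.+1] | c e \in rar e]| <= 3 * m}.
  move=> c; rewrite in_set => /and3P[H1 H2 H3].
  apply: (@leq_trans #|[set y in part j1 | c y == i1] :|: [set y in part j2 | c y == i2] :|: [set y in part j3 | c y == i3]|).
    apply: subset_leq_card; apply/subsetP => y; rewrite !inE /rar /=.
    case: ifP => [_|_]; first by rewrite inE => ->.
    case: ifP => [_|_]; first by rewrite inE => ->; rewrite orbT.
    by case: ifP => [_|_]; rewrite ?inE // => ->; rewrite orbT.
  apply: leq_trans (leq_card_setU _ _) _; apply: leq_trans (leq_add (leq_card_setU _ _) (leqnn _)) _.
  apply: (@leq_trans (m + m + m)); last by lia.
  by apply: leq_add; [apply: leq_add|]; apply: ltnW; [exact: H1|exact: H2|exact: H3].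
have AT : A \subset fam [set: 'I_n.+1] by apply/subsetP => c _; apply/famP => e; rewrite inE.
apply: le_trans (weighted_count x01 AT Ad) _.
rewrite (eq_bigr (fun y => if y \in P then 2 + x else 3)%R); last first.
  move=> y _; rewrite /rar /P !inE; case: ifP => _; first by rewrite cards1 mulr1.
  case: ifP => _; first by rewrite cards1 mulr1.
  by case: ifP => _; rewrite ?cards1 ?cards0 /= ?mulr1 // mulr0 addr0.
rewrite (eq_bigl predT) => [|y]; last by rewrite inE.
rewrite (bigID (mem P)) /= (eq_bigr (fun _ => (2 + x)%R)) => [|i ->//].
rewrite [X in (_ * X)%R](eq_bigr (fun _ => 3%R)) => [|i /negbTE->//].
rewrite !prodr_const mulrC.
have Pn : #|P| <= n.+1 by rewrite -[X in _ <= X](card_ord n.+1) max_card.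
have -> : #|[pred i | i \notin P]| = n.+1 - #|P|.
  by apply/eqP; rewrite -(eqn_add2l #|P|) subnKC // -[X in _ == X](card_ord n.+1) -(cardC (mem P)).
exact: pow_shift.
Qed.

Lemma count_rare_rows :
  (#|rare_rows m|%:R * x ^+ (3 * m) <= (27 * r ^ 3)%:R * (3 ^+ (n.+1 - 3 * p0) * (2 + x) ^+ (3 * p0)))%R.
Proof.
pose K : finType := (('I_r * 'I_3) * ('I_r * 'I_3) * ('I_r * 'I_3))%type.
have cK : #|K| = 27 * r ^ 3 by rewrite !card_prod !card_ord; lia.
pose good (t : K) := [&& t.1.1.1 != t.1.2.1, t.1.2.1 != t.2.1 & t.2.1 != t.1.1.1].
pose A (t : K) := [set rho | good t && [&& rare_at m rho t.1.1.1 t.1.1.2, rare_at m rho t.1.2.1 t.1.2.2 & rare_at m rho t.2.1 t.2.2]].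
have le : #|rare_rows m| <= \sum_t #|A t|.
  apply: (@leq_trans (\sum_(rho in rare_rows m) \sum_t (rho \in A t))).
    rewrite -sum1_card; apply: leq_sum => rho; rewrite inE => /card_gt2P[j1 [j2 [j3 [[]]]]].
    rewrite !inE => /existsP[i1 H1] /existsP[i2 H2] /existsP[i3 H3] [j12 j23 j31].
    by rewrite (bigD1 ((j1, i1), (j2, i2), (j3, i3))) //= inE /good /= j12 j23 j31 H1 H2 H3.
  rewrite exchange_big /=; apply: leq_sum => t _; rewrite -sum1_card big_mkcond [X in _ <= X]big_mkcond.
  by apply: leq_sum => rho _; case: (rho \in rare_rows m); case: (rho \in A t).
apply: le_trans (_ : ((\sum_t #|A t|)%:R * x ^+ (3 * m) <= _)%R).
  by apply: ler_wpM2r; rewrite ?exprn_ge0 ?ler_nat // ltW.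
rewrite natr_sum mulr_suml -cK mulr_natl -sumr_const; apply: ler_sum => t _.
rewrite /A; have [/and3P[g1 g2 g3]|_] := boolP (good t); last first.
  rewrite (_ : [set _ | _] = set0) ?cards0 ?mul0r; last by apply/setP => c; rewrite !inE.
  by rewrite mulr_ge0 // exprn_ge0 //; have := x0; lra.
by have := count_three_rare t.1.1.2 t.1.2.2 t.2.2 g1 g2 g3.
Qed.

End RareRows.

(** Moving all vertices outside the [r] parts into one of them leaves at most [r] parts and destroys
    only edges that meet these vertices. *)
Lemma card_mgr_near : #|mgr pt| <= tur r n.+1 + #|~: \bigcup_j part j| * n.+1.
Proof.
have r0 : 0 < r by lia.
pose O := ~: \bigcup_j part j; pose W0 := W (Ordinal r0).
pose pt' x := if x \in O then W0 else pt x.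
have inW x : x \notin O -> exists j, pt x = W j.
  by rewrite in_setC negbK => /bigcupP[j _]; rewrite inE => /eqP; exists j.
have le1 : #|mgr pt'| <= tur r n.+1.
  apply: card_mgr_le => //; rewrite -[X in _ <= X](card_ord r) -(size_codom W).
  apply: uniq_leq_size; first exact: undup_uniq.
  move=> s; rewrite mem_undup => /codomP[x ->]; rewrite /pt'.
  by case: ifP => [_|/negbT/inW[j ->]]; apply: codom_f.
have le2 : #|mgr pt :\: mgr pt'| <= #|O| * n.+1.
  apply: (@leq_trans #|[set [set p.1; p.2] | p : 'I_n.+1 * 'I_n.+1 in setX O setT]|); last first.
    by apply: leq_trans (leq_imset_card _ _) _; rewrite cardsX cardsT card_ord.
  apply: subset_leq_card; apply/subsetP => e; rewrite inE => /andP[+ eE].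
  have /eqP/cards2P[x [y [xy ee]]] := is_graph2 (mgr_graph pt) eE; subst e.
  rewrite mgrE negbK /pt' => H; move: eE H; case: (boolP (x \in O)) => xO.
    by move=> _ _; apply/imsetP; exists (x, y); rewrite // in_setX /= xO in_setT.
  case: (boolP (y \in O)) => yO.
    by move=> _ _; apply/imsetP; exists (y, x); [rewrite in_setX /= yO in_setT|rewrite /= setUC].
  by rewrite mgrE => /negbTE->.
by rewrite -(cardsID (mgr pt')) leq_add // (leq_trans _ le1) // subset_leq_card // subsetIr.
Qed.

End Near.

(** * Numerical estimates near the Turán graph *)

Section NearNumerics.

Variable R : realType.
Local Open Scope ring_scope.
Implicit Types (n m p q : nat).

Lemma ln_monoX (x : R) n : 0 < x -> ln (x ^+ n) = n%:R * ln x.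
Proof. by move=> x0; rewrite lnXn // mulr_natl. Qed.

Lemma ln3_gt0 : 0 < ln (3 : R). Proof. by apply: ln_gt0; lra. Qed.

Lemma natr_unbounded (b : R) : exists n0, forall n, (n0 <= n)%N -> b <= n%:R.
Proof.
exists (Num.bound `|b|) => n le; apply: le_trans (ler_norm b) _; apply/ltW.
by apply: lt_le_trans (archi_boundP (normr_ge0 b)) _; rewrite ler_nat.
Qed.

Lemma quadratic_eventually (a b c : R) : 0 < a ->
  exists n0, forall n, (n0 <= n)%N -> b * n%:R + c <= a * n%:R * n%:R.
Proof.
move=> a0; have [n1 H1] := natr_unbounded ((`|b| + `|c|) / a).
exists (maxn 1 n1) => n; rewrite geq_max => /andP[n0 /H1].
rewrite ler_pdivrMr // mulrC => H.
have n1' : 1 <= n%:R :> R by rewrite ler1n.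
have Hb := ler_norm b; have Hc := ler_norm c; have c0 := normr_ge0 c.
have : b * n%:R + c <= (`|b| + `|c|) * n%:R by nra.
by move=> /le_trans; apply; rewrite ler_wpM2r //; lra.
Qed.

(** [(201/100)^3] is about [8.12], safely below 9. *)
Definition rare_weight : R := 100^-1.

(** Logarithm of [9 / (2 + x)^3]; [row_gain * n / r] is the saving at a vertex that lacks a colour
    on three parts of size [n / r]. *)
Definition row_gain : R := 2 * ln 3 - 3 * ln (2 + rare_weight).

Local Notation x := rare_weight.
Local Notation k2 := row_gain.

(* [(2 + 1/100)^3 < 3^2] *)
Lemma three_rare_gain : 0 < k2.
Proof.
rewrite /row_gain -[2]/(2%:R) -[3 * _]/(3%:R * _) -!ln_monoX /rare_weight; try lra.
by rewrite subr_gt0 ltr_ln ?posrE /rare_weight; lra.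
Qed.

(** Of the saving [row_gain * n / r], a quarter pays for the weights [x ^+ (3 * m)], a quarter for
    the deficit [eta] in the part sizes, and half for the constants, among them the factor 2 in the
    conclusion. *)
Lemma rare_numeric r D (eta : R) : (1 < r)%N -> (0 < D)%N -> 0 < eta ->
  12 * r%:R * ln 100 <= k2 * D%:R -> 12 * r%:R * (ln 3 - ln (2 + x)) * eta <= k2 ->
  exists n0, forall n m p Rr, (n0 <= n)%N -> m%:R * D%:R <= n%:R :> R ->
    (r%:R^-1 - eta) * n%:R <= p%:R + 1 -> (3 * p <= n.+1)%N ->
    Rr%:R * x ^+ (3 * m) <= (27 * r ^ 3)%:R * (3 ^+ (n.+1 - 3 * p) * (2 + x) ^+ (3 * p)) ->
    (2 * Rr <= 3 ^ (n - n %/ r).-1)%N.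
Proof.
move=> r1 D0 eta0 HD Heta.
have r0 : 0 < r%:R :> R by rewrite ltr0n; lia.
have D0' : 0 < D%:R :> R by rewrite ltr0n.
pose kp : R := ln 3 - ln (2 + x).
have kp0 : 0 <= kp by rewrite /kp subr_ge0 ler_ln ?posrE /rare_weight; lra.
pose C0 := ln 2 + ln ((27 * r ^ 3)%:R) + 2 * ln 3 + 3 * kp : R.
have [n1 H1] := natr_unbounded (2 * r%:R * C0 / k2).
exists (maxn 1 n1) => n m p Rr; rewrite geq_max => /andP[n0 /H1 Hn] mD pn p3 HR.
have [->|Rr0] := posnP Rr; first by rewrite muln0.
have K0 : 0 < (27 * r ^ 3)%:R :> R by rewrite ltr0n muln_gt0 expn_gt0; lia.
have x0 : 0 < x by rewrite /rare_weight; lra.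
have x2 : 0 < 2 + x by lra.
have Rr0' : 0 < Rr%:R :> R by rewrite ltr0n.
have {}HR : ln Rr%:R - 3 * m%:R * ln 100 <= ln ((27 * r ^ 3)%:R) + (n%:R + 1 - 3 * p%:R) * ln 3 + 3 * p%:R * ln (2 + x) :> R.
  have := HR; rewrite -ler_ln ?posrE; last 2 first.
  - by rewrite mulr_gt0 // exprn_gt0.
  - by rewrite !mulr_gt0 // exprn_gt0.
  rewrite !lnM ?posrE ?mulr_gt0 ?exprn_gt0 // !ln_monoX // /rare_weight lnV ?posrE // natrM natrB // natrM -natr1.
  by move=> ?; lra.
have er : n%:R - n%:R / r%:R - 1 <= ((n - n %/ r).-1)%:R :> R.
  have : (n %/ r * r <= n)%N by rewrite leq_divM.
  rewrite -(ler_nat R) natrM -ler_pdivlMr // => Hq.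
  have lt : (n %/ r < n)%N by rewrite ltn_Pdiv.
  have -> : ((n - n %/ r).-1)%:R = n%:R - (n %/ r)%:R - 1 :> R.
    by rewrite -subn1 !natrB ?subn_gt0 // ltnW.
  by lra.
rewrite -(ler_nat R) natrM natrX -ler_ln ?posrE ?exprn_gt0 // ?mulr_gt0 //.
rewrite lnM ?posrE // ln_monoX //.
apply: le_trans (_ : (n%:R - n%:R / r%:R - 1) * ln 3 <= _); last by rewrite ler_wpM2r // ltW // ln3_gt0.
have mm : 3 * m%:R * ln 100 <= k2 * n%:R / (4 * r%:R) :> R.
  have l100 : 0 <= ln 100 :> R by rewrite ln_ge0; lra.
  have : 12 * r%:R * ln 100 * m%:R <= k2 * n%:R.
    apply: le_trans (_ : k2 * D%:R * m%:R <= _); first by rewrite ler_wpM2r.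
    by rewrite -mulrA [D%:R * _]mulrC ler_wpM2l // ltW // three_rare_gain.
  by rewrite ler_pdivlMr ?mulr_gt0 //; lra.
have ee : 3 * kp * eta * n%:R <= k2 * n%:R / (4 * r%:R).
  rewrite ler_pdivlMr ?mulr_gt0 //.
  have : 12 * r%:R * kp * eta * n%:R <= k2 * n%:R by rewrite ler_wpM2r.
  by lra.
have cc : C0 <= k2 * n%:R / (2 * r%:R).
  rewrite ler_pdivlMr ?mulr_gt0 //; move: Hn; rewrite ler_pdivrMr ?three_rare_gain //; lra.
have pp : 3 * kp * ((r%:R^-1 - eta) * n%:R) <= 3 * kp * (p%:R + 1) by rewrite ler_wpM2l // mulr_ge0.
have i4 : k2 * n%:R / (4 * r%:R) = k2 * (n%:R / r%:R) / 4 by rewrite invfM; ring.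
have i2 : k2 * n%:R / (2 * r%:R) = k2 * (n%:R / r%:R) / 2 by rewrite invfM; ring.
have i1 : 3 * kp * ((r%:R^-1 - eta) * n%:R) = (k2 + ln 3) * (n%:R / r%:R) - 3 * kp * eta * n%:R by rewrite /row_gain /kp; ring.
rewrite i4 in mm ee; rewrite i2 in cc; rewrite i1 in pp.
move: mm ee cc pp HR; rewrite /C0; set y := n%:R / r%:R.
have : (n%:R + 1 - 3 * p%:R) * ln 3 + 3 * p%:R * ln (2 + x) = (n%:R + 1) * ln 3 - 3 * kp * p%:R by rewrite /kp; ring.
by lra.
Qed.

(** [C ln 3 - ln (3^C - 1)] is the saving per block, and there are about [(n / (r D))^2] blocks.
    Half of the total pays for the edges at vertices outside the parts, the other half beats the
    terms linear in [n]. *)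
Lemma nonuniversal_numeric r D C (eta : R) : (1 < r)%N -> (0 < D)%N -> (0 < C)%N -> 0 < eta ->
  8 * r%:R * eta * ln 3 * (r%:R * D%:R) ^+ 2 <= C%:R * ln 3 - ln ((3 ^ C - 1)%:R) ->
  exists n0, forall n q t (O NU E : nat), (n0 <= n)%N -> n%:R / (r%:R * D%:R) <= q%:R + 1 :> R ->
    O%:R <= r%:R * eta * (n%:R + 1) -> (E <= t + O * n.+1)%N ->
    (NU * (3 ^ C) ^ (q * q) <= (2 ^ n.+1) ^ r * 3 ^ (2 ^ r) * (3 ^ E * (3 ^ C - 1) ^ (q * q)))%N ->
    (2 * NU <= 3 ^ t)%N.
Proof.
move=> r1 D0 C0 eta0 Heta.
have r0 : 0 < r%:R :> R by rewrite ltr0n; lia.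
have D0' : 0 < D%:R :> R by rewrite ltr0n.
have l3 := ln3_gt0.
set k3 := C%:R * ln 3 - _ in Heta.
have C3 : (0 < 3 ^ C - 1)%N by rewrite subn_gt0 -[X in (X < _)%N](expn0 3) ltn_exp2l.
pose s := r%:R * D%:R : R.
have s0 : 0 < s by rewrite mulr_gt0.
have k30 : 0 < k3.
  by apply: lt_le_trans Heta; rewrite !mulr_gt0 // exprn_gt0 // mulr_gt0.
have [n1 H1] := @quadratic_eventually (k3 / s ^+ 2 / 2) (r%:R * ln 2 + 2 * k3 / s) (r%:R * ln 2 + (2 ^ r)%:R * ln 3 + ln 2) (ltac:(by rewrite !divr_gt0 // exprn_gt0)).
exists (maxn 1 n1) => n q t O NU E; rewrite geq_max => /andP[n0 /H1 Hn] qn On Et HN.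
have [->|NU0] := posnP NU; first by rewrite muln0.
have NU0' : 0 < NU%:R :> R by rewrite ltr0n.
have n1' : 1 <= n%:R :> R by rewrite ler1n.
have {}HN : ln NU%:R + (q%:R * q%:R) * (C%:R * ln 3) <= (n%:R + 1) * r%:R * ln 2 + (2 ^ r)%:R * ln 3 + (E%:R * ln 3 + (q%:R * q%:R) * ln ((3 ^ C - 1)%:R)) :> R.
  have := HN; rewrite -(ler_nat R) !natrM.
  rewrite ![((_ ^ (q * q))%N)%:R]natrX ![((3 ^ _)%N)%:R]natrX ![((2 ^ n.+1) ^ r)%N%:R]natrX ![((2 ^ n.+1)%N)%:R]natrX.
  set c := ((3 ^ C - 1)%N)%:R; have c0 : 0 < c :> R by rewrite /c ltr0n.
  have P1 : NU%:R * 3 ^+ C ^+ (q * q) \in (@Num.pos R) by rewrite posrE mulr_gt0 // !exprn_gt0.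
  have P2 : 2 ^+ n.+1 ^+ r * 3 ^+ (2 ^ r) * (3 ^+ E * c ^+ (q * q)) \in (@Num.pos R) by rewrite posrE !mulr_gt0 // !exprn_gt0.
  rewrite -(ler_ln P1 P2).
  rewrite !lnM ?posrE ?mulr_gt0 ?exprn_gt0 // !ln_monoX ?exprn_gt0 // !natrM -natr1 => ?.
  by lra.
rewrite -(ler_nat R) natrM natrX -ler_ln ?posrE ?exprn_gt0 // ?mulr_gt0 //.
rewrite lnM ?posrE // ln_monoX //.
have Et' : E%:R * ln 3 <= t%:R * ln 3 + 4 * r%:R * eta * n%:R * n%:R * ln 3.
  rewrite -mulrDl ler_pM2r //; apply: le_trans (_ : (t + O * n.+1)%:R <= _); first by rewrite ler_nat.
  rewrite natrD natrM -natr1 lerD2l.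
  have re0 : 0 < r%:R * eta by rewrite mulr_gt0.
  have : O%:R * (n%:R + 1) <= r%:R * eta * (n%:R + 1) * (n%:R + 1) by rewrite ler_wpM2r //; lra.
  move/le_trans; apply; rewrite -!mulrA [4 * _]mulrC -!mulrA !ler_pM2l //; nra.
have qq : k3 * (n%:R / s * (n%:R / s) - 2 * (n%:R / s)) <= q%:R * q%:R * k3.
  rewrite [X in _ <= X]mulrC ler_pM2l //.
  have y0 : 0 <= n%:R / s by rewrite divr_ge0 // ltW.
  have q0 : 0 <= q%:R :> R by [].
  rewrite -/s in qn; move: qn q0 y0; set y := n%:R / s; set z := q%:R => ? ? ?.
  have [?|?] := lerP 1 y; nra.
have eta' : 4 * r%:R * eta * n%:R * n%:R * ln 3 <= k3 / s ^+ 2 / 2 * n%:R * n%:R.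
  have : 4 * r%:R * eta * ln 3 <= k3 / s ^+ 2 / 2.
    by rewrite ler_pdivlMr // ler_pdivlMr ?exprn_gt0 //; move: Heta; rewrite -/s; lra.
  move=> H; have : (4 * r%:R * eta * ln 3) * (n%:R * n%:R) <= k3 / s ^+ 2 / 2 * (n%:R * n%:R) by rewrite ler_wpM2r // mulr_ge0.
  by lra.
have i1 : k3 * (n%:R / s * (n%:R / s) - 2 * (n%:R / s)) = k3 / s ^+ 2 * n%:R * n%:R - 2 * k3 / s * n%:R.
  by field; lra.
have i3 : q%:R * q%:R * k3 = q%:R * q%:R * (C%:R * ln 3) - q%:R * q%:R * ln (3 ^ C - 1)%:R :> R by rewrite -mulrBr.
rewrite i1 i3 in qq; clearbody k3.
by move: Hn HN Et' eta' qq; lra.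
Qed.

End NearNumerics.

Local Lemma six_mul (m r D : nat) : 6 * r <= D -> 3 * m * (2 * r) <= m * D.
Proof. by move=> h; have := leq_mul (leqnn m) h; lia. Qed.

Local Lemma half_le (x y t : nat) : 2 * y <= t -> t <= x + y -> x + y <= 2 * x.
Proof. lia. Qed.

(** By the assumed lower bound [3 ^ tur r n.+1], at most half of the colourings are not universal;
    the universal ones are counted through their rows at a vertex outside the [r] given parts. *)
Lemma near_progress (R : realType) r (pat : {set 'I_r.+1} -> nat) a :
  1 < r -> num_classes pat = 2 -> a \in pclasses pat ->
  exists eta : R, (0 < eta)%R /\ exists n0, forall n (pt : 'I_n.+1 -> nat) (W : 'I_r -> nat),
    n0 <= n -> injective W ->
    (forall j, (r%:R^-1 - eta) * (n%:R + 1) <= #|[set y | pt y == W j]|%:R)%R ->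
    r < size (parts pt) -> 3 ^ tur r n.+1 <= c3 pat (mgr pt) ->
    exists u, c3 pat (mgr pt) <= c3 pat (mgr (pt \o lift u)) * 3 ^ (n - n %/ r).-1.
Proof.
move=> r1 n2 aP; have r0 : 0 < r by lia.
have r0R : (0 < r%:R :> R)%R by rewrite ltr0n.
have k20 := three_rare_gain R; have l3 := ln3_gt0 R.
have [D0 HD0] := natr_unbounded (12 * r%:R * ln 100 / row_gain R)%R.
pose D := maxn D0 (6 * r).
have D1 : 0 < D by rewrite /D leq_max; lia.
(* Gives [3 * m <= n / (2 r)] below, while [eta <= e1] keeps every part at least that large. *)
have D6 : 6 * r <= D by rewrite leq_maxr.
have HD : (12 * r%:R * ln 100 <= row_gain R * D%:R)%R.
  by rewrite [X in (_ <= X)%R]mulrC -ler_pdivrMr //; apply: HD0; rewrite leq_maxl.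
pose C := #|edgesK r|.
have C0 : 0 < C.
  by apply/card_gt0P; exists [set Ordinal r0; Ordinal r1]; rewrite edgesK2.
have D1R : (0 < D%:R :> R)%R by rewrite ltr0n.
pose kp : R := (ln 3 - ln (2 + rare_weight R))%R.
have kp0 : (0 < kp)%R by rewrite /kp subr_gt0 ltr_ln ?posrE /rare_weight; lra.
pose k3 : R := (C%:R * ln 3 - ln ((3 ^ C - 1)%N)%:R)%R.
have k30 : (0 < k3)%R.
  have e1 : 1 < 3 ^ C by rewrite -[X in (X < _)%N](expn0 3) ltn_exp2l.
  by rewrite /k3 subr_gt0 -ln_monoX // ltr_ln ?posrE ?exprn_gt0 // ?ltr0n ?subn_gt0 // -natrX ltr_nat; lia.
pose s : R := ((r%:R * D%:R) ^+ 2)%R.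
have s0 : (0 < s)%R by rewrite exprn_gt0 // mulr_gt0.
pose e1 : R := ((2 * r%:R)^-1)%R; pose e2 : R := (row_gain R / (12 * r%:R * kp))%R.
pose e3 : R := (k3 / (8 * r%:R * ln 3 * s))%R.
pose eta : R := Num.min e1 (Num.min e2 e3).
have eta0 : (0 < eta)%R.
  by rewrite /eta !lt_min /e1 /e2 /e3 invr_gt0 !divr_gt0 ?mulr_gt0.
have h1 : (eta <= e1)%R by rewrite /eta ge_min lexx.
have h2 : (eta <= e2)%R by rewrite /eta !ge_min lexx orbT.
have h3 : (eta <= e3)%R by rewrite /eta !ge_min lexx !orbT.
have H2 : (12 * r%:R * kp * eta <= row_gain R)%R.
  by move: h2; rewrite /e2 ler_pdivlMr ?mulr_gt0 // mulrC.
have H3 : (8 * r%:R * eta * ln 3 * s <= k3)%R.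
  move: h3; rewrite /e3 ler_pdivlMr ?mulr_gt0 //; congr (_ <= _)%R; ring.
have [nA HA] := rare_numeric r1 D1 eta0 HD H2.
have [nB HB] := nonuniversal_numeric r1 D1 C0 eta0 H3.
exists eta; split=> //; exists (maxn 1 (maxn nA nB)) => n pt W.
rewrite !geq_max => /and3P[n1 nnA nnB] Winj Wp ps c3n.
pose part j := [set y | pt y == W j].
(* [m] is at most [n / D], a small fraction of a part, yet [q * q] is quadratic in [n]. *)
pose q := n %/ (r * D); pose m := r * q.
have n0R : (0 <= n%:R :> R)%R by [].
have mD : m * D <= n by rewrite /m mulnAC mulnC leq_divM.
have [u uW] : exists u, forall j, pt u != W j.
  suff /existsP[u /forallP H] : [exists u, [forall j, pt u != W j]] by exists u.
  rewrite -[X in is_true X]negbK negb_exists; apply/negP => /forallP H.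
  have : size (parts pt) <= size (codom W).
    apply: uniq_leq_size => [|v]; first exact: undup_uniq.
    rewrite mem_undup => /codomP[x ->]; have := H x; rewrite negb_forall => /existsP[j].
    by rewrite negbK => /eqP->; apply: codom_f.
  by rewrite size_codom card_ord leqNgt ps.
exists u; have e1r : ((2 * r%:R)^-1 * 2 = r%:R^-1 :> R)%R by rewrite invfM mulrAC mulVf ?mul1r // pnatr_eq0.
have mW j : 3 * m <= #|part j|.
  rewrite -(ler_nat R); apply: le_trans (Wp j).
  have h : ((2 * r%:R)^-1 <= r%:R^-1 - eta)%R by move: h1; rewrite /e1; lra.
  apply: le_trans (_ : ((2 * r%:R)^-1 * n%:R <= _)%R); last first.
    apply: le_trans (_ : ((r%:R^-1 - eta) * n%:R <= _)%R); first by rewrite ler_wpM2r.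
    rewrite ler_wpM2l //; last by lra.
    by apply: le_trans h; rewrite invr_ge0 mulr_ge0 // ltW.
  rewrite mulrC ler_pdivlMr ?mulr_gt0 // -natrM -natrM ler_nat.
  by apply: leq_trans mD; apply: six_mul.
pose p := Num.truncn ((r%:R^-1 - eta) * (n%:R + 1))%R.
have he : (0 <= r%:R^-1 - eta)%R.
  have : (0 <= (2 * r%:R)^-1 :> R)%R by rewrite invr_ge0 mulr_ge0 // ltW.
  by move: h1; rewrite /e1; lra.
have pge0 : (0 <= (r%:R^-1 - eta) * (n%:R + 1) :> R)%R by rewrite mulr_ge0 // addr_ge0.
have [pl pu] := andP (Num.Theory.truncn_itv pge0).
have pP j : p <= #|part j| by rewrite -(ler_nat R); apply: le_trans (Wp j).
have pn : ((r%:R^-1 - eta) * n%:R <= p%:R + 1)%R.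
  rewrite -natr1 in pu; apply: le_trans (ltW pu); rewrite ler_wpM2l //; lra.
have x01 : (0 < rare_weight R <= 1)%R by rewrite /rare_weight; apply/andP; split; lra.
have rows : 2 * #|rare_rows pt W m| <= 3 ^ (n - n %/ r).-1.
  have [->|ne] := eqVneq (rare_rows pt W m) set0; first by rewrite cards0.
  apply: (HA _ m p) => //; first by rewrite -natrM ler_nat.
    have /set0Pn[rho] := ne; rewrite inE => /card_gt2P[j1 [j2 [j3 [_ [j12 j23 j31]]]]].
    exact: (three_parts r1 Winj x01 pP j12 j23 j31).
  exact: (count_rare_rows r1 Winj).
have Out : (#|~: \bigcup_j part j|%:R <= r%:R * eta * (n%:R + 1) :> R)%R.
  have := cardsC (\bigcup_j part j); rewrite card_ord => /(congr1 (fun m => m%:R : R)%R).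
  rewrite natrD -natr1 => HS.
  suff : (r%:R * ((r%:R^-1 - eta) * (n%:R + 1)) <= #|\bigcup_j part j|%:R)%R.
    by rewrite mulrA mulrBr mulfV ?pnatr_eq0 -?lt0n //; lra.
  have -> : #|\bigcup_j part j| = \sum_j #|part j|.
    rewrite -sum1_card partition_disjoint_bigcup /= => [|i j ij].
      by apply: eq_bigr => j _; rewrite sum1_card.
    rewrite -setI_eq0; apply/set0Pn => -[y]; rewrite !inE => /andP[/eqP-> /eqP/Winj ji].
    by rewrite ji eqxx in ij.
  rewrite natr_sum mulr_natl -[X in (_ *+ X)%R](card_ord r) -sumr_const.
  by apply: ler_sum => j _; apply: Wp.
have NU : 2 * #|[set c in cols pat (mgr pt) | ~~ universal pt W m c]| <= 3 ^ tur r n.+1.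
  apply: (HB n q _ _ _ _ nnB _ Out) (card_mgr_near r1 pt W) (count_nonuniversal pat r1 pt Winj q).
  rewrite ler_pdivrMr ?mulr_gt0 // -natrM natr1 -natrM ler_nat.
  by apply: ltnW; rewrite ltn_ceil // muln_gt0 r0.
pose A := [set c in cols pat (mgr pt) | universal pt W m c].
have cA : #|A| <= c3 pat (mgr (pt \o lift u)) * #|rare_rows pt W m|.
  apply: delete_count; first by apply/subsetP => c; rewrite in_set => /andP[].
  by move=> c; rewrite in_set => /andP[cE cu]; rewrite inE; apply: (universal_rare r1 Winj n2 aP uW mW).
have tot : c3 pat (mgr pt) = #|A| + #|[set c in cols pat (mgr pt) | ~~ universal pt W m c]|.
  rewrite -[c3 _ _]/(#|cols pat (mgr pt)|) -(cardsID [set c | universal pt W m c]); congr (_ + _).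
    by apply: eq_card => c; rewrite in_setI !(in_set (fun c => universal _ _ _ c)) [in RHS]in_set.
  by apply: eq_card => c; rewrite in_setD !(in_set (fun c => universal _ _ _ c)) [in RHS]in_set andbC.
have le : c3 pat (mgr pt) <= 2 * #|A| by rewrite tot in c3n *; apply: half_le NU c3n.
apply: leq_trans le _; apply: leq_trans (leq_mul (leqnn 2) cA) _.
by rewrite mulnCA leq_mul2l rows orbT.
Qed.

(** * Weak regularity *)

Section Average.

Variables (R : realFieldType) (V : finType) (p : V -> nat).
Local Open Scope ring_scope.

(** Conditional expectation of [u] with respect to the partition into fibres of [p]. *)
Definition avg (u : V -> R) x : R := (\sum_(x' | p x' == p x) u x') / #|[pred x' | p x' == p x]|%:R.

Lemma card_block_gt0 x : 0 < #|[pred x' | p x' == p x]|%:R :> R.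
Proof. by rewrite ltr0n; apply/card_gt0P; exists x; rewrite inE. Qed.

Lemma avg_block u x x' : p x = p x' -> avg u x = avg u x'.
Proof. by rewrite /avg => ->. Qed.

Lemma avg_ge0 u x : (forall x, 0 <= u x) -> 0 <= avg u x.
Proof. by move=> u0; rewrite divr_ge0 // sumr_ge0. Qed.

Lemma avg_le1 u x : (forall x, u x <= 1) -> avg u x <= 1.
Proof.
move=> u1; rewrite ler_pdivrMr ?card_block_gt0 // mul1r -sumr_const; apply: ler_sum => x' _; exact: u1.
Qed.

Lemma avg_sum (I : finType) (u : I -> V -> R) x : \sum_i avg (u i) x = avg (fun y => \sum_i u i y) x.
Proof. by rewrite /avg -mulr_suml exchange_big. Qed.

Lemma eq_avg u v x : u =1 v -> avg u x = avg v x.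
Proof. by move=> uv; rewrite /avg; congr (_ / _); apply: eq_bigr. Qed.

(** Averaging is the orthogonal projection onto the block-constant functions. *)
Lemma avg_proj u v : (forall x x', p x = p x' -> v x = v x') ->
  \sum_x avg u x * v x = \sum_x u x * v x.
Proof.
move=> vp; rewrite /avg.
under eq_bigr => x _.
  rewrite mulrAC mulr_suml mulr_suml.
  rewrite (eq_bigr (fun x' => u x' * v x' / #|[pred y | p y == p x']|%:R)); last by move=> x' /eqP xx; rewrite xx (vp x' x xx).
  over.
rewrite (exchange_big_dep predT) //=; apply: eq_bigr => x' _.
rewrite (eq_bigl (fun x => p x == p x')); last by move=> x; rewrite eq_sym.
rewrite sumr_const -[X in X = _]mulr_natr mulfVK //; exact: lt0r_neq0 (card_block_gt0 x').
Qed.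

Lemma avgC (u : V -> V -> R) x y : avg (fun x' => avg (u x') y) x = avg (fun y' => avg (u^~ y') x) y.
Proof.
rewrite /avg -mulr_suml exchange_big -mulr_suml /= -!mulrA; congr (_ * _); exact: mulrC.
Qed.

End Average.

Section Regularity.

Variables (R : realFieldType) (V : finType) (k : nat) (col : V -> V -> option 'I_3).
Hypotheses (colC : forall x y, col x y = col y x) (V0 : 0 < #|V|).
Local Open Scope ring_scope.
Implicit Types (p : V -> nat) (f : {ffun 'I_k -> V}).

Let N : R := #|V|%:R.
Let N0 : 0 < N. Proof. by rewrite ltr0n. Qed.

Definition gcol (i : 'I_3) x y : R := (col x y == Some i)%:R.

(** Density of colour [i] between the blocks of [x] and [y]. *)
Definition wcol p i x y : R := avg p (fun x' => avg p (gcol i x') y) x.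

Definition block_const p (h : V -> V -> R) :=
  forall x x' y y', p x = p x' -> p y = p y' -> h x y = h x' y'.

Lemma gcol_ge0 i x y : 0 <= gcol i x y. Proof. exact: ler0n. Qed.
Lemma gcol_le1 i x y : gcol i x y <= 1. Proof. by rewrite /gcol; case: (_ == _). Qed.

Lemma gcol_sum x y : \sum_i gcol i x y <= 1.
Proof.
case E : (col x y) => [i|]; last by rewrite big1 // => i _; rewrite /gcol E.
rewrite (bigD1 i) //= big1 ?addr0 ?gcol_le1 // => j ji; rewrite /gcol E.
by case: eqP => // -[ij]; rewrite ij eqxx in ji.
Qed.

Lemma wcol_ge0 p i x y : 0 <= wcol p i x y.
Proof. by apply: avg_ge0 => x'; apply: avg_ge0 => y'; apply: gcol_ge0. Qed.

Lemma wcol_le1 p i x y : wcol p i x y <= 1.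
Proof. by apply: avg_le1 => x'; apply: avg_le1 => y'; apply: gcol_le1. Qed.

Lemma wcolC p i x y : wcol p i x y = wcol p i y x.
Proof. by rewrite /wcol avgC; do 2 apply: eq_avg => ?; rewrite /gcol colC. Qed.

Lemma wcol_const p i : block_const p (wcol p i).
Proof.
move=> x x' y y' xx yy; rewrite /wcol (avg_block _ xx); apply: eq_avg => z; exact: avg_block.
Qed.

Lemma wcol_proj p i h : block_const p h ->
  \sum_x \sum_y wcol p i x y * h x y = \sum_x \sum_y gcol i x y * h x y.
Proof.
move=> hp; rewrite exchange_big /=.
rewrite (eq_bigr (fun y => \sum_x avg p (gcol i x) y * h x y)); last first.
  by move=> y _; apply: avg_proj => x x' xx; apply: hp.
rewrite exchange_big; apply: eq_bigr => x _; apply: avg_proj => y y' yy; exact: hp.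
Qed.

Definition energy p : R := \sum_i \sum_x \sum_y wcol p i x y ^+ 2.

Lemma energy_ge0 p : 0 <= energy p.
Proof. by do 3 (apply: sumr_ge0 => ? _); apply: sqr_ge0. Qed.

Lemma energy_le p : energy p <= N ^+ 2.
Proof.
have -> : N ^+ 2 = \sum_(x : V) \sum_(y : V) 1.
  by rewrite !sumr_const cardT -cardE expr2 mulr_natr.
rewrite /energy exchange_big /=; apply: ler_sum => x _; rewrite exchange_big /=.
apply: ler_sum => y _; apply: le_trans (_ : \sum_i wcol p i x y <= _).
  apply: ler_sum => i _; rewrite expr2 -[X in _ <= X]mulr1; apply: ler_wpM2l; [exact: wcol_ge0|exact: wcol_le1].
rewrite /wcol avg_sum; apply: avg_le1 => x'; rewrite avg_sum; apply: avg_le1 => y'; exact: gcol_sum.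
Qed.

(** Pythagoras: both densities are projections of [gcol], and functions constant on the blocks of
    [p] are constant on those of the finer [p']. *)
Lemma energy_refine p p' : (forall x y, p' x = p' y -> p x = p y) ->
  \sum_i \sum_x \sum_y (wcol p i x y - wcol p' i x y) ^+ 2 = energy p' - energy p.
Proof.
move=> ref; rewrite /energy -sumrB; apply: eq_bigr => i _.
have c1 : block_const p' (wcol p i) by move=> *; apply: wcol_const; apply: ref.
have H1 := wcol_proj i c1; rewrite -(wcol_proj i (@wcol_const p i)) in H1.
have H (A B : V -> V -> R) : \sum_x \sum_y (A x y - B x y) ^+ 2 = \sum_x \sum_y A x y * A x y
    - 2 * (\sum_x \sum_y B x y * A x y) + \sum_x \sum_y B x y ^+ 2.
  rewrite mulr_sumr -sumrB -big_split; apply: eq_bigr => x _ /=.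
  by rewrite mulr_sumr -sumrB -big_split; apply: eq_bigr => y _ /=; ring.
have E : \sum_x \sum_y wcol p i x y ^+ 2 = \sum_x \sum_y wcol p i x y * wcol p i x y.
  by apply: eq_bigr => x _; apply: eq_bigr => y _; rewrite expr2.
by rewrite H H1 E; ring.
Qed.

Let Q := #|{ffun 'I_k -> option 'I_3}|.

(** Splits the blocks by the colours towards the [k] vertices [f j]. The numerical code keeps an
    explicit bound on the number of blocks. *)
Definition refine p f x : nat :=
  (p x * Q + enum_rank [ffun j => col x (f j)])%N.

Lemma refine_inj p f x y : refine p f x = refine p f y -> p x = p y /\ forall j, col x (f j) = col y (f j).
Proof.
rewrite /refine => H; have lt z : (enum_rank [ffun j => col z (f j)] < Q)%N by apply: ltn_ord.
have Q0 : (0 < Q)%N by apply: leq_ltn_trans (lt x).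
have := congr1 (divn^~ Q) H; rewrite !divnMDl // !divn_small // !addn0 => pxy; split=> // j.
move: H; rewrite pxy => /addnI /val_inj /enum_rank_inj /ffunP /(_ j); by rewrite !ffunE.
Qed.

Lemma refine_lt p f x m : (p x < m)%N -> (refine p f x < m * Q)%N.
Proof.
move=> pm; apply: (@leq_trans ((p x).+1 * Q)); last by rewrite leq_mul2r pm orbT.
by rewrite /refine mulSn [X in (_ < X)%N]addnC ltn_add2l; apply: ltn_ord.
Qed.

(** Weaker than regularity: only refinements by the colours towards [k] vertices are tested, which
    is all that counting maps of [K_k] uses. *)
Definition stable (tau : R) p := [forall f : {ffun 'I_k -> V}, energy (refine p f) - energy p <= (tau * N) ^+ 2].

(** Energy increment: an unstable partition gains more than [(tau N)^2], whereas the energy never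
    exceeds [N^2]; so fewer than [K] refinements occur. *)
Lemma stable_partition (tau : R) K : 0 < tau -> 1 < K%:R * tau ^+ 2 ->
  exists p, (forall x, p x < Q ^ K)%N /\ stable tau p.
Proof.
move=> tau0 HK.
suff main j : (exists p, (forall x, p x < Q ^ j)%N /\ stable tau p) \/
    exists p, (forall x, p x < Q ^ j)%N /\ j%:R * (tau * N) ^+ 2 <= energy p.
  have [//|[p [_ H]]] := main K; have := le_trans H (energy_le p).
  rewrite exprMn mulrA ger_pMl ?exprn_gt0 // => H'; by have := lt_le_trans HK H'; rewrite ltxx.
have Q0 : (0 < Q)%N by apply/card_gt0P; exists [ffun=> None].
elim: j => [|j [[p [pQ st]]|[p [pQ ep]]]].
- by right; exists (fun=> 0%N); rewrite mul0r energy_ge0.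
- by left; exists p; split=> // x; apply: leq_trans (pQ x) _; rewrite expnS leq_pmull.
have [st|] := boolP (stable tau p).
  by left; exists p; split=> // x; apply: leq_trans (pQ x) _; rewrite expnS leq_pmull.
rewrite negb_forall => /existsP[f]; rewrite -ltNge => gain; right; exists (refine p f); split.
  by move=> x; rewrite expnSr refine_lt.
by rewrite -natr1 mulrDl mul1r; lra.
Qed.

Section Hybrid.

Variables (tau : R) (p : V -> nat) (chi : {set 'I_k} -> 'I_3).
Hypotheses (tau0 : 0 < tau) (st : stable tau p).

Implicit Types (e : 'I_k * 'I_k) (s : seq ('I_k * 'I_k)).

Let factor (U : 'I_3 -> V -> V -> R) f e := U (chi [set e.1; e.2]) (f e.1) (f e.2).

Let prodf s1 s2 f := (\prod_(e <- s1) factor (wcol p) f e) * (\prod_(e <- s2) factor gcol f e).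

Let H s1 s2 := \sum_f prodf s1 s2 f.

Section Step.

Variables (a b : 'I_k) (s1 s2 : seq ('I_k * 'I_k)).
Hypotheses (ab : a != b) (absent : forall e, e \in s1 ++ s2 -> [/\ e.1 != e.2, e != (a, b) & e != (b, a)]).

Let upd f x y : {ffun 'I_k -> V} := [ffun j => if j == a then x else if j == b then y else f j].

(** Resampling the values at [a] and [b] lets the ends of this edge vary while the other vertices
    stay fixed; each map arises [N ^+ 2] times. *)
Let upd_sum (F : {ffun 'I_k -> V} -> R) : \sum_f \sum_x \sum_y F (upd f x y) = N ^+ 2 * \sum_f F f.
Proof.
(* [T] exchanges the values of [f] at [a] and [b] with [x] and [y]. *)
pose T (t : {ffun 'I_k -> V} * (V * V)) := (upd t.1 t.2.1 t.2.2, (t.1 a, t.1 b)).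
have TK : involutive T.
  case=> f [x y]; rewrite /T /= !ffunE !eqxx eq_sym (negbTE ab) /=; congr (_, _).
  by apply/ffunP => j; rewrite !ffunE; case: eqP => [->//|_]; case: eqP => [->|].
have -> : \sum_f \sum_x \sum_y F (upd f x y) = \sum_t F (T t).1.
  rewrite (eq_bigr (fun f => \sum_(z : V * V) F (upd f z.1 z.2))); last by move=> f _; rewrite pair_big.
  by rewrite pair_big.
rewrite (reindex_inj (inv_inj TK)) /= (eq_bigr (fun t => F t.1)); last by move=> t _; exact: (congr1 (fun z => F z.1) (TK t)).
rewrite -(pair_big predT predT (fun f (z : V * V) => F f)) /= mulr_sumr; apply: eq_bigr => f _.
by rewrite sumr_const card_prod -natrX mulr_natl mulnn.
Qed.

(** No other edge joins [a] and [b], so each factor sees at most one of [x] and [y]: a factor of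
    [gcol] through a colour towards some [f j], a factor of [wcol] through a block. *)
Let prodf_const f : block_const (refine p f) (fun x y => prodf s1 s2 (upd f x y)).
Proof.
have key (U : 'I_3 -> V -> V -> R) : (forall i x y, U i x y = U i y x) ->
    (forall i x x' j, refine p f x = refine p f x' -> U i x (f j) = U i x' (f j)) ->
    forall x x' y y' e, refine p f x = refine p f x' -> refine p f y = refine p f y' ->
    e \in s1 ++ s2 -> factor U (upd f x y) e = factor U (upd f x' y') e.
  move=> UC Uf x x' y y' e xx yy es; have [e12 nab nba] := absent es.
  case: e {es} e12 nab nba => c d /= e12 nab nba; rewrite /factor /= !ffunE.
  have [ca|ca] := eqVneq c a.
    have da : d != a by rewrite -ca eq_sym.
    have db : d != b by apply: contraNneq nab => ->; rewrite ca.
    by rewrite (negbTE da) (negbTE db); apply: Uf.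
  have [cb|cb] := eqVneq c b.
    have da : d != a by apply: contraNneq nba => ->; rewrite cb.
    have db : d != b by rewrite -cb eq_sym.
    by rewrite (negbTE da) (negbTE db); apply: Uf.
  have [da|da] := eqVneq d a; first by rewrite UC [RHS]UC; apply: Uf.
  by have [db|db] := eqVneq d b => //; rewrite UC [RHS]UC; apply: Uf.
move=> x x' y y' xx yy; rewrite /prodf; congr (_ * _).
  rewrite big_seq [RHS]big_seq; apply: eq_bigr => e es.
  apply: key => // [i u v|i u u' j uu|]; first exact: wcolC.
    by apply: wcol_const => //; have [] := refine_inj uu.
  by rewrite mem_cat es.
rewrite big_seq [RHS]big_seq; apply: eq_bigr => e es.
apply: key => // [i u v|i u u' j uu|]; first by rewrite /gcol colC.
  by rewrite /gcol; have [_ ->] := refine_inj uu.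
by rewrite mem_cat es orbT.
Qed.

Let prodf01 f : 0 <= prodf s1 s2 f <= 1.
Proof.
rewrite /prodf; apply/andP; split.
  by apply: mulr_ge0; apply: prodr_ge0 => e _; [apply: wcol_ge0|apply: gcol_ge0].
rewrite -[X in _ <= X]mulr1; apply: ler_pM.
- by apply: prodr_ge0 => e _; apply: wcol_ge0.
- by apply: prodr_ge0 => e _; apply: gcol_ge0.
- by rewrite prodr_ile1 // => e _; rewrite wcol_ge0 wcol_le1.
by rewrite prodr_ile1 // => e _; rewrite gcol_ge0 gcol_le1.
Qed.

(** The product is constant on the blocks of [refine p f], so [gcol] may be replaced by its
    densities there; stability bounds their mean square distance from [wcol p]. *)
Let local_step f (i : 'I_3) :
  \sum_x \sum_y (wcol p i x y - gcol i x y) * prodf s1 s2 (upd f x y) <= tau * N ^+ 2.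
Proof.
set p' := refine p f; set h := fun x y => prodf s1 s2 (upd f x y).
have hc : block_const p' h := @prodf_const f.
have -> : \sum_x \sum_y (wcol p i x y - gcol i x y) * h x y = \sum_x \sum_y (wcol p i x y - wcol p' i x y) * h x y.
  have H1 := wcol_proj i hc.
  transitivity ((\sum_x \sum_y wcol p i x y * h x y) - \sum_x \sum_y gcol i x y * h x y).
    by rewrite -sumrB; apply: eq_bigr => x _; rewrite -sumrB; apply: eq_bigr => y _; rewrite mulrBl.
  by rewrite -H1 -sumrB; apply: eq_bigr => x _; rewrite -sumrB; apply: eq_bigr => y _; rewrite mulrBl.
have en : \sum_x \sum_y (wcol p i x y - wcol p' i x y) ^+ 2 <= (tau * N) ^+ 2.
  have /forallP/(_ f) := st; apply: le_trans; rewrite -energy_refine; last by move=> x y /refine_inj[].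
  rewrite [X in _ <= X](bigD1 i) //= lerDl; apply: sumr_ge0 => j _.
  by do 2 (apply: sumr_ge0 => ? _); apply: sqr_ge0.
apply: le_trans (_ : (2 * tau)^-1 * (\sum_x \sum_y (wcol p i x y - wcol p' i x y) ^+ 2) + tau / 2 * N ^+ 2 <= _).
  have -> : N ^+ 2 = \sum_(x : V) \sum_(y : V) 1 by rewrite !sumr_const cardT -cardE expr2 mulr_natr.
  (* AM-GM: [A h <= A^2 / (2 tau) + tau h^2 / 2] *)
  rewrite !mulr_sumr -big_split; apply: ler_sum => x _ /=.
  rewrite !mulr_sumr -big_split; apply: ler_sum => y _ /=; rewrite mulr1.
  have /andP[h0 h1] := prodf01 (upd f x y); rewrite -/(h x y) in h0 h1.
  set A := _ - _; have sq := sqr_ge0 (A - tau * h x y).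
  have hh : h x y * h x y <= 1 by rewrite -[X in _ <= X]mulr1 ler_pM.
  have t2 : 0 < 2 * tau by rewrite mulr_gt0.
  rewrite -(ler_pM2l t2) [X in _ <= X]mulrDr mulVKf ?lt0r_neq0 //.
  have := ler_wpM2l (sqr_ge0 tau) hh; move: sq; rewrite !expr2; move: A (h x y) => A' h'; lra.
have t2 : 0 < 2 * tau by rewrite mulr_gt0.
have := ler_wpM2l (ltW (ltac:(by rewrite invr_gt0) : 0 < (2 * tau)^-1)) en.
have -> : (2 * tau)^-1 * (tau * N) ^+ 2 = tau / 2 * N ^+ 2 by field; rewrite lt0r_neq0.
by move=> le; apply: le_trans (lerD le (lexx _)) _; rewrite -mulrDl -splitr.
Qed.

Lemma hybrid_step : H ((a, b) :: s1) s2 <= H s1 ((a, b) :: s2) + tau * N ^+ k.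
Proof.
rewrite -lerBlDl /H -sumrB.
have N2 : 0 < N ^+ 2 by rewrite exprn_gt0.
rewrite -(ler_pM2l N2) -upd_sum.
have -> : N ^+ 2 * (tau * N ^+ k) = \sum_(f : {ffun 'I_k -> V}) tau * N ^+ 2.
  by rewrite sumr_const card_ffun card_ord -[X in _ = X]mulr_natr natrX -/N; ring.
apply: ler_sum => f _; apply: le_trans (local_step f (chi [set a; b])).
apply: ler_sum => x _; apply: ler_sum => y _; rewrite le_eqVlt; apply/orP; left; apply/eqP.
rewrite {1 2}/prodf !big_cons /factor /= !ffunE !eqxx eq_sym (negbTE ab) /prodf; ring.
Qed.

End Step.

(** Densities are exchanged for true colours one edge at a time. *)
Lemma hybrid s1 s2 : uniq (s1 ++ s2) -> (forall e, e \in s1 ++ s2 -> e.1 < e.2)%N ->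
  H s1 s2 <= H [::] (rev s1 ++ s2) + (size s1)%:R * tau * N ^+ k.
Proof.
elim: s1 s2 => [|[a b] s1 IH] s2 /=; first by rewrite !mul0r addr0.
move=> /andP[abs us] lt.
have ab : (a < b)%N by apply: (lt (a, b)); rewrite inE eqxx.
have step : H ((a, b) :: s1) s2 <= H s1 ((a, b) :: s2) + tau * N ^+ k.
  apply: hybrid_step => [|[c d] es]; first by rewrite -val_eqE neq_ltn ab.
  have cd : (c < d)%N by apply: (lt (c, d)); rewrite inE es orbT.
  split=> /=; first by rewrite -val_eqE neq_ltn cd.
    by apply: contraNneq abs => <-.
  by apply: contraTneq cd => -[-> ->]; rewrite -leqNgt ltnW.
have perm : perm_eq (s1 ++ (a, b) :: s2) ((a, b) :: s1 ++ s2).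
  by rewrite perm_sym -cat_rcons -cat_cons perm_cat2r perm_sym perm_rcons.
apply: le_trans step _; rewrite rev_cons cat_rcons -natr1 !mulrDl mul1r addrA lerD2r.
apply: IH; first by rewrite (perm_uniq perm) /= abs us.
by move=> e; rewrite (perm_mem perm); apply: lt.
Qed.

(** Counting lemma: after all exchanges the sum counts maps that display [chi], and there are none.
    [k * k] bounds the number of exchanges. *)
Lemma rare_template : (forall f : {ffun 'I_k -> V}, exists e : 'I_k * 'I_k, (e.1 < e.2)%N /\
      col (f e.1) (f e.2) != Some (chi [set e.1; e.2])) ->
  \sum_(f : {ffun 'I_k -> V}) \prod_(e : 'I_k * 'I_k | (e.1 < e.2)%N) wcol p (chi [set e.1; e.2]) (f e.1) (f e.2)
  <= (k * k)%:R * tau * N ^+ k.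
Proof.
move=> none; pose s := [seq e : 'I_k * 'I_k <- enum {: 'I_k * 'I_k} | (e.1 < e.2)%N].
have us : uniq (s ++ [::]) by rewrite cats0 filter_uniq ?enum_uniq.
have ls e : e \in s ++ [::] -> (e.1 < e.2)%N by rewrite cats0 mem_filter => /andP[].
have Hs := hybrid us ls.
have E f : prodf s [::] f = \prod_(e : 'I_k * 'I_k | (e.1 < e.2)%N) wcol p (chi [set e.1; e.2]) (f e.1) (f e.2).
  by rewrite /prodf big_nil mulr1 big_filter big_enum_cond.
rewrite -(eq_bigr _ (fun f _ => E f)); apply: le_trans Hs _.
have -> : H [::] (rev s ++ [::]) = 0.
  rewrite /H big1 // => f _; rewrite /prodf big_nil mul1r cats0.
  have [e [lt ne]] := none f; rewrite (big_rem e) /=; last first.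
    by rewrite mem_rev mem_filter lt mem_enum.
  by rewrite {1}/factor /gcol (negbTE ne) mul0r.
rewrite add0r !ler_wpM2r ?exprn_ge0 ?(ltW tau0) ?(ltW N0) // ler_nat.
by rewrite size_filter (leq_trans (count_size _ _)) // -cardE card_prod !card_ord.
Qed.

End Hybrid.

End Regularity.

(** * Clique counts *)

Section Cliques.

Variables (R : realFieldType) (V : finType) (D : rel V).
Hypotheses (DC : symmetric D).
Local Open Scope ring_scope.

Let N : R := #|V|%:R.

Definition cl j (f : {ffun 'I_j -> V}) : bool := [forall a, forall b, (a != b) ==> D (f a) (f b)].

Definition common j (g : {ffun 'I_j -> V}) (x : V) : bool := [forall a, D x (g a)].

Definition deg j (g : {ffun 'I_j -> V}) : R := \sum_x (common g x)%:R.

(** Cliques are counted with their order, so the counts compare directly with powers of [N]. *)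
Definition num_cl j : R := \sum_(f : {ffun 'I_j -> V}) (cl f)%:R.

Definition sq_cl j : R := \sum_(f : {ffun 'I_j -> V} | cl f) deg f ^+ 2.

Definition drop_at j (i : 'I_j.+1) (f : {ffun 'I_j.+1 -> V}) : {ffun 'I_j -> V} := [ffun a => f (lift i a)].

Definition insert_at j (i : 'I_j.+1) (g : {ffun 'I_j -> V}) (x : V) : {ffun 'I_j.+1 -> V} :=
  [ffun a => if unlift i a is Some b then g b else x].

Lemma drop_insert j i (g : {ffun 'I_j -> V}) x : drop_at i (insert_at i g x) = g.
Proof. by apply/ffunP => a; rewrite !ffunE liftK. Qed.

Lemma insert_at_eq j i (g : {ffun 'I_j -> V}) x : insert_at i g x i = x.
Proof. by rewrite ffunE unlift_none. Qed.

Lemma insert_drop j i (f : {ffun 'I_j.+1 -> V}) : insert_at i (drop_at i f) (f i) = f.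
Proof.
by apply/ffunP => a; rewrite ffunE; case: unliftP => [b ->|->]; rewrite ?ffunE.
Qed.

Lemma sum_insert j (i : 'I_j.+1) (F : {ffun 'I_j.+1 -> V} -> R) :
  \sum_f F f = \sum_g \sum_x F (insert_at i g x).
Proof.
rewrite (pair_big predT predT (fun g x => F (insert_at i g x))) /=.
rewrite (reindex (fun p : {ffun 'I_j -> V} * V => insert_at i p.1 p.2)) //=.
exists (fun f => (drop_at i f, f i)) => [[g x]|f] _ /=; first by rewrite drop_insert insert_at_eq.
exact: insert_drop.
Qed.

Lemma cl_insert j (i : 'I_j.+1) g x : cl (insert_at i g x) = cl g && common g x.
Proof.
apply/idP/andP => [/forallP H|[/forallP Hg /forallP Hx]].
  have Hij a b : a != b -> D (insert_at i g x a) (insert_at i g x b).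
    by move=> ab; have /forallP/(_ b)/implyP := H a; apply.
  split; apply/forallP => a.
    apply/forallP => b; apply/implyP => ab; have := Hij (lift i a) (lift i b).
    by rewrite (inj_eq lift_inj) !ffunE !liftK; apply.
  by have := Hij i (lift i a) (neq_lift _ _); rewrite !ffunE unlift_none liftK.
apply/forallP => a; apply/forallP => b; apply/implyP; rewrite !ffunE.
case: unliftP => [a' ->|->]; case: unliftP => [b' ->|->].
- by rewrite (inj_eq lift_inj) => ab; have /forallP/(_ b')/implyP := Hg a'; apply.
- by move=> _; rewrite DC.
- by move=> _; apply: Hx.
by rewrite eqxx.
Qed.

Lemma sum_cl_insert j (i : 'I_j.+1) (F : {ffun 'I_j.+1 -> V} -> R) :
  \sum_(f | cl f) F f = \sum_(g | cl g) \sum_(x | common g x) F (insert_at i g x).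
Proof.
rewrite big_mkcond (sum_insert i) [RHS]big_mkcond /=; apply: eq_bigr => g _.
case: (boolP (cl g)) => cg.
  by rewrite [RHS]big_mkcond; apply: eq_bigr => x _; rewrite cl_insert cg.
by rewrite big1 // => x _; rewrite cl_insert (negbTE cg).
Qed.

Lemma degE j (g : {ffun 'I_j -> V}) : deg g = \sum_(x | common g x) 1.
Proof. by rewrite /deg [RHS]big_mkcond; apply: eq_bigr => x _; case: (common g x). Qed.

Lemma num_clE j : num_cl j = \sum_(f : {ffun 'I_j -> V} | cl f) 1.
Proof. by rewrite /num_cl [RHS]big_mkcond; apply: eq_bigr => x _; case: (cl x). Qed.

Lemma num_clS j : num_cl j.+1 = \sum_(g : {ffun 'I_j -> V} | cl g) deg g.
Proof. by rewrite num_clE (sum_cl_insert ord0); apply: eq_bigr => g _; rewrite degE. Qed.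

Lemma num_cl_ge0 j : 0 <= num_cl j. Proof. by apply: sumr_ge0. Qed.

Lemma num_cl1 : num_cl 1 = N.
Proof.
rewrite num_clE (eq_bigl predT) => [|f]; last first.
  by apply/forallP => a; apply/forallP => b; rewrite !ord1 eqxx.
by rewrite sumr_const card_ffun card_ord expn1.
Qed.

Lemma num_cl2 : num_cl 2 = \sum_x \sum_y (D x y)%:R.
Proof.
rewrite num_clS (eq_bigl predT) => [|f]; last first.
  by apply/forallP => a; apply/forallP => b; rewrite !ord1 eqxx.
rewrite (sum_insert ord0) (big_pred1 [ffun a : 'I_0 => (ltac:(by case: a) : V)]) => [|f]; last first.
  by apply/esym/eqP/ffunP => -[].
apply: eq_bigr => x _; apply: eq_bigr => y _; congr (nat_of_bool _)%:R.
rewrite DC; by apply/forallP/idP => [/(_ ord0)|H a]; rewrite ?(ord1 a) insert_at_eq.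
Qed.

(** Sum of [(deg g - lam)^2 >= 0] over the cliques: Cauchy-Schwarz without a division by
    [num_cl j]. *)
Lemma sq_cl_ge j lam : 0 <= lam -> lam * num_cl j <= num_cl j.+1 -> lam * num_cl j.+1 <= sq_cl j.
Proof.
move=> l0 le; apply: le_trans (_ : 2 * lam * num_cl j.+1 - lam ^+ 2 * num_cl j <= _).
  have := ler_wpM2l l0 le; rewrite expr2; lra.
rewrite num_clS num_clE /sq_cl !mulr_sumr -sumrB; apply: ler_sum => g _.
by rewrite mulr1 -subr_ge0; have := sqr_ge0 (deg g - lam); rewrite !expr2; lra.
Qed.

Lemma facet_sum j (f : {ffun 'I_j.+1 -> V}) : \sum_i deg (drop_at i f) <= N + j%:R * deg f.
Proof.
have -> : N = \sum_(x : V) 1 by rewrite sumr_const.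
rewrite /deg exchange_big mulr_sumr -big_split /=; apply: ler_sum => x _.
have [_|] := boolP (common f x).
  rewrite mulr1 nat1r -[X in _ <= X%:R](card_ord j.+1) -sumr_const.
  by apply: ler_sum => i _; rewrite lern1 leq_b1.
(* If [x] misses [f a], then [x] can extend only the facet that omits [a]. *)
rewrite negb_forall => /existsP[a na]; rewrite mulr0 addr0 (bigD1 a) //= big1 ?addr0 ?lern1 ?leq_b1 //.
move=> i ia; apply/eqP; rewrite pnatr_eq0 eqb0; apply: contra na => /forallP H.
by have [b ab|ab] := unliftP i a; [have := H b; rewrite ffunE -ab|rewrite ab eqxx in ia].
Qed.

(** [facet_sum] summed over all cliques of size [j.+1]: a facet [g] occurs [deg g] times at each
    position and contributes [deg g] each time, whence the squares. *)
Lemma moon_moser_step j : j.+1%:R * sq_cl j <= N * num_cl j.+1 + j%:R * num_cl j.+2.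
Proof.
have -> : j.+1%:R * sq_cl j = \sum_(f : {ffun 'I_j.+1 -> V} | cl f) \sum_i deg (drop_at i f).
  rewrite exchange_big /= (eq_bigr (fun _ => sq_cl j)) => [|i _].
    by rewrite sumr_const card_ord mulr_natl.
  rewrite (sum_cl_insert i); apply: eq_bigr => g _.
  rewrite (eq_bigr (fun _ => deg g)) => [|x _]; last by rewrite drop_insert.
  by rewrite expr2 {3}degE mulr_sumr; apply: eq_bigr => x _; rewrite mulr1.
rewrite num_clE num_clS !mulr_sumr -big_split /=; apply: ler_sum => f _.
by rewrite mulr1; apply: facet_sum.
Qed.

Section Density.

Variable (b : R).
Hypotheses (b0 : 0 <= b) (dens : (1 - b) * N * N <= num_cl 2).

(** The Moon-Moser inequality: with edge density at least [1 - b], the lower bound for the ratio of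
    consecutive clique counts falls by [b * N] per step. *)
Lemma moon_moser j : j.+1%:R * b <= 1 -> N * (1 - j.+1%:R * b) * num_cl j.+1 <= num_cl j.+2.
Proof.
elim: j => [|j IH] jb; first by rewrite num_cl1 mul1r; have := dens; lra.
have jb' : j.+1%:R * b <= 1 by apply: le_trans jb; rewrite ler_wpM2r // ler_nat.
have {}IH := IH jb'.
have l0 : 0 <= N * (1 - j.+1%:R * b) by rewrite mulr_ge0 // subr_ge0.
have S := sq_cl_ge l0 IH.
have M := moon_moser_step j.+1.
have j0 : 0 < j.+1%:R :> R by rewrite ltr0n.
rewrite -(ler_pM2l j0); have := ler_wpM2l (ltW (ltr0Sn R j.+1)) S.
move: M; rewrite -[j.+2%:R]natr1; move: (j.+1%:R) (num_cl j.+2) (num_cl j.+3) (sq_cl j.+1) => J h2 h3 s.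
by move=> *; lra.
Qed.

Lemma sq_cl_density j : j.+1%:R * b <= 1 -> N * (1 - j.+1%:R * b) * num_cl j.+2 <= sq_cl j.+1.
Proof.
by move=> jb; apply: sq_cl_ge (moon_moser jb); rewrite mulr_ge0 // subr_ge0.
Qed.

Lemma many_cliques j th : 0 <= th -> j%:R * b + th <= 1 -> th ^+ j * N ^+ j.+1 <= num_cl j.+1.
Proof.
move=> th0; elim: j => [|j IH] jb; first by rewrite mul1r expr1 num_cl1.
have jj : j%:R * b + th <= 1 by apply: le_trans jb; rewrite lerD2r ler_wpM2r // ler_nat.
have jb' : j.+1%:R * b <= 1 by lra.
apply: le_trans (moon_moser jb').
rewrite exprS [N ^+ j.+2]exprS.
have -> : th * th ^+ j * (N * N ^+ j.+1) = (N * th) * (th ^+ j * N ^+ j.+1) by ring.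
apply: ler_pM; rewrite ?mulr_ge0 ?exprn_ge0 ?IH //.
by rewrite ler_wpM2l //; lra.
Qed.

End Density.

Section Stability.

Variables (r : nat) (pt : V -> nat) (e mu th : R).
Hypotheses (r1 : (1 < r)%N) (V0 : (0 < #|V|)%N).
Hypotheses (e0 : 0 <= e) (th0 : 0 < th) (mu0 : 0 <= mu).
Hypotheses (dens : (1 - (r%:R^-1 + e)) * N * N <= num_cl 2).
Hypotheses (eth : r.-1%:R * (r%:R^-1 + e) + th <= 1).

Let size_part x : R := \sum_y (pt y == pt x)%:R.

Hypothesis few : \sum_(g : {ffun 'I_r.-1 -> V} | cl g)
  \sum_(y | common g y) \sum_(z | common g z) (pt y != pt z)%:R <= mu * N ^+ r.+1.
Hypothesis part_le : forall x, size_part x <= N / r%:R + 1.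

Let N0 : 0 < N. Proof. by rewrite ltr0n. Qed.
Let r0 : 0 < r%:R :> R. Proof. by rewrite ltr0n (ltn_trans _ r1). Qed.

(** For an [(r-1)]-clique [g] with common neighbour [y], the other common neighbours lie in the part
    of [y] except for crossing pairs, so [deg g] is at most [size_part y] plus an error controlled
    by [few]. Summing over [y] and [g] gives the sum of [deg g ^+ 2], bounded below by the edge
    density. *)
Lemma big_part_sum (i : 'I_r) :
  N * (r%:R^-1 - r.-1%:R * e) * num_cl r - mu * N ^+ r.+1 <= \sum_(f : {ffun 'I_r -> V} | cl f) size_part (f i).
Proof.
move: i few dens eth; case: r r1 r0 => [|[|j]] // _ rr i few' dens' eth'; rewrite /= in few' dens' eth' *.
have b0 : 0 <= j.+2%:R^-1 + e by rewrite addr_ge0 // invr_ge0 ltW.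
have S := sq_cl_density b0 dens' (j := j).
have eth2 : j.+1%:R * (j.+2%:R^-1 + e) <= 1 by apply: le_trans eth'; rewrite lerDl ltW.
have {}S := S eth2.
rewrite lerBlDl; apply: le_trans (lerD few' (lexx _)); apply: le_trans (le_trans _ S) _.
  apply: ler_wpM2r; first exact: num_cl_ge0.
  rewrite ler_pM2l // mulrDr.
  have -> : j.+1%:R / j.+2%:R = 1 - j.+2%:R^-1 :> R.
    by rewrite -[j.+2%:R]natr1 -{1}(addrK 1 j.+1%:R) mulrBl mulfV ?natr1 ?pnatr_eq0 // mul1r.
  by rewrite opprD opprB addrA addrCA subrr addr0.
rewrite (sum_cl_insert i) -big_split; apply: ler_sum => g cg /=.
rewrite -big_split expr2 {1}degE mulr_suml; apply: ler_sum => y cy; rewrite mul1r insert_at_eq /=.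
rewrite /size_part /deg [X in _ <= X + _]big_mkcond -big_split; apply: ler_sum => z _ /=.
rewrite [pt y == pt z]eq_sym; case: (common g z); case: (pt z == pt y); rewrite /= ?addr0 ?add0r ?ler_nat //.
Qed.

Let gap_arith (P1 P2 P3 P4 P5 S : R) : (P1 - P3) * P5 - P4 <= S -> P4 <= P2 * P5 ->
  (P1 + 1) * P5 - S <= (1 + P3 + P2) * P5.
Proof. by move=> *; lra. Qed.

(** By [part_le] all terms of [gap] are nonnegative, so an [r]-clique of at most average gap has
    only large parts. The lower bound [th ^+ r.-1 * N ^+ r] for the number of [r]-cliques makes the
    error [mu * N ^+ r.+1] relative to that number. *)
Lemma stability : exists f : {ffun 'I_r -> V}, cl f /\
  forall i, N / r%:R - r%:R * (1 + r.-1%:R * e * N + mu * N / th ^+ r.-1) <= size_part (f i).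
Proof.
have thr : 0 < th ^+ r.-1 by rewrite exprn_gt0.
have b0 : 0 <= r%:R^-1 + e by rewrite addr_ge0 // invr_ge0 ltW.
have hr : th ^+ r.-1 * N ^+ r <= num_cl r.
  by have := many_cliques b0 dens (ltW th0) eth; rewrite prednK // (ltn_trans _ r1).
have hr0 : 0 < num_cl r by apply: lt_le_trans hr; rewrite mulr_gt0 // exprn_gt0.
pose c := r%:R * (1 + r.-1%:R * e * N + mu * N / th ^+ r.-1).
pose gap (f : {ffun 'I_r -> V}) := \sum_i (N / r%:R + 1 - size_part (f i)).
have gle : \sum_(f : {ffun 'I_r -> V} | cl f) gap f <= \sum_(f : {ffun 'I_r -> V} | cl f) c.
  rewrite /gap exchange_big /= [X in _ <= X](_ : _ = c * num_cl r); last first.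
    by rewrite num_clE mulr_sumr; apply: eq_bigr => f _; rewrite mulr1.
  pose c0 := 1 + r.-1%:R * e * N + mu * N / th ^+ r.-1.
  have -> : c * num_cl r = \sum_(i < r) c0 * num_cl r by rewrite sumr_const card_ord /c -mulrA mulr_natl.
  apply: ler_sum => i _; rewrite /c0.
  rewrite sumrB [X in X - _](_ : _ = (N / r%:R + 1) * num_cl r); last first.
    by rewrite num_clE mulr_sumr; apply: eq_bigr => f _; rewrite mulr1.
  have H := big_part_sum i.
  have mh : mu * N ^+ r.+1 <= mu * N / th ^+ r.-1 * num_cl r.
    rewrite mulrAC ler_pdivlMr // exprS -!mulrA ler_wpM2l // ler_wpM2l ?(ltW N0) //.
    by rewrite mulrC.
  have E : N * (r%:R^-1 - r.-1%:R * e) = N / r%:R - r.-1%:R * e * N by ring.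
  by rewrite E in H; apply: gap_arith H mh.
have [f cf gf] : exists2 f : {ffun 'I_r -> V}, cl f & gap f <= c.
  have [/existsP[f /andP[cf gf]]|] := boolP [exists f : {ffun 'I_r -> V}, cl f && (gap f <= c)]; first by exists f.
  rewrite negb_exists => /forallP H; move: gle; rewrite leNgt => /negP[].
  have [f cf] : exists f : {ffun 'I_r -> V}, cl f.
    have [/existsP//|] := boolP [exists f : {ffun 'I_r -> V}, cl f]; rewrite negb_exists => /forallP nf.
    by move: hr0; rewrite num_clE big1 ?ltxx // => f cf; have := nf f; rewrite cf.
  rewrite (bigD1 f) //= [X in _ < X](bigD1 f) //=; apply: ltr_leD.
    by have := H f; rewrite cf /= ltNge.
  by apply: ler_sum => f' /andP[cf' _]; have := H f'; rewrite cf' /= -ltNge => /ltW.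
exists f; split=> // i; rewrite -/c.
have : N / r%:R + 1 - size_part (f i) <= gap f.
  by rewrite /gap (bigD1 i) //= lerDl sumr_ge0 // => j _; rewrite subr_ge0.
by lra.
Qed.

End Stability.

End Cliques.

(** * Templates *)

Section Templates.

Variables (R : archiRealFieldType) (r : nat) (pat : {set 'I_r.+1} -> nat) (a : nat).
Hypotheses (n2 : num_classes pat = 2) (aP : a \in pclasses pat).
Local Notation k := r.+1.
Local Open Scope ring_scope.

Definition homs n (Lam : 'I_n -> 'I_n -> {set 'I_3}) (chi : {set 'I_k} -> 'I_3) : {set {ffun 'I_k -> 'I_n}} :=
  [set f : {ffun 'I_k -> 'I_n} | [forall x : 'I_k, forall y : 'I_k, (x < y)%N ==> (chi [set x; y] \in Lam (f x) (f y))]].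

(** Few maps rather than none is what the counting lemma yields; it is contradicted by clique counts
    of order [n ^+ k]. *)
Definition good_template (xi : R) n (Lam : 'I_n -> 'I_n -> {set 'I_3}) :=
  [forall x, forall y, Lam x y == Lam y x] &&
  [forall chi : {ffun {set 'I_k} -> 'I_3}, pcol (pclass pat a) chi ==> (#|homs Lam chi|%:R <= xi * n%:R ^+ k)].

Definition misses n (pt : 'I_n -> nat) (Lam : 'I_n -> 'I_n -> {set 'I_3}) (c : {ffun {set 'I_n} -> 'I_3}) :=
  [set e : 'I_n * 'I_n | (pt e.1 != pt e.2) && (c [set e.1; e.2] \notin Lam e.1 e.2)].

Section OneColoring.

Variables (n : nat) (pt : 'I_n -> nat) (c : {ffun {set 'I_n} -> 'I_3}).
Hypotheses (n0 : (0 < n)%N) (cE : c \in cols pat (mgr pt)).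

Definition ecol (x y : 'I_n) : option 'I_3 := if pt x != pt y then Some (c [set x; y]) else None.

Lemma ecolC x y : ecol x y = ecol y x.
Proof. by rewrite /ecol eq_sym setUC. Qed.

Lemma ecol_pcol (chi : {ffun {set 'I_k} -> 'I_3}) : pcol (pclass pat a) chi -> forall f : {ffun 'I_k -> 'I_n},
  exists e : 'I_k * 'I_k, (e.1 < e.2)%N /\ ecol (f e.1) (f e.2) != Some (chi [set e.1; e.2]).
Proof.
move=> pchi f; have [/existsP[e /andP[? ?]]|] := boolP [exists e : 'I_k * 'I_k, (e.1 < e.2)%N && (ecol (f e.1) (f e.2) != Some (chi [set e.1; e.2]))].
  by exists e.
rewrite negb_exists => /forallP H.
have {}H x y : x != y -> ecol (f x) (f y) = Some (chi [set x; y]).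
  rewrite -val_eqE neq_ltn => /orP[] lt.
    by have := H (x, y); rewrite lt /= negbK => /eqP.
  by have := H (y, x); rewrite lt /= negbK => /eqP; rewrite ecolC setUC.
have Hpt x y : x != y -> pt (f x) != pt (f y) by move=> /H; rewrite /ecol; case: ifP.
have cf : clique_map (mgr pt) f.
  apply/andP; split.
    by apply/injectiveP => x y fxy; apply/eqP/negPn/negP => /Hpt; rewrite fxy eqxx.
  by apply/forallP => x; apply/forallP => y; apply/implyP => /Hpt; rewrite mgrE.
move: cE; rewrite inE => /andP[_ av].
have [e /edgesKP[x [y [xy ->]]]] := avoids_pcol n2 aP av cf pchi.
by rewrite imset_set2; have := H x y xy; rewrite /ecol Hpt // => -[->]; rewrite eqxx.
Qed.

Variables (de tau xi : R) (p : 'I_n -> nat).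
Hypotheses (de01 : 0 < de <= 1) (tau0 : 0 < tau) (st : stable k ecol tau p).
Hypothesis tau_xi : (k * k)%:R * tau <= xi * de ^+ (k * k).

Let lam x y := [set i | de <= wcol R ecol p i x y].

(** Each map into the lists contributes at least [de ^+ (k * k)] to the sum that the counting lemma
    bounds. *)
Lemma template_good : good_template xi lam.
Proof.
have de0 : 0 < de by case/andP: de01.
have de1 : de <= 1 by case/andP: de01.
have n0' : (0 < #|'I_n|)%N by rewrite card_ord.
apply/andP; split.
  apply/forallP => x; apply/forallP => y; apply/eqP/setP => i.
  by rewrite !inE wcolC //; apply: ecolC.
apply/forallP => chi; apply/implyP => pchi.
have H := rare_template ecolC n0' (chi := chi) tau0 st (ecol_pcol pchi).
rewrite card_ord in H.
have dk : 0 < de ^+ (k * k) by rewrite exprn_gt0.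
rewrite -(ler_pM2l dk); apply: le_trans (_ : (k * k)%:R * tau * n%:R ^+ k <= _); last first.
  by rewrite mulrA ler_wpM2r ?exprn_ge0 // [_ * xi]mulrC.
apply: le_trans H; rewrite mulrC mulr_natl -sumr_const [X in X <= _]big_mkcond; apply: ler_sum => f _.
case: ifP => [|_]; last by apply: prodr_ge0 => e _; apply: wcol_ge0.
rewrite inE => /forallP ff.
apply: le_trans (_ : \prod_(e : 'I_k * 'I_k | (e.1 < e.2)%N) de <= _).
  rewrite prodr_const; apply: ler_wiXn2l => //; first exact: ltW.
  by apply: leq_trans (max_card _) _; rewrite card_prod !card_ord.
apply: ler_prod => e lt; rewrite (ltW de0) /=.
by have /forallP/(_ e.2)/implyP/(_ lt) := ff e.1; rewrite inE.
Qed.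

(** A missed pair has a colour of density below [de] between its blocks; for each of the three
    colours such blocks contain at most [de * n ^+ 2] pairs of that colour. *)
Lemma template_misses : #|misses pt lam c|%:R <= 3 * de * n%:R ^+ 2.
Proof.
have n0' : (0 < #|'I_n|)%N by rewrite card_ord.
have bc i : block_const p (fun x y => (wcol R ecol p i x y < de)%R%:R : R).
  by move=> x x' y y' xx yy; rewrite (@wcol_const R _ ecol p i x x' y y' xx yy).
have -> : #|misses pt lam c|%:R = \sum_x \sum_y \sum_i gcol R ecol i x y * (wcol R ecol p i x y < de)%R%:R.
  rewrite (pair_big predT predT (fun x y => \sum_i gcol R ecol i x y * (wcol R ecol p i x y < de)%R%:R)) /=.
  rewrite -sum1_card natr_sum big_mkcond /=; apply: eq_bigr => -[x y] _.
  rewrite inE /gcol /ecol /=; case: (pt x != pt y) => /=; last by rewrite big1 // => i _; rewrite mul0r.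
  rewrite (bigD1 (c [set x; y])) //= eqxx mul1r big1 ?addr0 => [|i ic].
    by rewrite inE -ltNge; case: (_ < _).
  by rewrite (inj_eq Some_inj) eq_sym (negbTE ic) mul0r.
rewrite (eq_bigr (fun x => \sum_i \sum_y gcol R ecol i x y * (wcol R ecol p i x y < de)%R%:R)); last by move=> x _; rewrite exchange_big.
rewrite exchange_big /= (eq_bigr (fun i => \sum_x \sum_y wcol R ecol p i x y * (wcol R ecol p i x y < de)%R%:R)); last first.
  by move=> i _; rewrite (wcol_proj ecol i (bc i)).
have -> : 3 * de * n%:R ^+ 2 = \sum_(i : 'I_3) \sum_(x : 'I_n) \sum_(y : 'I_n) de.
  by rewrite !sumr_const !card_ord -!mulrnA -[RHS]mulr_natl !natrM; ring.
do 3 (apply: ler_sum => ? _); case: ltP => [lt|_]; first by rewrite mulr1 ltW.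
by rewrite mulr0; case/andP: de01 => /ltW.
Qed.

End OneColoring.

(** [M] is independent of [n] and the lists factor through [M] blocks, so there are only
    [M ^ n * 8 ^ (M * M)] templates to choose from. *)
Lemma template_exists (de xi : R) : 0 < de <= 1 -> 0 < xi -> exists M, (0 < M)%N /\
  forall n (pt : 'I_n -> nat) c, (0 < n)%N -> c \in cols pat (mgr pt) ->
  exists (p : {ffun 'I_n -> 'I_M}) (l : {ffun 'I_M * 'I_M -> {set 'I_3}}),
    let lam x y := l (p x, p y) in good_template xi lam /\ #|misses pt lam c|%:R <= 3 * de * n%:R ^+ 2.
Proof.
move=> de01 xi0; have de0 : 0 < de by case/andP: de01.
pose tau := xi * de ^+ (k * k) / (k * k)%:R.
have kk0 : 0 < (k * k)%:R :> R by rewrite ltr0n.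
have tau0 : 0 < tau by rewrite divr_gt0 // mulr_gt0 // exprn_gt0.
pose K := (Num.bound (tau ^- 2)).
have HK : 1 < K%:R * tau ^+ 2.
  by rewrite -ltr_pdivrMr ?exprn_gt0 // mul1r archi_boundP // invr_ge0 exprn_ge0 // ltW.
pose Q := #|{ffun 'I_k -> option 'I_3}|.
have Q0 : (0 < Q)%N by apply/card_gt0P; exists [ffun=> None].
exists (Q ^ K)%N; split=> [|n pt c n0 cE]; first by rewrite expn_gt0 Q0.
have n0' : (0 < #|'I_n|)%N by rewrite card_ord.
have [p [pQ st]] := stable_partition k (ecol pt c) n0' tau0 HK.
pose pf : {ffun 'I_n -> 'I_(Q ^ K)} := [ffun x => Ordinal (pQ x)].
pose lam x y := [set i | de <= wcol R (ecol pt c) p i x y].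
(* The list of two blocks is read off from any representatives; labels of empty blocks get the empty
   list. *)
pose l : {ffun 'I_(Q ^ K) * 'I_(Q ^ K) -> {set 'I_3}} :=
  [ffun uv => [set i | [exists x, exists y, [&& pf x == uv.1, pf y == uv.2 & i \in lam x y]]]].
have E : (fun x y => l (pf x, pf y)) = lam.
  apply/functional_extensionality => x; apply/functional_extensionality => y.
  apply/setP => i; rewrite ffunE in_set /=; apply/existsP/idP => [[x' /existsP[y' /and3P[/eqP + /eqP + +]]]|il].
    rewrite !ffunE => /(congr1 val) /= xx /(congr1 val) /= yy; rewrite !inE.
    by rewrite (@wcol_const R _ (ecol pt c) p i _ _ _ _ xx yy).
  by exists x; apply/existsP; exists y; rewrite !eqxx.
exists pf, l; rewrite E; split; last exact: template_misses.
apply: (template_good n0 cE de01 tau0 st).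
by rewrite /tau mulrCA mulfV ?mulr1 // lt0r_neq0.
Qed.

End Templates.

(** * Dense colour lists *)

Lemma set3_full (A : {set 'I_3}) i : #|A| == 3 -> i \in A.
Proof.
move=> A3; suff -> : A = [set: 'I_3] by rewrite inE.
by apply/eqP; rewrite eqEcard subsetT cardsT card_ord (eqP A3).
Qed.

Section Lists.

Variables (R : archiRealFieldType) (r : nat) (pat : {set 'I_r.+1} -> nat) (a : nat).
Variables (n : nat) (pt : 'I_n -> nat) (Lam : 'I_n -> 'I_n -> {set 'I_3}) (xi : R).
Hypotheses (n0 : 0 < n) (r0 : 0 < r) (xi0 : (0 <= xi)%R) (good : good_template pat a xi Lam).
Local Notation k := r.+1.
Local Open Scope ring_scope.

Let LamC x y : Lam x y = Lam y x.
Proof. by have /andP[/forallP/(_ x)/forallP/(_ y)/eqP] := good. Qed.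

Definition num_chi := #|{ffun {set 'I_k} -> 'I_3}|.

Definition bad_homs : {set {ffun 'I_k -> 'I_n}} :=
  [set f : {ffun 'I_k -> 'I_n} | [exists chi : {ffun {set 'I_k} -> 'I_3}, pcol (pclass pat a) chi && (f \in homs Lam chi)]].

Lemma card_bad_homs : #|bad_homs|%:R <= num_chi%:R * xi * n%:R ^+ k.
Proof.
apply: (@le_trans _ _ (\sum_(chi : {ffun {set 'I_k} -> 'I_3} | pcol (pclass pat a) chi) #|homs Lam chi|)%:R).
  rewrite ler_nat; have E (chi : {ffun {set 'I_k} -> 'I_3}) : #|homs Lam chi| = (\sum_f (f \in homs Lam chi))%N.
    by rewrite -sum1_card big_mkcond; apply: eq_bigr => f _; case: (_ \in _).
  rewrite (eq_bigr _ (fun chi _ => E chi)) exchange_big /= -sum1_card big_mkcond; apply: leq_sum => f _.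
  case: ifP => //; rewrite inE => /existsP[chi /andP[pchi fchi]].
  by rewrite (bigD1 chi) //= fchi.
rewrite natr_sum -mulrA mulr_natl -sumr_const; rewrite big_mkcond /=; apply: ler_sum => chi _.
have /andP[_ /forallP/(_ chi)/implyP H] := good.
by case: ifP => [pc|_]; [apply: H|rewrite mulr_ge0 // exprn_ge0].
Qed.

Definition list_of (f : {ffun 'I_k -> 'I_n}) (e : {set 'I_k}) : {set 'I_3} :=
  [set i | [exists x, exists y, (e == [set x; y]) && (i \in Lam (f x) (f y))]].

Lemma list_ofE f x y : x != y -> list_of f [set x; y] = Lam (f x) (f y).
Proof.
move=> xy; apply/setP => i; rewrite inE; apply/existsP/idP => [[x' /existsP[y' /andP[/eqP E il]]]|il].
  have : x \in [set x'; y'] by rewrite -E !inE eqxx.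
  have : y \in [set x'; y'] by rewrite -E !inE eqxx orbT.
  rewrite !inE => /orP[]/eqP yy /orP[]/eqP xx; subst x y; rewrite ?eqxx // in xy *.
  by rewrite LamC.
by exists x; apply/existsP; exists y; rewrite eqxx.
Qed.

Lemma bad_homsP f (chi : {ffun {set 'I_k} -> 'I_3}) : pcol (pclass pat a) chi ->
  (forall e, e \in edgesK k -> chi e \in list_of f e) -> f \in bad_homs.
Proof.
move=> pc H; rewrite inE; apply/existsP; exists chi; rewrite pc inE /=.
apply/forallP => x; apply/forallP => y; apply/implyP => xy.
have xy' : x != y by rewrite -val_eqE neq_ltn xy.
by rewrite -list_ofE // H // edgesK2.
Qed.

Definition color_rel (i : 'I_3) : rel 'I_n :=
  fun x y => [&& pt x != pt y, (1 < #|Lam x y|)%N & i \in Lam x y].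

Definition full_rel : rel 'I_n := fun x y => (pt x != pt y) && (#|Lam x y| == 3).

Lemma color_relC i : symmetric (color_rel i).
Proof. by move=> x y; rewrite /color_rel eq_sym LamC. Qed.

Lemma full_relC : symmetric full_rel.
Proof. by move=> x y; rewrite /full_rel eq_sym LamC. Qed.

(** Above the Turán density these pairs would span order [n ^+ k] cliques, each of which, by the
    Ramsey hypothesis, admits a pattern colouring from its lists. *)
Lemma color_density (eta : R) i : ramsey_le (pclass pat a) k ->
  0 < eta -> r%:R * eta <= 1 -> num_chi%:R * xi < (r%:R * eta) ^+ r ->
  \sum_x \sum_y (color_rel i x y)%:R <= (1 - (r%:R^-1 - eta)) * n%:R ^+ 2.
Proof.
move=> HR eta0 reta lt; rewrite leNgt; apply/negP => dens.
have r0R : 0 < r%:R :> R by rewrite ltr0n.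
have th0 : 0 <= r%:R * eta by rewrite mulr_ge0 ?ltW.
have b0 : 0 <= r%:R^-1 - eta by rewrite subr_ge0 -div1r ler_pdivlMr // mulrC.
(* [th = r * eta] is exactly what [b = 1/r - eta] leaves over: [r * b + th = 1]. *)
have := @many_cliques R _ _ (color_relC i) (r%:R^-1 - eta) b0 _ r (r%:R * eta) th0.
rewrite card_ord (num_cl2 R (color_relC i)) -mulrA -expr2 => /(_ (ltW dens)).
rewrite mulrBr mulfV ?lt0r_neq0 // subrK lexx => /(_ isT) many.
have le : num_cl R (color_rel i) k <= #|bad_homs|%:R.
  rewrite /num_cl -natr_sum ler_nat -sum1_card [X in (_ <= X)%N]big_mkcond; apply: leq_sum => f _.
  case: (boolP (cl _ f)) => // /forallP cf.
  have cf' x y : x != y -> color_rel i (f x) (f y) by move=> xy; have /forallP/(_ y)/implyP := cf x; apply.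
  have [|chi pc H] := @ramsey_lists k (pclass pat a) (list_of f) i HR.
    by move=> e /edgesKP[x [y [xy ->]]]; rewrite list_ofE //; have /and3P[] := cf' x y xy.
  by rewrite (bad_homsP pc H).
have := le_trans many (le_trans le card_bad_homs); rewrite leNgt => /negP; apply.
by rewrite ltr_pM2r // exprn_gt0 // ltr0n.
Qed.

End Lists.

(** Let [y], [z] be a crossing pair over a clique [g] of full pairs. If its list is empty, any
    colouring [c] misses the pair; otherwise a colour of the list extends to a pattern colouring
    that the other, full lists admit, and [g], [y], [z] form a bad map. *)
Lemma few_crossing (R : archiRealFieldType) r (pat : {set 'I_r.+1} -> nat) a n (pt : 'I_n -> nat) Lam (xi : R) c :
  (1 < r)%N -> (0 <= xi)%R -> good_template pat a xi Lam ->
  (\sum_(g : {ffun 'I_r.-1 -> 'I_n} | cl (full_rel pt Lam) g)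
     \sum_(y | common (full_rel pt Lam) g y) \sum_(z | common (full_rel pt Lam) g z) (pt y != pt z)%:R
   <= #|misses pt Lam c|%:R * n%:R ^+ r.-1 + (num_chi r)%:R * xi * n%:R ^+ r.+1 :> R)%R.
Proof.
case: r pat => [|[|r]] // pat _ xi0 good; rewrite [r.+2.-1]/=; set H := full_rel pt Lam.
have LamC x y : Lam x y = Lam y x by have /andP[/forallP/(_ x)/forallP/(_ y)/eqP] := good.
pose ff (g : {ffun 'I_r.+1 -> 'I_n}) y z := insert_at ord0 (insert_at ord0 g y) z.
have key (g : {ffun 'I_r.+1 -> 'I_n}) y z : cl H g -> common H g y -> common H g z -> pt y != pt z ->
    Lam y z != set0 -> ff g y z \in bad_homs pat a Lam.
  move=> cg cy cz yz /set0Pn[c0 c0L].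
  have v0 : ff g y z ord0 = z by rewrite insert_at_eq.
  have v1 : ff g y z (lift ord0 ord0) = y by rewrite ffunE liftK insert_at_eq.
  have e0K : [set ord0; lift ord0 ord0] \in edgesK r.+3 by rewrite edgesK2.
  have [chi pc chi0] := pcol_edge (pclass pat a) c0 e0K.
  apply: (bad_homsP good pc) => e /edgesKP[u [v [uv ->]]]; rewrite (list_ofE good) //.
  have cgy : cl H (insert_at ord0 g y) by rewrite cl_insert ?cg //; apply: (full_relC pt good).
  have part u' v' : u' != v' -> [set u'; v'] != [set ord0; lift ord0 ord0] -> #|Lam (ff g y z u') (ff g y z v')| == 3%N.
    have [u1 ->|->] := unliftP ord0 u'; have [v1' ->|->] := unliftP ord0 v'.
    - rewrite (inj_eq lift_inj) => uv1 _; rewrite !ffunE !liftK.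
      by have /forallP/(_ u1)/forallP/(_ v1')/implyP/(_ uv1)/andP[] := cgy.
    - move=> _ ne; rewrite v0 ffunE liftK LamC.
      have [w -> | E] := unliftP ord0 u1; last by case/eqP: ne; rewrite E setUC.
      by rewrite ffunE liftK; have /forallP/(_ w)/andP[] := cz.
    - move=> _ ne; rewrite v0 ffunE liftK.
      have [w -> | E] := unliftP ord0 v1'; last by case/eqP: ne; rewrite E.
      by rewrite ffunE liftK; have /forallP/(_ w)/andP[] := cz.
    by rewrite eqxx.
  have [E|ne] := eqVneq [set u; v] [set ord0; lift ord0 ord0].
    by rewrite -(list_ofE good) // E chi0 (list_ofE good) // v0 v1 LamC.
  exact: set3_full (part _ _ uv ne).
apply: (@le_trans _ _ (\sum_(g : {ffun 'I_r.+1 -> 'I_n}) \sum_y \sum_z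
    (((y, z) \in misses pt Lam c)%:R + (ff g y z \in bad_homs pat a Lam)%:R)))%R.
  rewrite big_mkcond; apply: ler_sum => g _; case: ifP => [cg|_]; last first.
    by do 2 (apply: sumr_ge0 => ? _); rewrite addr_ge0.
  rewrite big_mkcond; apply: ler_sum => y _; case: ifP => [cy|_]; last first.
    by apply: sumr_ge0 => ? _; rewrite addr_ge0.
  rewrite big_mkcond; apply: ler_sum => z _; case: ifP => [cz|_]; last by rewrite addr_ge0.
  case: (boolP (pt y != pt z)) => [yz|_]; last by rewrite addr_ge0.
  have [L0|L0] := eqVneq (Lam y z) set0.
    by rewrite inE /= yz L0 inE lerDl.
  by rewrite (key g y z) // lerDr.
apply: (@le_trans _ _ (#|misses pt Lam c|%:R * n%:R ^+ r.+1 + #|bad_homs pat a Lam|%:R))%R; last first.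
  by rewrite lerD2l; apply: card_bad_homs.
rewrite le_eqVlt; apply/orP; left; apply/eqP.
under eq_bigr do under eq_bigr do rewrite big_split /=.
under eq_bigr do rewrite big_split /=.
rewrite big_split /=; congr (_ + _)%R.
  rewrite sumr_const card_ffun !card_ord -[LHS]mulr_natr natrX; congr (_ * _)%R.
  rewrite (pair_big predT predT (fun y z => (((y, z) \in misses pt Lam c)%:R)%R)) /= -sum1_card natr_sum [RHS]big_mkcond.
  by apply: eq_bigr => -[y z] _ /=; case: (_ \in _).
rewrite -sum1_card natr_sum [RHS]big_mkcond /= [RHS](sum_insert ord0) [RHS](sum_insert ord0).
by do 3 (apply: eq_bigr => ? _); rewrite /ff; case: (_ \in _).
Qed.

(** * Counting the colourings of one template *)

Section TemplateCount.

Variables (R : realType) (r : nat) (pat : {set 'I_r.+1} -> nat) (a : nat).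
Local Open Scope ring_scope.

Lemma sum_ordered_edges n (pt : 'I_n -> nat) (F : {set 'I_n} -> R) :
  2 * (\sum_(e in mgr pt) F e) = \sum_x \sum_y (if pt x != pt y then F [set x; y] else 0).
Proof.
rewrite (pair_big predT predT (fun x y => if pt x != pt y then F [set x; y] else 0)) /= -big_mkcond /=.
rewrite (partition_big (fun p : 'I_n * 'I_n => [set p.1; p.2]) (mem (mgr pt))) /=; last first.
  by move=> [x y] /= xy; rewrite mgrE.
rewrite mulr_sumr; apply: eq_bigr => e eE.
have /eqP/cards2P[x [y [xy ee]]] := is_graph2 (mgr_graph pt) eE.
have ptxy : pt x != pt y by rewrite -mgrE -ee.
rewrite (eq_bigl (fun p => (p == (x, y)) || (p == (y, x)))) => [|[u v]] /=.
  rewrite (bigD1 (x, y)) ?eqxx //= (big_pred1 (y, x)) => [|p] /=.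
    by rewrite -ee [[set y; x]]setUC -ee; ring.
  have [->|np] := eqVneq p (x, y); last by rewrite andbT.
  by rewrite /= xpair_eqE (negbTE xy).
rewrite !xpair_eqE ee; apply/andP/orP => [[uv /eqP E]|].
  have : u \in [set x; y] by rewrite -E !inE eqxx.
  have : v \in [set x; y] by rewrite -E !inE eqxx orbT.
  rewrite !inE => /orP[]/eqP vE /orP[]/eqP uE; move: uv; rewrite vE uE ?eqxx // => _; first [by left|by right].
by case=> /andP[/eqP-> /eqP->]; rewrite ?eqxx // [pt y == _]eq_sym [[set y; x]]setUC eqxx.
Qed.

Lemma tur_ge n : (0 < r)%N -> (1 - r%:R^-1) * (n%:R * n%:R - n%:R) <= 2 * (tur r n)%:R :> R.
Proof.
move=> r0; have r0R : 0 < r%:R :> R by rewrite ltr0n.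
elim: n => [|n IH] /=; first by rewrite !mulr0n subr0 !mulr0.
rewrite natrD natrB ?leq_div //.
have : (n %/ r)%:R <= n%:R / r%:R :> R.
  by rewrite ler_pdivlMr // -natrM ler_nat leq_divM.
rewrite -[n.+1%:R]natr1; set z := (n %/ r)%:R; set w := n%:R / r%:R => zw.
have -> : (1 - r%:R^-1) * ((n%:R + 1) * (n%:R + 1) - (n%:R + 1)) = (1 - r%:R^-1) * (n%:R * n%:R - n%:R) + 2 * (n%:R - w) :> R.
  by rewrite /w; ring.
by rewrite [X in _ <= X]mulrDr lerD // ler_wpM2l // lerD2l lerN2.
Qed.

Lemma template_cover (de xi : R) M n (pt : 'I_n -> nat) : (0 < c3 pat (mgr pt))%N -> 
  (forall c, c \in cols pat (mgr pt) ->
    exists (p : {ffun 'I_n -> 'I_M}) (l : {ffun 'I_M * 'I_M -> {set 'I_3}}),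
    let lam x y := l (p x, p y) in good_template pat a xi lam /\ #|misses pt lam c|%:R <= 3 * de * n%:R ^+ 2) ->
  exists lam, [/\ good_template pat a xi lam,
    exists c, #|misses pt lam c|%:R <= 3 * de * n%:R ^+ 2 &
    (c3 pat (mgr pt) <= M ^ n * 8 ^ (M * M) *
      #|[set c in cols pat (mgr pt) | (#|misses pt lam c|%:R <= 3 * de * n%:R ^+ 2)%R]|)%N].
Proof.
move=> c0 cover.
pose T : finType := ({ffun 'I_n -> 'I_M} * {ffun 'I_M * 'I_M -> {set 'I_3}})%type.
pose lam (t : T) x y := t.2 (t.1 x, t.1 y).
pose F (t : T) : {set {ffun {set 'I_n} -> 'I_3}} :=
  [set c in cols pat (mgr pt) | good_template pat a xi (lam t) && (#|misses pt (lam t) c|%:R <= 3 * de * n%:R ^+ 2)].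
have cT : #|T| = (M ^ n * 8 ^ (M * M))%N.
  by rewrite card_prod !card_ffun card_prod !card_ord -cardsT -powersetT card_powerset cardsT card_ord.
have le : (c3 pat (mgr pt) <= \sum_t #|F t|)%N.
  apply: (@leq_trans (\sum_(c in cols pat (mgr pt)) \sum_t (c \in F t))).
    rewrite -[c3 _ _]/(#|cols pat (mgr pt)|) -sum1_card; apply: leq_sum => c cE.
    have [p [l [gl ml]]] := cover c cE.
    by rewrite (bigD1 (p, l)) //= in_set cE [lam (p, l)]/lam /= gl ml.
  rewrite exchange_big /=; apply: leq_sum => t _; rewrite -sum1_card big_mkcond [X in (_ <= X)%N]big_mkcond.
  by apply: leq_sum => c _; case: (c \in cols _ _); case: (c \in F t).
have T0 : (0 < #|T|)%N.
  have /card_gt0P[c cE] : (0 < #|cols pat (mgr pt)|)%N := c0.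
  by have [p [l _]] := cover c cE; apply/card_gt0P; exists (p, l).
have [t mt] := @bigop.eq_bigmax T (fun t => #|F t|) T0.
have le2 : (c3 pat (mgr pt) <= #|T| * #|F t|)%N.
  apply: leq_trans le _; rewrite -mt -sum_nat_const; apply: leq_sum => s _.
  exact: (@leq_bigmax _ (fun t => #|F t|) s).
have : (0 < #|F t|)%N by have [Z|//] := posnP #|F t|; move: le2; rewrite Z muln0 leqn0 eqn0Ngt c0.
case/card_gt0P => c; rewrite inE => /and3P[cE gl ml].
exists (lam t); split=> //; first by exists c.
apply: leq_trans le2 _; rewrite cT leq_mul2l; apply/orP; right.
by apply: subset_leq_card; apply/subsetP => c'; rewrite !in_set gl.
Qed.

Definition rel_count n (D : rel 'I_n) : R := \sum_x \sum_y (D x y)%:R.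

Definition pair_rel n (pt : 'I_n -> nat) (Lam : 'I_n -> 'I_n -> {set 'I_3}) : rel 'I_n :=
  fun x y => (pt x != pt y) && (#|Lam x y| == 2).

(** The factor of [weighted_count] at an edge whose list has size [s], the colours outside the list
    being rare. *)
Definition list_weight (x : R) s : R := s%:R + x * (3 - s)%:R.

(** Since [ln 1 = 0], lists of size at most 1 contribute no more than [2 * x]; only pairs with two
    or three colours carry entropy. *)
Lemma list_weightP (x : R) : 0 < x <= 100^-1 ->
  (forall s, (s <= 3)%N -> 0 < list_weight x s) /\
  (forall s, (s <= 3)%N -> ln (list_weight x s) <= (s == 3%N)%:R * ln 3 + (s == 2%N)%:R * ln (2 + 100^-1) + 2 * x).
Proof.
move=> /andP[x0 x100].
have w0E : list_weight x 0%N = 3 * x by rewrite /list_weight subn0 add0r mulrC.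
have w1E : list_weight x 1%N = 1 + 2 * x by rewrite /list_weight -[(3 - 1)%N]/2%N mulrC.
have w2E : list_weight x 2%N = 2 + x by rewrite /list_weight -[(3 - 2)%N]/1%N mulr1.
have w3E : list_weight x 3%N = 3 by rewrite /list_weight subnn mulr0 addr0.
split; first by case=> [|[|[|[|]]]] // _; rewrite ?w0E ?w1E ?w2E ?w3E; lra.
case=> [|[|[|[|]]]] // _; rewrite ?w0E ?w1E ?w2E ?w3E /= ?mul0r ?mul1r ?add0r ?addr0.
- by apply: le_trans (ln_le0 _) _; lra.
- by apply: le_ln1Dx; lra.
- by apply: (@le_trans _ _ (ln (2 + 100^-1))); [rewrite ler_ln ?posrE; lra|rewrite lerDl; lra].
by rewrite lerDl; lra.
Qed.

Let count_arith (A D lx S T de N2 : R) : D * - lx <= 3 * de * N2 * - lx -> A + D * lx <= S -> 2 * S <= T ->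
  2 * A <= 6 * de * N2 * - lx + T.
Proof. by move=> *; lra. Qed.

(** Logarithm of [weighted_count], doubled because the relations count ordered pairs. *)
Lemma ln_template_count (x de : R) n (pt : 'I_n -> nat) (Lam : 'I_n -> 'I_n -> {set 'I_3})
    (A : {set {ffun {set 'I_n} -> 'I_3}}) :
  0 < x <= 100^-1 -> 0 <= de -> (forall x y, Lam x y = Lam y x) ->
  A \subset cols pat (mgr pt) -> {in A, forall c, #|misses pt Lam c|%:R <= 3 * de * n%:R ^+ 2 :> R} -> (0 < #|A|)%N ->
  2 * ln #|A|%:R <= 6 * de * n%:R ^+ 2 * ln x^-1 + rel_count (full_rel pt Lam) * ln 3
    + rel_count (pair_rel pt Lam) * ln (2 + 100^-1) + 2 * x * n%:R ^+ 2 :> R.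
Proof.
move=> /andP[x0 x100] de0 LamC AE Am A0.
have x1 : x <= 1 by apply: le_trans x100 _; lra.
pose d := Num.truncn (3 * de * n%:R ^+ 2).
have d0 : 0 <= 3 * de * n%:R ^+ 2 by rewrite !mulr_ge0 // exprn_ge0.
have [dl _] := andP (Num.Theory.truncn_itv d0); rewrite -/d in dl.
pose rare (e : {set 'I_n}) := [set i | [exists x, exists y, (e == [set x; y]) && (i \notin Lam x y)]].
have rareE u v : u != v -> rare [set u; v] = ~: Lam u v.
  move=> uv; apply/setP => i; rewrite !inE; apply/existsP/idP => [[u' /existsP[v' /andP[/eqP E il]]]|il].
    have : u \in [set u'; v'] by rewrite -E !inE eqxx.
    have : v \in [set u'; v'] by rewrite -E !inE eqxx orbT.
    rewrite !inE => /orP[]/eqP vE /orP[]/eqP uE; move: uv il; rewrite vE uE ?eqxx // => _; rewrite 1?LamC //.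
  by exists u; apply/existsP; exists v; rewrite eqxx.
have xx : 0 < x <= 1 by rewrite x0 x1.
have AF : A \subset fam (mgr pt).
  apply/subsetP => c /(subsetP AE); rewrite inE => /andP[/forallP cE _].
  by apply/famP => e eE; apply/eqP; apply: (implyP (cE e)).
have Ad : {in A, forall c : {ffun {set 'I_n} -> 'I_3}, #|[set e in mgr pt | c e \in rare e]| <= d}%N.
  move=> c cA; rewrite /d Num.Theory.truncn_ge_nat //.
  apply: le_trans (Am c cA); rewrite ler_nat.
  apply: (@leq_trans #|[set [set p.1; p.2] | p : 'I_n * 'I_n in misses pt Lam c]|); last exact: leq_imset_card.
  apply: subset_leq_card; apply/subsetP => e; rewrite in_set => /andP[eE].
  have /eqP/cards2P[u [v [uv ee]]] := is_graph2 (mgr_graph pt) eE; subst e.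
  rewrite rareE // in_setC => ce; apply/imsetP; exists (u, v) => //.
  by rewrite inE /= ce andbT; move: eE; rewrite mgrE.
have W := weighted_count xx AF Ad.
have A0R : 0 < #|A|%:R :> R by rewrite ltr0n.
pose w := list_weight x.
have W' : #|A|%:R * x ^+ d <= \prod_(e in mgr pt) w (3 - #|rare e|)%N.
  apply: le_trans W _; rewrite le_eqVlt; apply/orP; left; apply/eqP; apply: eq_bigr => e _.
  by rewrite /w /list_weight subKn // -[X in (_ <= X)%N](card_ord 3) max_card.
have [w0 lw] := list_weightP (introT andP (conj x0 x100)).
have lnprod : ln (\prod_(e in mgr pt) w (3 - #|rare e|)%N) = \sum_(e in mgr pt) ln (w (3 - #|rare e|)%N).
  have [_ //] : 0 < \prod_(e in mgr pt) w (3 - #|rare e|)%N /\ ln (\prod_(e in mgr pt) w (3 - #|rare e|)%N) = \sum_(e in mgr pt) ln (w (3 - #|rare e|)%N).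
  apply: (big_ind2 (fun (A B : R) => 0 < A /\ ln A = B)) => [|A1 B1 A2 B2 [p1 <-] [p2 <-]|e _].
  - by rewrite ltr01 ln1.
  - by rewrite mulr_gt0 // lnM ?posrE.
  by split=> //; apply: w0; rewrite leq_subr.
have lnA : ln #|A|%:R + d%:R * ln x <= \sum_(e in mgr pt) ln (w (3 - #|rare e|)%N).
  rewrite -lnprod -ln_monoX // -lnM ?posrE ?exprn_gt0 // ler_ln ?posrE //.
    by rewrite mulr_gt0 // exprn_gt0.
  by apply: prodr_gt0 => e _; apply: w0; rewrite leq_subr.
have S : 2 * (\sum_(e in mgr pt) ln (w (3 - #|rare e|)%N)) <=
    rel_count (full_rel pt Lam) * ln 3 + rel_count (pair_rel pt Lam) * ln (2 + 100^-1) + 2 * x * n%:R ^+ 2.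
  rewrite (sum_ordered_edges pt (fun e => ln (w (3 - #|rare e|)%N))) /rel_count.
  have -> : 2 * x * n%:R ^+ 2 = \sum_(u < n) \sum_(v < n) 2 * x.
    by rewrite !sumr_const !card_ord -mulrnA -[RHS]mulr_natr natrM expr2.
  rewrite !mulr_suml -!big_split; apply: ler_sum => u _ /=.
  rewrite !mulr_suml -!big_split; apply: ler_sum => v _ /=.
  rewrite /full_rel /pair_rel; case: (boolP (pt u != pt v)) => [uv|_] /=; last by rewrite !mul0r !add0r mulr_ge0 // ltW.
  have uv' : u != v by apply: contraNneq uv => ->.
  have L3 : (#|Lam u v| <= 3)%N by rewrite -[X in (_ <= X)%N](card_ord 3) max_card.
  rewrite rareE //; have -> : (3 - #|~: Lam u v|)%N = #|Lam u v|.
    by rewrite [RHS]cardsCs card_ord.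
  exact: lw.
have lx : ln x^-1 = - ln x by rewrite lnV // posrE.
have lx0 : 0 <= ln x^-1 by rewrite lx oppr_ge0 ln_le0.
by have dx := ler_wpM2r lx0 dl; rewrite lx in dx *; rewrite -!addrA; apply: count_arith dx lnA _; rewrite !addrA.
Qed.

End TemplateCount.

(** * Arithmetic of the constants in the stability argument *)

Section FarArithmetic.

Variable R : realFieldType.
Local Open Scope ring_scope.

(** A linear program in [e3] and [e2]: as [2 * l3 > 3 * l2], trading full pairs for pairs with two
    colours along the second constraint loses entropy, so nearly maximal entropy forces [e2] to be
    small. *)
Lemma full_density_arith (G N2 l3 l2 E e3 e2 eta e : R) :
  0 < l3 -> 0 <= l2 <= l3 -> 0 < 2 * l3 - 3 * l2 -> 0 <= E -> 0 <= eta * l3 * N2 ->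
  G * N2 * l3 - E <= e3 * l3 + e2 * l2 -> 3 * e3 + 2 * e2 <= 3 * ((G + eta) * N2) ->
  (E + eta * l3 * N2) * (3 + 9 * l3 / (2 * l3 - 3 * l2)) <= 3 * (e * l3 * N2) ->
  (G - e) * N2 <= e3.
Proof.
move=> l30 /andP[l20 l23] k0 E0 Q0 H1 H2 H3; have B0 := addr_ge0 E0 Q0; set ka := 2 * l3 - 3 * l2 in k0 H3.
set B := E + eta * l3 * N2 in B0 H3.
have H3' : B * (ka + 3 * l3) <= ka * (e * l3 * N2).
  rewrite -(ler_pM2l (ltac:(by []) : 0 < 3%:R)).
  have -> : 3 * (B * (ka + 3 * l3)) = ka * (B * (3 + 9 * l3 / ka)) by field; rewrite lt0r_neq0.
  have -> : 3 * (ka * (e * l3 * N2)) = ka * (3 * (e * l3 * N2)) by ring.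
  by rewrite ler_pM2l.
have H4 : ka * e2 <= 3 * B.
  have := ler_wpM2r (ltW l30) H2; rewrite /ka /B; lra.
have H5 : ka * (e2 * l2) <= 3 * B * l3.
  rewrite mulrA; apply: le_trans (ler_wpM2r l20 H4) _.
  by apply: ler_wpM2l => //; rewrite mulr_ge0.
rewrite -(ler_pM2r l30) -(ler_pM2l k0).
have H6 := ler_wpM2l (ltW k0) H1.
have H7 : ka * E <= ka * B by rewrite ler_pM2l // /B lerDl.
by move: H3' H5 H6 H7; clearbody B ka; lra.
Qed.

(** One share [u] for each source of error: lower-order terms including the number of templates,
    missed pairs, the weight [x], and the excess density [eta]. *)
Lemma error_arith (G N N2 lM M8 l3 L de x eta u : R) : 0 <= G <= 1 -> 0 <= N -> 0 <= l3 -> 0 <= N2 ->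
  (2 * lM + l3) * N + M8 <= u * N * N -> N2 = N * N -> 6 * de * L <= u -> 2 * x <= u -> eta * l3 <= u ->
  2 * (N * lM) + M8 + G * N * l3 + 6 * de * N2 * L + 2 * x * N2 + eta * l3 * N2 <= 4 * u * N2.
Proof.
move=> /andP[G0 G1] N0 l30 N20 H1 -> H2 H3 H4.
have h1 : G * N * l3 <= N * l3.
  by rewrite -mulrA -[X in _ <= X]mul1r; apply: ler_wpM2r => //; apply: mulr_ge0.
have NN : 0 <= N * N by apply: mulr_ge0.
have h2 := ler_wpM2r NN H2; have h3 := ler_wpM2r NN H3; have h4 := ler_wpM2r NN H4.
by move: h1 h2 h3 h4 H1; clear; lra.
Qed.

Lemma entropy_arith (G N N2 t l3 l2 lc lM M8 lA e3 e2 Y Z : R) :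
  G * (N2 - N) <= 2 * t -> 0 <= l3 -> t * l3 <= lc -> lc <= N * lM + M8 + lA ->
  2 * lA <= Y + e3 * l3 + e2 * l2 + Z ->
  G * N2 * l3 - (2 * (N * lM) + 2 * M8 + G * N * l3 + Y + Z) <= e3 * l3 + e2 * l2.
Proof.
move=> H1 l30 H2 H3 H4; have h1 := ler_wpM2r l30 H1.
by move: h1 H2 H3 H4; clear; lra.
Qed.

Lemma part_arith (r r1 N e mu th S eta P : R) : 0 < r -> 0 < N -> 0 < eta -> 0 < th -> 0 <= r1 <= r -> 0 <= e ->
  r * 4 / eta <= N -> e * (4 * r * r) <= eta -> mu = eta * th / (4 * r) ->
  P - r * (1 + r1 * e * N + mu * N / th) <= S -> P - eta * N <= S.
Proof.
move=> r0 N0 eta0 th0 /andP[r10 r1r] e0 HN He muE H; apply: le_trans H; rewrite lerD2l lerN2.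
move: HN; rewrite ler_pdivrMr // => HN.
have h1 : r * r1 * e * N <= eta * N / 4.
  rewrite ler_pdivlMr //; apply: le_trans (_ : e * (4 * r * r) * N <= _); last by rewrite ler_pM2r.
  have -> : r * r1 * e * N * 4 = r1 * (4 * r * e * N) by ring.
  have -> : e * (4 * r * r) * N = r * (4 * r * e * N) by ring.
  by apply: ler_wpM2r => //; rewrite !mulr_ge0 // ltW.
have -> : r * (1 + r1 * e * N + mu * N / th) = r + r * r1 * e * N + eta * N / 4.
  by rewrite muE; field; rewrite !lt0r_neq0.
have e0N : 0 <= eta * N by rewrite mulr_ge0 // ltW.
by move: h1 HN e0N; clear; lra.
Qed.

Lemma density_arith (r r1 e : R) : 0 < r -> r1 = r - 1 -> e * r <= (2 * r)^-1 -> 0 <= e ->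
  r1 * (r^-1 + e) + (2 * r)^-1 <= 1.
Proof.
move=> r0 -> H e0.
have -> : (r - 1) * (r^-1 + e) + (2 * r)^-1 = 1 - (2 * r)^-1 + e * r - e by field; rewrite lt0r_neq0.
by move: H e0; clear; lra.
Qed.

Lemma few_arith (m CX Q P mu de : R) : 0 <= Q -> 0 <= P -> m <= 3 * de * Q -> 6 * de <= mu -> 2 * CX <= mu ->
  m * P + CX * (Q * P) <= mu * (Q * P).
Proof.
move=> Q0 P0 H1 H2 H3; rewrite mulrA -mulrDl mulrA; apply: ler_wpM2r => //.
have := ler_wpM2r Q0 H2; have := ler_wpM2r Q0 H3; move: H1; clear; lra.
Qed.

End FarArithmetic.

(** The constants are chosen in the order [e], [mu], [u], [eta], [x], [de], [xi], [M], each from its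
    predecessors, and the bound on [n] comes last. *)
Lemma far_parts (R : realType) r (pat : {set 'I_r.+1} -> nat) a (eta' : R) :
  1 < r -> num_classes pat = 2 -> a \in pclasses pat -> ramsey_le (pclass pat a) r.+1 -> (0 < eta')%R ->
  exists n0, forall n (pt : 'I_n -> nat), n0 <= n -> 3 ^ tur r n <= c3 pat (mgr pt) ->
    (forall x, #|[set y | pt y == pt x]|%:R <= n%:R / r%:R + 1 :> R)%R ->
    exists f : 'I_r -> 'I_n, injective (pt \o f) /\
      forall i, ((r%:R^-1 - eta') * n%:R <= #|[set y | pt y == pt (f i)]|%:R)%R.
Proof.
move=> r1 n2 aP HR eta0'; have r0 : 0 < r by apply: ltn_trans r1.
have rR : (0 < r%:R :> R)%R by rewrite ltr0n.
have l3 := ln3_gt0 R; have k0 := three_rare_gain R.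
pose l2 : R := ln (2 + 100^-1)%R.
have l2P : (0 <= l2 <= ln 3)%R.
  by rewrite /l2 ln_ge0 ?ler_ln ?posrE /=; lra.
pose rho : R := (3 + 9 * ln 3 / row_gain R)%R.
have rho0 : (0 < rho)%R by rewrite /rho addr_gt0 // divr_gt0 // mulr_gt0.
pose th : R := (2 * r%:R)^-1%R.
have th0 : (0 < th)%R by rewrite invr_gt0 mulr_gt0.
pose e : R := Num.min (th / r%:R)%R (eta' / (4 * r%:R * r%:R))%R.
have e0 : (0 < e)%R by rewrite lt_min !divr_gt0 // !mulr_gt0.
have e1 : (e * r%:R <= th)%R by rewrite -ler_pdivlMr // ge_min lexx.
have e2 : (e * (4 * r%:R * r%:R) <= eta')%R by rewrite -ler_pdivlMr ?mulr_gt0 // ge_min lexx orbT.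
pose mu : R := (eta' * th ^+ r.-1 / (4 * r%:R))%R.
have mu0 : (0 < mu)%R by rewrite divr_gt0 ?mulr_gt0 // exprn_gt0.
(* Four shares [u], amplified by the factor [rho] of [full_density_arith], use up exactly the
   allowance [3 * e * ln 3]. *)
pose u : R := (3 * e * ln 3 / (4 * rho))%R.
have u0 : (0 < u)%R by rewrite divr_gt0 // ?mulr_gt0.
have uE : (4 * u * rho = 3 * (e * ln 3))%R by rewrite /u; field; rewrite lt0r_neq0.
pose eta : R := Num.min r%:R^-1%R (u / ln 3)%R.
have eta0 : (0 < eta)%R by rewrite lt_min invr_gt0 rR divr_gt0.
have eta1 : (r%:R * eta <= 1)%R by rewrite mulrC -ler_pdivlMr // div1r ge_min lexx.
have eta2 : (eta * ln 3 <= u)%R by rewrite -ler_pdivlMr // ge_min lexx orbT.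
pose x : R := Num.min 100^-1%R (u / 2)%R.
have x0 : (0 < x <= 100^-1)%R.
  by apply/andP; split; [rewrite lt_min invr_gt0 ltr0n divr_gt0|rewrite ge_min lexx].
have x2 : (2 * x <= u)%R.
  have : (x <= u / 2)%R by rewrite ge_min lexx orbT.
  by rewrite ler_pdivlMr // mulrC.
pose L : R := ln x^-1%R.
have L0 : (0 <= L)%R.
  case/andP: x0 => x00 x1; rewrite /L ln_ge0 // invf_ge1 //.
  by apply: le_trans x1 _; rewrite invf_le1 ?ltr0n // ler1n.
have L1 : (0 < L + 1)%R by rewrite ltr_wpDl.
pose de : R := Num.min 1%R (Num.min (mu / 6) (u / (6 * (L + 1))))%R.
have de0 : (0 < de)%R.
  have d1 : (0 < mu / 6)%R by rewrite divr_gt0 // ltr0n.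
  have d2 : (0 < u / (6 * (L + 1)))%R by rewrite divr_gt0 // mulr_gt0 // ltr0n.
  by rewrite !lt_min ltr01 d1 d2.
have de1 : (de <= 1)%R by rewrite ge_min lexx.
have de2 : (6 * de <= mu)%R by rewrite mulrC -ler_pdivlMr // !ge_min lexx orbT.
have de3 : (6 * de * L <= u)%R.
  have : (de * (6 * (L + 1)) <= u)%R by rewrite -ler_pdivlMr ?mulr_gt0 // !ge_min lexx !orbT.
  apply: le_trans; rewrite [(6 * de)%R]mulrC -mulrA ler_pM2l // ler_pM2l // lerDl //.
have C0 : 0 < num_chi r by apply/card_gt0P; exists [ffun=> ord0].
have CR : (0 < (num_chi r)%:R :> R)%R by rewrite ltr0n.
pose xi : R := Num.min (mu / (2 * (num_chi r)%:R))%R ((r%:R * eta) ^+ r / (2 * (num_chi r)%:R))%R.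
have pr0 : (0 < (r%:R * eta) ^+ r)%R by rewrite exprn_gt0 // mulr_gt0.
have CR2 : (0 < 2 * (num_chi r)%:R :> R)%R by rewrite mulr_gt0.
have xi0 : (0 < xi)%R by rewrite lt_min; apply/andP; split; apply: divr_gt0.
have xi1 : (2 * ((num_chi r)%:R * xi) <= mu)%R.
  by rewrite mulrA mulrC -ler_pdivlMr ?mulr_gt0 // ge_min lexx.
have xi2 : ((num_chi r)%:R * xi < (r%:R * eta) ^+ r)%R.
  have : (2 * ((num_chi r)%:R * xi) <= (r%:R * eta) ^+ r)%R.
    by rewrite mulrA mulrC -ler_pdivlMr ?mulr_gt0 // ge_min lexx orbT.
  have : (0 < (num_chi r)%:R * xi)%R by rewrite mulr_gt0.
  by move: (_ * xi)%R (_ ^+ r)%R => A B; lra.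
have de01 : (0 < de <= 1)%R by rewrite de0.
have [M [M0 HM]] := template_exists n2 aP de01 xi0.
have [na Ha] := @quadratic_eventually R u (2 * ln M%:R + ln 3) (2 * (M * M)%:R * ln 8)%R u0.
have [nb Hb] := natr_unbounded (r%:R * 4 / eta')%R.
exists (maxn 1 (maxn na nb)) => n pt; rewrite !geq_max => /and3P[n0 /Ha{}Ha /Hb{}Hb] c3n ptle.
have nR : (0 < n%:R :> R)%R by rewrite ltr0n.
have c30 : 0 < c3 pat (mgr pt) by apply: leq_trans c3n; rewrite expn_gt0.
have [lam [good [c cm] cle]] := template_cover c30 (fun c cE => HM n pt c n0 cE).
set A := [set c in cols pat (mgr pt) | _] in cle.
have A0 : 0 < #|A| by have [Z|//] := posnP #|A|; move: cle; rewrite Z muln0 leqn0 eqn0Ngt c30.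
have lamC u' v' : lam u' v' = lam v' u' by have /andP[/forallP/(_ u')/forallP/(_ v')/eqP] := good.
have AE : A \subset cols pat (mgr pt) by apply/subsetP => c'; rewrite in_set => /andP[].
have Am : {in A, forall c, (#|misses pt lam c|%:R <= 3 * de * n%:R ^+ 2 :> R)%R}.
  by move=> c'; rewrite in_set => /andP[].
have HA := ln_template_count x0 (ltW de0) lamC AE Am A0; rewrite -/L -/l2 in HA.
set e3 := rel_count R (full_rel pt lam) in HA; set e2c := rel_count R (pair_rel pt lam) in HA.
pose G : R := (1 - r%:R^-1)%R.
have rV1 : (r%:R^-1 <= 1 :> R)%R by rewrite invf_le1 // ler1n.
have G01 : (0 <= G <= 1)%R by rewrite /G subr_ge0 rV1 gerBl invr_ge0 ltW.
have MR : (0 < M%:R :> R)%R by rewrite ltr0n.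
have AR : (0 < #|A|%:R :> R)%R by rewrite ltr0n.
have c3R : (0 < (c3 pat (mgr pt))%:R :> R)%R by rewrite ltr0n.
have Hc : (ln (c3 pat (mgr pt))%:R <= n%:R * ln M%:R + (M * M)%:R * ln 8 + ln #|A|%:R :> R)%R.
  have P1 : (0 < M%:R ^+ n :> R)%R by rewrite exprn_gt0.
  have P2 : (0 < 8 ^+ (M * M) :> R)%R by rewrite exprn_gt0.
  have P12 := mulr_gt0 P1 P2; have P := mulr_gt0 P12 AR.
  have -> : (n%:R * ln M%:R + (M * M)%:R * ln 8 + ln #|A|%:R = ln (M%:R ^+ n * 8 ^+ (M * M) * #|A|%:R) :> R)%R.
    by rewrite lnM ?posrE // lnM ?posrE // !ln_monoX.
  by rewrite ler_ln ?posrE // -!natrX -!natrM ler_nat.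
have Ht : ((tur r n)%:R * ln 3 <= ln (c3 pat (mgr pt))%:R :> R)%R.
  have P3 : (0 < 3 ^+ tur r n :> R)%R by rewrite exprn_gt0.
  by rewrite -ln_monoX // ler_ln ?posrE // -natrX ler_nat.
have H1 := entropy_arith (tur_ge R n r0) (ltW l3) Ht Hc HA; rewrite -/G -expr2 in H1.
have H2 : (3 * e3 + 2 * e2c <= 3 * ((G + eta) * n%:R ^+ 2))%R.
  (* A pair whose list has size 2 or 3 lies in [color_rel] for exactly that many colours. *)
  have -> : (3 * e3 + 2 * e2c = \sum_(i : 'I_3) rel_count R (color_rel pt lam i))%R.
    rewrite /rel_count exchange_big /= !mulr_sumr -big_split; apply: eq_bigr => y _ /=.
    rewrite exchange_big /= !mulr_sumr -big_split; apply: eq_bigr => z _ /=.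
    rewrite /full_rel /pair_rel /color_rel; case: (pt y != pt z) => /=; last first.
      by rewrite !mulr0 addr0 big1.
    have LS : (\sum_(i : 'I_3) (i \in lam y z)%:R = #|lam y z|%:R :> R)%R.
      by rewrite -sum1_card natr_sum [RHS]big_mkcond; apply: eq_bigr => i _; case: (_ \in _).
    have L3 : #|lam y z| <= 3 by rewrite -[X in _ <= X](card_ord 3) max_card.
    case: (ltnP 1 #|lam y z|) => [lt|le] /=.
      rewrite LS; move: lt L3; case: (#|lam y z|) => [|[|[|[|]]]] //= _ _; rewrite !mulr0 ?mulr1 ?addr0 ?add0r //.
    by rewrite big1 //; move: le; case: (#|lam y z|) => [|[|]] //= _; rewrite !mulr0 addr0.
  have -> : (3 * ((G + eta) * n%:R ^+ 2) = \sum_(i : 'I_3) (1 - (r%:R^-1 - eta)) * n%:R ^+ 2)%R.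
    by rewrite sumr_const card_ord /G -mulr_natl; ring.
  apply: ler_sum => i _; exact: (color_density pt n0 r0 (ltW xi0) good i HR eta0 eta1 xi2).
have nn0 : (0 <= n%:R ^+ 2 :> R)%R by rewrite exprn_ge0.
have E4 := error_arith G01 (ltW nR) (ltW l3) nn0 Ha (expr2 _) de3 x2 eta2.
have dens : ((G - e) * n%:R ^+ 2 <= e3)%R.
  apply: (full_density_arith l3 l2P k0 _ _ H1 H2).
  - have [G0 _] := andP G01; have M1 : (1 <= M%:R :> R)%R by rewrite ler1n.
    have [x00 _] := andP x0; have lM0 := ln_ge0 M1; have l80 : (0 <= ln 8 :> R)%R by rewrite ln_ge0 // ler1n.
    by rewrite !addr_ge0 // ?mulr_ge0 // ?mulr_ge0 // ?mulr_ge0 // ?(ltW l3) // ?(ltW x00) // ?(ltW de0) // ?(ltW nR).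
  - by rewrite !mulr_ge0 // ltW.
  rewrite -/(row_gain R) -/rho; move: E4; rewrite -[(2 * _ * ln 8)%R]mulrA => /(ler_wpM2r (ltW rho0)).
  move/le_trans; apply; rewrite mulrAC uE; rewrite le_eqVlt; apply/orP; left; apply/eqP; ring.
have [f [cf fsz]] : exists f : {ffun 'I_r -> 'I_n}, cl (full_rel pt lam) f /\ forall i,
   (n%:R / r%:R - r%:R * (1 + r.-1%:R * e * n%:R + mu * n%:R / th ^+ r.-1) <= \sum_y (pt y == pt (f i))%:R)%R.
  have fC : symmetric (full_rel pt lam) := full_relC pt good.
  have Vn : #|'I_n| = n by rewrite card_ord.
  have := @stability R _ (full_rel pt lam) fC r pt e mu th r1; rewrite Vn; apply.
  - by [].
  - exact: ltW.
  - by [].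
  - exact: ltW.
  - by rewrite num_cl2 // opprD addrA -mulrA -expr2.
  - apply: density_arith rR _ e1 (ltW e0); by rewrite -subn1 natrB.
  - have FC := @few_crossing R r pat a n pt lam xi c r1 (ltW xi0) good.
    apply: le_trans FC _.
    have -> : (n%:R ^+ r.+1 = n%:R ^+ 2 * n%:R ^+ r.-1 :> R)%R.
      by rewrite -exprD; congr (_ ^+ _)%R; rewrite -[in LHS](prednK r0).
    by apply: few_arith cm de2 xi1; rewrite exprn_ge0.
  move=> y; apply: le_trans (ptle y); rewrite -natr_sum ler_nat -sum1_card [X in _ <= X]big_mkcond.
  by apply: leq_sum => z _; rewrite inE; case: (_ == _).
exists f; split=> [i j ij|i].
  apply/eqP/negPn/negP => nij; have /forallP/(_ i)/forallP/(_ j)/implyP/(_ nij)/andP[] := cf.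
  by move: ij; rewrite /= => ->; rewrite eqxx.
have r1r : (0 <= (r.-1%:R : R) <= r%:R)%R by rewrite ler0n ler_nat leq_pred.
have thr0 : (0 < th ^+ r.-1)%R by rewrite exprn_gt0.
have := part_arith rR nR eta0' thr0 r1r (ltW e0) Hb e2 (erefl _) (fsz i).
rewrite -natr_sum mulrBl [(r%:R^-1 * _)%R]mulrC => /le_trans; apply.
rewrite ler_nat -[X in _ <= X]sum1_card [X in _ <= X]big_mkcond.
by apply: leq_sum => z _; rewrite inE; case: (_ == _).
Qed.

Theorem theorem1p3 (k : nat) (pat : {set 'I_k} -> nat) :
  3 <= k ->
  num_classes pat = 2 ->
  (exists a, a \in pclasses pat /\ ramsey_le (pclass pat a) k) ->
  exists N, forall n, N <= n -> c3 pat (turan (k - 1) n) = c3max pat n.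
Proof.
case: k pat => // r pat r2 n2 [a [aP HR]]; rewrite subn1 /=; have r1 : 1 < r := r2.
pose R : realType := Rdefinitions.R.
have [eta [eta0 [n1 near]]] := near_progress R r1 n2 aP.
have [n3 far] := far_parts r1 n2 aP HR eta0.
have r0 : 0 < r by apply: ltn_trans r1.
apply: (@turan_extremal _ pat r (maxn n1 n3)); first by rewrite r1 ltnSn.
move=> n pt; rewrite geq_max => /andP[nn1 nn3] ps c3n.
(* A vertex in a part of size at least [n %/ r + 2] has degree at most [n - n %/ r - 1] and can be
   deleted at once. Otherwise all parts satisfy the upper bound that [far] requires. *)
have [/existsP[x xl]|] := boolP [exists x, (n %/ r).+1 < #|[set y | pt y == pt x]|].
  exists x; apply: leq_trans (c3_delete pat pt x) _.
  rewrite leq_mul2l leq_exp2l // card_neq_part; apply/orP; right.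
  by move: xl; move: (n %/ r) #|_| => q s; lia.
rewrite negb_exists => /forallP small.
have [|f [finj fsz]] := far n.+1 pt (leqW nn3) c3n.
  move=> x; have := small x; rewrite -leqNgt -(ler_nat R) => /le_trans; apply.
  rewrite -natr1 lerD2r ler_pdivlMr ?ltr0n // -natrM ler_nat.
  by apply: leq_trans (leq_divM _ _) (leqnSn _).
apply: (near n pt (fun i => pt (f i))) => // j.
by rewrite natr1; apply: fsz.
Qed.
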